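(* Let $(a_i)_{i\ge1}$ be an i.i.d. sequence of real random variables with common probability density function $\rho$, where $\|\rho\|_\infty\le M_A<\infty$ and $\rho$ is fluctuation regular. For each $n$, let $b_1,\dots,b_{n-1}$ (possibly depending on $n$) be positive random variables such that $a_1,\dots,a_n,b_1,\dots,b_{n-1}$ are independent, and assume that there are constants $T>1$ and $M_B$, independent of $n$, with $\mathbb E[b_i^T]\le M_B$ for $i=1,\dots,n-1$. Let $J_n$ be the $n\times n$ Jacobi matrix with diagonal $a_1,\dots,a_n$ and subdiagonal $b_1,\dots,b_{n-1}$, and $G_n(z)=(J_n-z)^{-1}$. Let $0<s<\frac12$ and $\Lambda>0$. Then there are positive constants $M,\gamma,M_s$, independent of $n$, such that $\mathbb E[|G_n(\lambda;x,y)|^s]\le Me^{-\gamma|x-y|}$ for all $n$, all $\lambda\in[-\Lambda,\Lambda]$ and all $x,y\in\{1,\dots,n\}$, and, with the same $\gamma$, $$\mathbb E\big[|G_n(z;y,x)|^{s/2}\big]\le M_se^{-\frac\gamma2|y-x|}\quad\text{for } y\in\{1,n\},\ x\in\{1,\dots,n\},$$ for all $n$ and all $z=\lambda+i\tau$ with $\lambda\in[-\Lambda,\Lambda]$, $\tau\in\mathbb R$.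
   Context: A Jacobi matrix is a symmetric tridiagonal matrix with positive subdiagonal entries. $G_n(z;x,y)$ denotes the $(x,y)$ entry of $G_n(z)$ (for real $z$ it is defined almost surely). A probability density $\rho$ on $\mathbb R$ (or a random variable with this density) is called fluctuation regular if there are positive constants $\varepsilon,\delta$ and a measurable set $R\subset\mathbb R$ with $\int_R\rho(a)\,da>0$ such that for every $a\in R$ and all $x_1,x_2\in(a-\varepsilon,a+\varepsilon)$ one has $\rho(x_1)/\rho(x_2)\ge\delta$. *)

(* Defs.v *)
From HB Require Import structures.
From mathcomp Require Import all_boot all_order all_algebra finmap complex.
From mathcomp Require Import all_classical all_reals all_analysis.

Set Implicit Arguments.
Unset Strict Implicit.
Unset Printing Implicit Defensive.

Import Order.TTheory GRing.Theory Num.Theory.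
Import numFieldNormedType.Exports.

Local Open Scope classical_set_scope.
Local Open Scope ring_scope.
Local Open Scope complex_scope.

Definition is_pdf (R : realType) (rho : R -> R) : Prop :=
  [/\ measurable_fun setT rho,
      forall x, 0 <= rho x
    & (\int[lebesgue_measure]_x (rho x)%:E = 1)%E].

Definition has_pdf (d : measure_display) (Omega : measurableType d)
    (R : realType) (P : probability Omega R) (X : {RV P >-> R})
    (rho : R -> R) : Prop :=
  forall A : set R, measurable A ->
    distribution P X A = (\int[lebesgue_measure]_(x in A) (rho x)%:E)%E.

(* Since [u / 0 = 0] here and [0 < delta], the last inequality forces
   [rho x2 != 0]: the quotient is only ever taken where it makes sense. *)
Definition fluctuation_regular (R : realType) (rho : R -> R) : Prop :=
  exists (eps delta : R) (S : set R),
    [/\ 0 < eps, 0 < delta, measurable S,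
        (0 < \int[lebesgue_measure]_(x in S) (rho x)%:E)%E
      & forall a x1 x2, S a ->
          x1 \in `]a - eps, a + eps[ -> x2 \in `]a - eps, a + eps[ ->
          delta <= rho x1 / rho x2].

Definition mutually_independent (d : measure_display)
    (Omega : measurableType d) (R : realType) (P : probability Omega R)
    (I : choiceType) (X : I -> {RV P >-> R}) : Prop :=
  forall (F : {fset I}) (B : I -> set R), (forall i, measurable (B i)) ->
    P (\bigcap_(i in [set` F]) (X i @^-1` B i)) =
    (\prod_(i <- F) P (X i @^-1` B i))%E.

(* Indices start at 0: [a i] and [b i] stand for a_(i+1) and b_(i+1). *)
Definition jacobi_family (d : measure_display) (Omega : measurableType d)
    (R : realType) (P : probability Omega R) (n : nat)
    (a b : nat -> {RV P >-> R}) (k : 'I_n + 'I_n.-1) : {RV P >-> R} :=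
  match k with inl i => a i | inr j => b j end.

Definition jacobi_mx (R : realType) (n : nat) (a b : nat -> R) : 'M[R]_n :=
  \matrix_(i, j)
    if i == j then a i
    else if (j == i.+1 :> nat)%N then b i
    else if (i == j.+1 :> nat)%N then b j
    else 0.

(* [invmx A] is [A] itself when [A] is singular; this concerns only the
   real [z] in the spectrum of [J]. *)
Definition resolvent (R : realType) (n : nat) (J : 'M[R]_n) (z : R[i]) :
    'M[R[i]]_n :=
  invmx (map_mx (real_complex R) J - z%:M).

Definition green (d : measure_display) (Omega : measurableType d)
    (R : realType) (P : probability Omega R) (n : nat)
    (a b : nat -> {RV P >-> R}) (z : R[i]) (x y : 'I_n) (w : Omega) : R[i] :=
  resolvent (jacobi_mx n (fun i => a i w) (fun i => b i w)) z x y.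

(* Main.v *)
Require Import Defs.
From HB Require Import structures.
From mathcomp Require Import all_boot all_order all_algebra finmap complex.
From mathcomp Require Import all_classical all_reals all_analysis.
From mathcomp Require Import measurable_realfun.
From mathcomp Require Import ring lra zify.

(** The pivots of [J - lambda], [v_0 = a_0 - lambda] and
    [v_(k+1) = a_(k+1) - lambda - b_k^2 / v_k], express the Green function:
    elimination from both ends of the matrix gives, for [x <= y],

      [|G(x, y)| = (prod_(x <= k < y) b_k / |v_k|) / |v_y - r_y|]

    where [r_y] is a function of the entries to the right of site [y] only
    ([normc_green_real]).  Everything rests on the exponential decay of a
    fractional moment of this product ([resolvent_moment_decay]).

    Let [nu] be the law of [a_k - lambda] and [avg f u] the [nu]-mean of
    [f (a + u)].  Conditionally on the [b_k] and on what lies outside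
    the sites [x .. y], the expectation of [(prod_k b_k / |v_k|) f (v_y)] is
    obtained by iterating [f -> (b / |v|) avg f (- b^2 / v)], one step for each
    site ([chain_expectation]).  In [L^2] of the line this is an average
    followed by an isometry, since [v -> - b^2 / v] has Jacobian [b^2 / v^2].
    Two consecutive averages strictly contract the norm
    ([sqnorm_step_contraction]).  Indeed the squared norm lost by an average
    is the mean of [|f (. + a) - f (. + a')|^2] over independent [a], [a'] of
    law [nu]; as the density of [nu] is bounded, [a - a'] is often bounded
    away from 0, so a small loss makes [f] nearly invariant under a macroscopic
    translation and leaves little of its mass on any given bounded interval.  But
    for [b <= B] the inversion exchanges the inside and the outside of [[-B, B]],
    so that a function and its inversion cannot both have little mass there.
    The contraction factor depends only on [B] and on the bound [M] of the
    density; translating the law by [lambda] does not change the latter, so that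
    all estimates are uniform in the energy.
    Steps with [b > B] do not increase the norm, and the moment bound on the
    [b_k] makes [b_k <= B] an event of probability at least 1/2 for a suitable
    [B]; independence of the [b_k] then yields a geometric factor.

    The function [1 / |v - r|] is not square integrable, but
    [h = min (1, 1 / |v - r|)] is.  Young's inequality bounds the moment of order
    [s] of [Z / |V|], for a product [Z] and [V = v_y - r_y], by the mean of [Z h]
    and that of [(|V| h) ^ (- s / (1 - s))]; the latter is finite because
    [s / (1 - s) < 1] and [V] is [a_y] minus an independent variable.

    Off the real axis only the first and the last row are concerned.  For the first one,
    [G(x, 0)] is the product of the [b_k], [k < x], over that of the right
    pivots [w_k], [k <= x], computed from the last site backwards.  The
    imaginary parts of the [w_k] all have the sign of [- tau], which allows one
    to bound [prod_(k <= x) |w_k|] below by [prod_(k < x) |v_k|] times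
    [|v_x - r_x|], with the real pivots [v_k] of the matrix at energy [lambda]
    and a real [r_x] depending on the entries to the right of [x]
    ([prod_rpivot_ge_real]): the real estimate applies again.  The last row
    becomes the first one when the matrix is read backwards. *)

Set Implicit Arguments.
Unset Strict Implicit.
Unset Printing Implicit Defensive.

Import Order.TTheory GRing.Theory Num.Theory.
Import numFieldNormedType.Exports.
Import ComplexField.Normc.

Local Open Scope classical_set_scope.
Local Open Scope ring_scope.
Local Open Scope complex_scope.

Local Notation mu := (@lebesgue_measure _).

(** * Lebesgue measure under translations and inversions *)

Section lebesgue_translation.
Context {R : realType}.

Lemma ge0_integral_translation (c : R) (F : R -> \bar R) :
  measurable_fun [set: R] F -> (forall x, 0 <= F x)%E ->
  (\int[mu]_x F (x + c)%R = \int[mu]_x F x)%E.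
Proof.
move=> mF F0.
have mph : measurable_fun setT (fun x : measurableTypeR R => (x + c : measurableTypeR R)).
  exact: measurable_funD.
have /= := @ge0_integral_pushforward _ _ _ _ R _ mph mu setT F measurableT mF (fun y _ => F0 y).
rewrite preimage_setT => <-.
apply: eq_measure_integral => A mA _; apply/esym.
apply: (@lebesgue_measure_unique R (pushforward mu
  (fun x : measurableTypeR R => (x + c : measurableTypeR R)))) => //.
move=> _ [[a b]] _ <- /=.
rewrite /pushforward /=.
have -> : (fun x : R => x + c) @^-1` `]a, b]%classic = `]a - c, b - c]%classic.
  by apply/seteqP; split => x /=; rewrite !in_itv /= ltrBlDr lerBrDr.
rewrite !lebesgue_measure_itv /= !lte_fin ltrD2r.
by case: ifPn => // _; rewrite -!EFinD; congr EFin; lra.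
Qed.
End lebesgue_translation.

Lemma measurable_inv {R : realType} : measurable_fun [set: R] (@GRing.inv R).
Proof.
(* [powR] is known to be measurable, and the formula also holds at 0. *)
have -> : @GRing.inv R = (fun x : R => x * (x ^+ 2) `^ (-1)).
  apply/funext => x; rewrite powR_inv1 ?sqr_ge0//.
  have [->|x0] := eqVneq x 0; first by rewrite invr0 mul0r.
  by field.
apply: measurable_funM => //.
by apply: (measurableT_comp (measurable_powR (-1))); exact: measurable_funX.
Qed.

Lemma measurable_funV d (T : measurableType d) {R : realType} (D : set T)
    (f : T -> R) : measurable_fun D f -> measurable_fun D (fun x => (f x)^-1).
Proof. by move=> mf; exact: (measurableT_comp measurable_inv). Qed.

Section weighted_image.
Context d d' (T : measurableType d) (T' : measurableType d') {R : realType}.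
Variables (m : {measure set T -> \bar R}) (phi : T -> T') (w : T -> R).

Definition weighted_image of measurable_fun setT phi & measurable_fun setT w
    & (forall x, 0 <= w x) : set T' -> \bar R :=
  fun A => (\int[m]_(x in phi @^-1` A) (w x)%:E)%E.

Hypotheses (mphi : measurable_fun setT phi) (mw : measurable_fun setT w).
Hypothesis w0 : forall x, 0 <= w x.

Local Notation nu := (weighted_image mphi mw w0).

Let mpre (A : set T') : measurable A -> measurable (phi @^-1` A).
Proof. by move=> mA; rewrite -[X in measurable X]setTI; exact: mphi. Qed.

Let weighted_image0 : nu set0 = 0%E.
Proof. by rewrite /weighted_image preimage_set0 integral_set0. Qed.

Let weighted_image_ge0 A : (0 <= nu A)%E.
Proof. by apply: integral_ge0 => x _; rewrite lee_fin. Qed.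

Let weighted_image_sigma_additive : semi_sigma_additive nu.
Proof.
move=> /= F mF tF mUF; rewrite /weighted_image; apply: cvg_toP.
  apply: ereal_nondecreasing_is_cvgn => k n kn.
  by apply: lee_sum_nneg_natr => // i _ _; exact: weighted_image_ge0.
rewrite preimage_bigcup ge0_integral_bigcup//=.
- by move=> n; exact: mpre.
- by apply: measurable_funTS; exact/measurable_EFinP.
- by move=> x _; rewrite lee_fin.
- apply/trivIsetP => /= i j _ _ ij; rewrite -preimage_setI.
  by move/trivIsetP : tF => /(_ _ _ _ _ ij) ->//; rewrite preimage_set0.
Qed.

HB.instance Definition _ := isMeasure.Build _ _ _ nu
  weighted_image0 weighted_image_ge0 weighted_image_sigma_additive.

Import HBNNSimple.

(** The change of variables formula, [w] being the Jacobian. It suffices to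
    identify [m'] with the image of [w dm] as set functions; the equality of
    integrals follows by approximation by simple functions. *)
Lemma ge0_integral_weighted_image (m' : {measure set T' -> \bar R}) (F : T' -> \bar R) :
  (forall A, measurable A -> m' A = nu A) ->
  measurable_fun setT F -> (forall y, 0 <= F y)%E ->
  (\int[m']_y F y = \int[m]_x (F (phi x) * (w x)%:E))%E.
Proof.
move=> m'E mF F0.
pose h := nnsfun_approx measurableT mF.
have FE y : F y = lim ((EFin \o h n) y @[n --> \oo]).
  by apply/esym/cvg_lim => //; exact: cvg_nnsfun_approx.
transitivity (lim ((\int[m']_y (EFin \o h n) y)%E @[n --> \oo])).
  under eq_integral do rewrite FE.
  apply: monotone_convergence => //.
  - by move=> n; apply/measurable_EFinP.
  - by move=> n x _ /=; rewrite lee_fin.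
  - by move=> x _ a b ab; rewrite lee_fin; exact/lefP/nd_nnsfun_approx.
transitivity (lim ((\int[m]_x ((h n (phi x))%:E * (w x)%:E))%E @[n --> \oo])); last first.
  rewrite -monotone_convergence //.
  - apply: eq_integral => x _; apply/cvg_lim => //.
    by apply: cvgeZr => //; exact: cvg_nnsfun_approx.
  - move=> n; apply: emeasurable_funM; last exact/measurable_EFinP.
    by apply/measurable_EFinP; exact: measurableT_comp.
  - by move=> n x _; rewrite mule_ge0 ?lee_fin.
  - move=> x _ a b ab; rewrite lee_wpmul2r ?lee_fin//.
    exact/lefP/nd_nnsfun_approx.
apply: congr_lim; apply/funext => n /=.
transitivity (\int[m']_x
   (\sum_(y \in range (h n)) (y * \1_(h n @^-1` [set y]) x)%:E))%E.
  by apply: eq_integral => t _; rewrite /= fimfunE -fsumEFin.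
rewrite ge0_integral_fsum//; last 2 first.
  - by move=> r; apply/measurable_EFinP; exact: measurable_funM.
  - by move=> r y _; exact: nnfun_muleindic_ge0.
transitivity (\int[m]_x (\sum_(y \in range (h n))
    (y * \1_(h n @^-1` [set y]) (phi x))%:E * (w x)%:E))%E; last first.
  apply: eq_integral => x _.
  rewrite -ge0_mule_fsuml => [|y]; last exact: nnfun_muleindic_ge0.
  by rewrite fsumEFin // -(fimfunE _ (phi x)).
have mind r : measurable_fun setT
    (fun x => (r * \1_(h n @^-1` [set r]) (phi x))%:E).
  apply/measurable_EFinP; apply: measurable_funM => //.
  by apply: (measurableT_comp _ mphi); exact: measurable_indic.
rewrite ge0_integral_fsum//; last 2 first.
  - by move=> r; apply: emeasurable_funM => //; exact/measurable_EFinP.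
  - by move=> r x _; rewrite mule_ge0 ?lee_fin// -lee_fin nnfun_muleindic_ge0.
apply: eq_fsbigr => r rhn.
have r0 : 0 <= r by move: rhn; rewrite inE => -[t _ <-].
under eq_integral do rewrite EFinM.
rewrite (@ge0_integralZl _ _ _ m' setT measurableT
  (fun y => (\1_(h n @^-1` [set r]) y)%:E))//; last first.
  by apply/measurable_EFinP; exact: measurable_indic.
rewrite integral_indic// setIT m'E//.
under [RHS]eq_integral do rewrite EFinM -muleA.
rewrite ge0_integralZl//; last 2 first.
  - apply: emeasurable_funM; last exact/measurable_EFinP.
    by apply/measurable_EFinP; apply: (measurableT_comp _ mphi); exact: measurable_indic.
  - by move=> x _; rewrite mule_ge0 ?lee_fin.
congr (_ * _)%E.
rewrite /weighted_image integral_mkcond; apply: eq_integral => x _.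
rewrite patchE indicE /=; have [xA|xA] := boolP (x \in _).
  rewrite mem_set ?mul1e//; exact: set_mem xA.
by rewrite memNset ?mul0e// => hx; move/negP : xA; apply; exact: mem_set.
Qed.
End weighted_image.

Section inversion.
Context {R : realType}.
Variable c : R.
Hypothesis c0 : 0 < c.

Let phi (v : R) : R := - c / v.
Let w (v : R) : R := c / v ^+ 2.

Let mphi : measurable_fun [set: measurableTypeR R]
  (phi : measurableTypeR R -> measurableTypeR R).
Proof. by apply: measurable_funM => //; exact: measurable_inv. Qed.

Let mw : measurable_fun [set: measurableTypeR R] w.
Proof.
by apply: measurable_funM => //; apply: measurable_funV; exact: measurable_funX.
Qed.

Let w0 v : 0 <= w v.
Proof. by rewrite divr_ge0 ?sqr_ge0// ltW. Qed.

Lemma integral_tail_sqr (t : R) : 0 < t ->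
  (\int[mu]_(x in `[t, +oo[) (w x)%:E = (c / t)%:E)%E.
Proof.
move=> t0.
have dF (x : R) : 0 < x -> is_derive x 1 (fun y : R => - c / y) (c / x ^+ 2).
  move=> x0; have xn0 : x != 0 by rewrite gt_eqF.
  have dV := @is_deriveV R id x 1 1 xn0 (is_derive_id x 1).
  have dZ := @is_deriveZ _ _ _ _ (- c) _ _ _ dV.
  by apply: (is_derive_eq dZ); rewrite /GRing.scale /=; field.
have cF (x : R) : 0 < x -> {for x, continuous (fun y : R => - c / y)}.
  move=> x0; apply/differentiable_continuous/derivable1_diffP.
  by have [] := dF x x0.
rewrite (@ge0_continuous_FTC2y R w (fun y => - c / y) t 0)//.
- by rewrite -EFinB; congr EFin; rewrite sub0r mulNr opprK.
- apply: continuous_in_subspaceT => x.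
  rewrite inE /= in_itv /= andbT => tx.
  have x0 : x != 0 by rewrite gt_eqF// (lt_le_trans t0).
  apply: cvgM; first exact: cvg_cst.
  by apply: cvgV; rewrite ?expf_neq0//; exact: exprn_continuous.
- rewrite -(mulr0 (- c)); apply: cvgM; first exact: cvg_cst.
  apply/gtr0_cvgV0; last exact: cvg_id.
  exact: nbhs_pinfty_gt.
- by move=> x tx; have [] := dF x (lt_trans t0 tx).
- by apply/cvg_at_right_filter/cF.
- move=> x; rewrite in_itv /= andbT => tx; rewrite derive1E.
  by have [_ ->] := dF x (lt_trans t0 tx).
Qed.

Lemma integral_tail_sqrN (t : R) : 0 < t ->
  (\int[mu]_(x in `]-oo, (- t)%R]) (w x)%:E = (c / t)%:E)%E.
Proof.
move=> t0; rewrite -integral_tail_sqr//.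
rewrite (_ : `]-oo, (- t)]%classic =
    (-%R : _ -> measurableTypeR R) @^-1` `[t, +oo[); last first.
  by rewrite opp_preimage_itvbndy.
transitivity (\int[mu]_(x in (-%R : _ -> measurableTypeR R) @^-1` `[t, +oo[)
    ((EFin \o w) \o -%R) x)%E.
  by apply: eq_integral => x _ /=; rewrite /w sqrrN.
rewrite -ge0_integral_pushforward//=; last 2 first.
  - by apply: measurable_funTS; exact/measurable_EFinP.
  - by move=> x _; rewrite lee_fin.
by apply: eq_measure_integral => //= A mA AS; exact: lebesgue_measureN.
Qed.

Let nu := weighted_image mu mphi mw w0.

Let Iphi (A B : set R) : phi @^-1` A = B ->
  nu A = (\int[mu]_(x in B) (w x)%:E)%E.
Proof. by rewrite /nu /weighted_image => ->. Qed.

Let nu_pos (y : R) : 0 <= y -> nu `]0, y]%classic = y%:E.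
Proof.
rewrite le_eqVlt => /predU1P[<-|y0].
  by rewrite set_itvoc0 /nu measure0.
rewrite (@Iphi _ `]-oo, - (c / y)]%classic); last first.
  apply/seteqP; split => v /=; rewrite !in_itv /= /phi.
    move=> /andP[h1 h2]; have v0 : v < 0.
      rewrite ltNge; apply/negP => v0; move: h1; rewrite ltNge => /negP; apply.
      by rewrite mulNr oppr_le0 divr_ge0// ltW.
    move: h2; rewrite -mulrNN -invrN opprK ler_pdivrMr ?oppr_gt0// => h2.
    by rewrite lerNr ler_pdivrMr// mulrC.
  move=> h; have v0 : v < 0.
    by rewrite (le_lt_trans h)// oppr_lt0 divr_gt0.
  rewrite -mulrNN -invrN opprK divr_gt0 ?oppr_gt0//=.
  by rewrite ler_pdivrMr ?oppr_gt0// mulrC -ler_pdivrMr// lerNr.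
rewrite integral_tail_sqrN ?divr_gt0//; congr EFin.
by field; rewrite !gt_eqF.
Qed.

Let nu_neg (y : R) : y <= 0 -> nu `]y, 0]%classic = (- y)%:E.
Proof.
rewrite le_eqVlt => /predU1P[->|y0].
  by rewrite set_itvoc0 /nu measure0 oppr0.
have cy0 : 0 < c / - y by rewrite divr_gt0// oppr_gt0.
rewrite (@Iphi _ ([set 0] `|` `]c / - y, +oo[)%classic); last first.
  apply/seteqP; split => v /=; rewrite !in_itv /= /phi ?andbT.
    move=> /andP[h1 h2]; have [v0|v0|v0] := ltgtP v 0; last by left.
      move: h2; rewrite -mulrNN -invrN opprK => h2.
      have : 0 < c / - v by rewrite divr_gt0// oppr_gt0.
      by rewrite ltNge h2.
    right; move: h1; rewrite mulNr ltrNr ltr_pdivrMr// => h1.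
    by rewrite ltr_pdivrMr ?oppr_gt0// mulrC.
  move=> [->|h]; first by rewrite invr0 mulr0 y0 lexx.
  have v0 : 0 < v by rewrite (lt_trans cy0).
  rewrite mulNr ltrNr oppr_le0 divr_ge0 ?ltW// andbT.
  by rewrite ltr_pdivrMr// mulrC -ltr_pdivrMr// oppr_gt0.
rewrite ge0_integral_setU//=; last 3 first.
  - by apply: measurable_funTS; exact/measurable_EFinP.
  - by move=> x _; rewrite lee_fin.
  - apply/disj_setPS => x [/= ->]; rewrite in_itv/= andbT ltNge.
    by rewrite (ltW cy0).
rewrite integral_set1 add0e integral_itv_obnd_cbnd; last first.
  by apply: measurable_funTS; exact/measurable_EFinP.
rewrite integral_tail_sqr//; congr EFin.
have [cn yn] : c != 0 /\ y != 0 by rewrite gt_eqF// lt_eqF.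
by field; rewrite ?oppr_eq0 ?cn ?yn.
Qed.

Let nu_ocitv (X : set R) : ocitv X -> mu X = nu X.
Proof.
move=> [[a b]] _ <- /=.
have [ba|ab] := leP b a.
  by rewrite set_itv_ge ?measure0 /nu ?measure0// bnd_simp -leNgt.
rewrite lebesgue_measure_itv/= lte_fin ab -EFinB.
have nuU x y z : x <= y -> y <= z ->
    nu `]x, z]%classic = (nu `]x, y]%classic + nu `]y, z]%classic)%E.
  move=> xy yz; rewrite -measureU//.
  - by rewrite -itv_bndbnd_setU// bnd_simp.
  - apply/seteqP; split => // v [] /=; rewrite !in_itv /= => /andP[_ vy] /andP[yv _].
    by move: (lt_le_trans yv vy); rewrite ltxx.
have [a0|a0] := leP 0 a.
  have := nuU 0 a b a0 (ltW ab); rewrite !nu_pos ?(le_trans a0 (ltW ab))//.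
  case: (nu `]a, b]%classic) => [r| |]//= [->]; congr EFin; ring.
have [b0|b0] := leP b 0.
  have := nuU a b 0 (ltW ab) b0; rewrite !nu_neg//; last exact: ltW.
  case: (nu `]a, b]%classic) => [r| |]//= [E]; congr EFin; lra.
by rewrite (nuU a 0 b) ?ltW// nu_neg ?nu_pos ?ltW// -EFinD addrC.
Qed.

(** The image of [c / v^2 dv] under [v -> - c / v] gives an interval its length,
    because the integral of [c / v^2] beyond [t] is [c / t]. Since [- c / 0 = 0]
    and [c / 0 ^+ 2 = 0], the origin needs no special care. *)
Lemma ge0_integral_inversion (F : R -> \bar R) :
  measurable_fun [set: R] F -> (forall x, 0 <= F x)%E ->
  (\int[mu]_v (F (- c / v)%R * (c / v ^+ 2)%:E) = \int[mu]_x F x)%E.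
Proof.
move=> mF F0; apply/esym.
rewrite (@ge0_integral_weighted_image _ _ (measurableTypeR R) (measurableTypeR R) R mu
  phi w mphi mw w0 mu F)//.
by move=> A mA; exact: (lebesgue_measure_unique nu_ocitv).
Qed.

End inversion.

(** * Averaging a square integrable function against a law *)

Section pair_variance.
Context d (T : measurableType d) {R : realType} (nu : probability T R).

Lemma integral_cst_probability (c : \bar R) : (\int[nu]_x c = c)%E.
Proof.
by rewrite (integral_cst nu measurableT) [X in (_ * X)%E]probability_setT mule1.
Qed.

(** The law of two independent samples of [nu]. *)
Definition pairp : subprobability (T * T)%type R :=
  product_subprobability (nu : subprobability T R, nu : subprobability T R).

Lemma ge0_integral_pairp (F : T * T -> \bar R) :
  measurable_fun setT F -> (forall p, 0 <= F p)%E ->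
  (\int[pairp]_p F p = \int[nu]_x \int[nu]_y F (x, y))%E.
Proof. by move=> mF F0; exact: (@fubini_tonelli1 _ _ _ _ _ nu nu F mF F0). Qed.

(** Expand the square: the cross term has mean [x ^+ 2] by independence. *)
Lemma pair_variance (X : T -> R) (x : R) :
  measurable_fun setT X -> (forall a, 0 <= X a) ->
  (\int[nu]_a (X a)%:E = x%:E)%E ->
  (\int[pairp]_p ((X p.1 - X p.2) ^+ 2)%:E + (2 * x ^+ 2)%:E =
   2%:E * \int[nu]_a ((X a) ^+ 2)%:E)%E.
Proof.
move=> mX X0 xE.
have mX1 : measurable_fun setT (fun p : T * T => X p.1).
  exact: (measurableT_comp mX).
have mX2 : measurable_fun setT (fun p : T * T => X p.2).
  exact: (measurableT_comp mX).
have -> : (2 * x ^+ 2)%:E = (\int[pairp]_p (2 * (X p.1 * X p.2))%:E)%E.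
  rewrite ge0_integral_pairp//; last 2 first.
  - by apply/measurable_EFinP/measurable_funM => //; exact: measurable_funM.
  - by move=> p; rewrite lee_fin !mulr_ge0.
  transitivity (\int[nu]_a ((2 * x)%:E * (X a)%:E))%E.
    rewrite ge0_integralZl//.
    - by rewrite xE -EFinM expr2 mulrA.
    - exact/measurable_EFinP.
    - by move=> y _; rewrite lee_fin.
    - rewrite lee_fin mulr_ge0// -lee_fin -xE integral_ge0// => y _.
      by rewrite lee_fin.
  apply/esym/eq_integral => a _ /=.
  transitivity (\int[nu]_y ((2 * X a)%:E * (X y)%:E))%E.
    by apply: eq_integral => y _; rewrite -EFinM mulrA.
  rewrite ge0_integralZl//.
  - by rewrite xE -!EFinM mulrAC.
  - exact/measurable_EFinP.
  - by move=> y _; rewrite lee_fin.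
  - by rewrite lee_fin mulr_ge0.
rewrite -ge0_integralD//; last 4 first.
- by move=> p _; rewrite lee_fin sqr_ge0.
- by apply/measurable_EFinP/measurable_funX; exact: measurable_funB.
- by move=> p _; rewrite lee_fin !mulr_ge0.
- by apply/measurable_EFinP/measurable_funM => //; exact: measurable_funM.
transitivity (\int[pairp]_p (((X p.1) ^+ 2)%:E + ((X p.2) ^+ 2)%:E))%E.
  by apply: eq_integral => p _; rewrite -!EFinD; congr (_%:E); ring.
rewrite ge0_integralD//; last 4 first.
- by move=> p _; rewrite lee_fin sqr_ge0.
- exact/measurable_EFinP/measurable_funX.
- by move=> p _; rewrite lee_fin sqr_ge0.
- exact/measurable_EFinP/measurable_funX.
rewrite !ge0_integral_pairp//; last 4 first.
- exact/measurable_EFinP/measurable_funX.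
- by move=> p; rewrite lee_fin sqr_ge0.
- exact/measurable_EFinP/measurable_funX.
- by move=> p; rewrite lee_fin sqr_ge0.
rewrite -[2%R]/(1 + 1)%R EFinD ge0_muleDl ?lee_fin// !mul1e; congr (_ + _)%E.
  apply: eq_integral => y _ /=.
  exact: integral_cst_probability.
by rewrite /= integral_cst_probability.
Qed.
End pair_variance.

Section square_integrable.
Context {R : realType}.
Implicit Type f : R -> R.

Definition sqint f : \bar R := (\int[mu]_x ((f x) ^+ 2)%:E)%E.

Definition sqnorm f : R := fine (sqint f).

(** Nonnegativity allows all integrals to be manipulated in the extended reals. *)
Definition nnL2 f : Prop :=
  [/\ measurable_fun [set: R] f, forall x, 0 <= f x & (sqint f < +oo)%E].

Lemma sqint_ge0 f : (0 <= sqint f)%E.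
Proof. by apply: integral_ge0 => x _; rewrite lee_fin sqr_ge0. Qed.

Lemma sqnorm_ge0 f : 0 <= sqnorm f.
Proof. exact/fine_ge0/sqint_ge0. Qed.

Lemma sqnormE f : nnL2 f -> sqint f = (sqnorm f)%:E.
Proof. by case=> _ _ fy; rewrite fineK// ge0_fin_numE// sqint_ge0. Qed.

Lemma sqint_translation f (c : R) : measurable_fun [set: R] f ->
  (\int[mu]_x ((f (x + c)%R) ^+ 2)%:E = sqint f)%E.
Proof.
move=> mf; apply: (@ge0_integral_translation R c (fun x => ((f x) ^+ 2)%:E)).
  exact/measurable_EFinP/measurable_funX.
by move=> x; rewrite lee_fin sqr_ge0.
Qed.

End square_integrable.

Section averaging.
Context {R : realType} (nu : probability (measurableTypeR R) R) (M : R).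
Hypothesis M0 : 0 <= M.
Hypothesis nuM : forall A, measurable A -> (nu A <= M%:E * mu A)%E.
Implicit Type f : R -> R.

Lemma ge0_integral_bounded_density (F : R -> \bar R) :
  measurable_fun [set: R] F -> (forall x, 0 <= F x)%E ->
  (\int[nu]_x F x <= M%:E * \int[mu]_x F x)%E.
Proof.
move=> mF F0.
have := @ge0_integral_mscale _ (measurableTypeR R) R mu setT measurableT
  (NngNum M0) F mF (fun x _ => F0 x).
move=> /= <-; apply: ge0_le_measure_integral => //.
Qed.

(** Convolution with the reflected law; it is finite for [f] in [nnL2] because the
    density of [nu] is bounded. *)
Definition avg f (u : R) : R := fine (\int[nu]_a (f (a + u)%R)%:E)%E.

Let mshift f (u : R) : measurable_fun [set: R] f ->
  measurable_fun [set: R] (fun a : R => f (a + u)).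
Proof. by move=> mf; apply: (measurableT_comp mf); exact: measurable_funD. Qed.

Lemma integral_sqr_shift_le f (u : R) : nnL2 f ->
  (\int[nu]_a ((f (a + u)%R) ^+ 2)%:E <= (M * sqnorm f)%:E)%E.
Proof.
move=> f2; have [mf f0 fy] := f2.
rewrite EFinM -sqnormE// -(sqint_translation u mf).
apply: ge0_integral_bounded_density.
  by apply/measurable_EFinP; apply: measurable_funX; exact: mshift.
by move=> x; rewrite lee_fin sqr_ge0.
Qed.

Lemma avgE f (u : R) : nnL2 f ->
  (\int[nu]_a (f (a + u)%R)%:E = (avg f u)%:E)%E.
Proof.
move=> f2; have [mf f0 fy] := f2.
rewrite /avg fineK// ge0_fin_numE; last first.
  by apply: integral_ge0 => x _; rewrite lee_fin.
apply: (@le_lt_trans _ _ (\int[nu]_a (1%:E + ((f (a + u)%R) ^+ 2)%:E))%E).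
  apply: ge0_le_integral => //.
  - by move=> x _; rewrite lee_fin.
  - by apply/measurable_EFinP; exact: mshift.
  - apply: emeasurable_funD => //.
    by apply/measurable_EFinP; apply: measurable_funX; exact: mshift.
  - move=> x _; rewrite -EFinD lee_fin.
    have := sqr_ge0 (f (x + u) - 1); have := f0 (x + u); nra.
rewrite ge0_integralD//; last 2 first.
  - by move=> x _; rewrite lee_fin sqr_ge0.
  - by apply/measurable_EFinP; apply: measurable_funX; exact: mshift.
rewrite integral_cst_probability.
apply: (@le_lt_trans _ _ (1%:E + (M * sqnorm f)%:E)%E).
  by rewrite leeD2l// integral_sqr_shift_le.
by rewrite -EFinD ltry.
Qed.

Lemma avg_ge0 f (u : R) : (forall x, 0 <= f x) -> 0 <= avg f u.
Proof.
by move=> f0; apply/fine_ge0/integral_ge0 => a _; rewrite lee_fin.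
Qed.

Let mplus f : measurable_fun [set: R] f ->
  measurable_fun setT (fun p : measurableTypeR R * measurableTypeR R => f (p.2 + p.1)).
Proof. by move=> mf; apply: (measurableT_comp mf); exact: measurable_funD. Qed.

Lemma measurable_avg f : measurable_fun [set: R] f -> (forall x, 0 <= f x) ->
  measurable_fun [set: R] (avg f).
Proof.
move=> mf f0; apply: measurableT_comp => //.
apply: (@measurable_fun_fubini_tonelli_F _ _ (measurableTypeR R) _ _ nu
  (fun p => (f (p.2 + p.1))%:E)).
  by apply/measurable_EFinP; exact: mplus.
by move=> p; rewrite lee_fin.
Qed.

Definition defect f (p : measurableTypeR R * measurableTypeR R) : \bar R :=
  (\int[mu]_u ((f (p.1 + u)%R - f (p.2 + u)%R) ^+ 2)%:E)%E.

(** Averaging loses exactly the mean oscillation of [f] along differences of two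
    samples of [nu]: this is [pair_variance] integrated over the base point. *)
Lemma avg_defect f : nnL2 f ->
  (\int[pairp nu]_p defect f p + 2%:E * sqint (avg f) = 2%:E * sqint f)%E.
Proof.
move=> f2; have [mf f0 fy] := f2.
have mD : measurable_fun setT
    (fun q : measurableTypeR R * (measurableTypeR R * measurableTypeR R) =>
      ((f (q.2.1 + q.1) - f (q.2.2 + q.1)) ^+ 2)%:E).
  apply/measurable_EFinP/measurable_funX/measurable_funB;
    apply: (measurableT_comp mf); apply: measurable_funD => //;
    exact: measurableT_comp.
have D0 (q : measurableTypeR R * (measurableTypeR R * measurableTypeR R)) :
    (0 <= ((f (q.2.1 + q.1) - f (q.2.2 + q.1)) ^+ 2)%:E)%E.
  by rewrite lee_fin sqr_ge0.
have -> : (\int[pairp nu]_p defect f p =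
    \int[mu]_u \int[pairp nu]_p ((f (p.1 + u)%R - f (p.2 + u)%R) ^+ 2)%:E)%E.
  exact/esym/(@fubini_tonelli _ _ _ _ _ mu (pairp nu) _ mD D0).
have mavg := measurable_avg mf f0.
rewrite -ge0_integralZl//; last 2 first.
  - exact/measurable_EFinP/measurable_funX.
  - by move=> x _; rewrite lee_fin sqr_ge0.
rewrite -ge0_integralD//; last 4 first.
  - by move=> u _; apply: integral_ge0 => p _; rewrite lee_fin sqr_ge0.
  - exact: (@measurable_fun_fubini_tonelli_F _ _ (measurableTypeR R) _ _ (pairp nu) _ mD D0).
  - by move=> u _; rewrite -EFinM lee_fin mulr_ge0// sqr_ge0.
  - by apply: measurable_funeM; exact/measurable_EFinP/measurable_funX.
transitivity (\int[mu]_u (2%:E * \int[nu]_a ((f (a + u)%R) ^+ 2)%:E))%E.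
  apply: eq_integral => u _.
  rewrite -(@pair_variance _ _ _ nu (fun a => f (a + u)) (avg f u))//.
  - exact: mshift.
  - exact: avgE.
have mS : measurable_fun setT (fun q : measurableTypeR R * measurableTypeR R =>
      ((f (q.2 + q.1)) ^+ 2)%:E).
  by apply/measurable_EFinP; apply: measurable_funX; exact: mplus.
have S0 (q : measurableTypeR R * measurableTypeR R) :
  (0 <= ((f (q.2 + q.1)) ^+ 2)%:E)%E by rewrite lee_fin sqr_ge0.
rewrite ge0_integralZl//; last 2 first.
  - exact: (@measurable_fun_fubini_tonelli_F _ _ (measurableTypeR R) _ _ nu _ mS S0).
  - by move=> u _; apply: integral_ge0 => p _; rewrite lee_fin sqr_ge0.
congr (_ * _)%E.
rewrite (@fubini_tonelli _ _ (measurableTypeR R) (measurableTypeR R) _ mu nu _ mS S0).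
under eq_integral => a _.
  under eq_integral => u _ do rewrite /= addrC.
  rewrite sqint_translation//; over.
by rewrite integral_cst_probability.
Qed.

Lemma sqint_avg_le f : nnL2 f -> (sqint (avg f) <= sqint f)%E.
Proof.
move=> f2; rewrite -(@lee_pmul2l _ 2%:E)// -(avg_defect f2).
rewrite leeDr// integral_ge0// => p _; apply: integral_ge0 => u _.
by rewrite lee_fin sqr_ge0.
Qed.

Lemma nnL2_avg f : nnL2 f -> nnL2 (avg f).
Proof.
move=> f2; have [mf f0 fy] := f2; split; first exact: measurable_avg.
  by move=> u; exact: avg_ge0.
exact: le_lt_trans (sqint_avg_le f2) fy.
Qed.

Lemma sqnorm_avg_le f : nnL2 f -> sqnorm (avg f) <= sqnorm f.
Proof.
move=> f2; rewrite -lee_fin -!sqnormE//; [exact: sqint_avg_le|exact: nnL2_avg].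
Qed.

Lemma sqr_avg_le_avg_sqr f (u : R) : nnL2 f ->
  (((avg f u) ^+ 2)%:E <= \int[nu]_a ((f (a + u)%R) ^+ 2)%:E)%E.
Proof.
move=> f2; have [mf f0 fy] := f2.
rewrite -(@lee_pmul2l _ 2%:E)// -EFinM.
rewrite -(@pair_variance _ _ _ nu (fun a => f (a + u)) (avg f u))//.
- rewrite leeDr// integral_ge0// => p _.
  by rewrite lee_fin sqr_ge0.
- exact: mshift.
- exact: avgE.
Qed.

Lemma sqr_avg_le f (u : R) : nnL2 f -> avg f u ^+ 2 <= M * sqnorm f.
Proof.
move=> f2; rewrite -lee_fin; apply: (le_trans (sqr_avg_le_avg_sqr u f2)).
exact: integral_sqr_shift_le.
Qed.

End averaging.

(** * Loss of norm and spreading *)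

Section spread.
Context {R : realType}.
Implicit Types (f : R -> R) (A : set R).

Definition mass f A : \bar R := (\int[mu]_x ((f x) ^+ 2 * \1_A x)%:E)%E.

Definition increment f (t : R) : \bar R :=
  (\int[mu]_x ((f x - f (x + t)%R) ^+ 2)%:E)%E.

Let mshift f (u : R) : measurable_fun [set: R] f ->
  measurable_fun [set: R] (fun a : R => f (a + u)).
Proof. by move=> mf; apply: (measurableT_comp mf); exact: measurable_funD. Qed.

Let mincr f (u v : R) : measurable_fun [set: R] f ->
  measurable_fun [set: R] (fun x : R => ((f (x + u) - f (x + v)) ^+ 2)%:E).
Proof.
move=> mf; apply/measurable_EFinP/measurable_funX; apply: measurable_funB;
  exact: mshift.
Qed.

Let mincr0 f (v : R) : measurable_fun [set: R] f ->
  measurable_fun [set: R] (fun x : R => ((f x - f (x + v)) ^+ 2)%:E).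
Proof.
move=> mf; apply/measurable_EFinP/measurable_funX; apply: measurable_funB => //.
exact: mshift.
Qed.

Lemma defectE f (p : measurableTypeR R * measurableTypeR R) :
  measurable_fun [set: R] f -> defect f p = increment f (p.2 - p.1).
Proof.
move=> mf; rewrite /increment.
rewrite -(@ge0_integral_translation R p.1); last 2 first.
- exact: mincr0.
- by move=> x; rewrite lee_fin sqr_ge0.
apply: eq_integral => u _.
have -> : u + p.1 + (p.2 - p.1) = p.2 + u by ring.
by rewrite (addrC u).
Qed.

(** The triangle inequality in [L^2]; the factor 4 comes from using
    [(x + y)^2 <= 2 x^2 + 2 y^2] at each step. *)
Lemma incrementMn f (t : R) (N : nat) : measurable_fun [set: R] f ->
  (increment f (N%:R * t)%R <= (4 ^+ N)%:E * increment f t)%E.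
Proof.
move=> mf; elim: N => [|N IH].
  rewrite mul0r expr0 mul1e /increment.
  under eq_integral do rewrite addr0 subrr expr0n.
  rewrite integral0; apply: integral_ge0 => x _; by rewrite lee_fin sqr_ge0.
have -> : (4 ^+ N.+1)%:E = (2 * 4 ^+ N + 2 * 4 ^+ N)%:E :> \bar R.
  by congr EFin; rewrite exprS; ring.
apply: (@le_trans _ _ (\int[mu]_x (2%:E * ((f x - f (x + N%:R * t)%R) ^+ 2)%:E +
    2%:E * ((f (x + N%:R * t)%R - f (x + N.+1%:R * t)%R) ^+ 2)%:E))%E).
  apply: ge0_le_integral => //.
  - by move=> x _; rewrite lee_fin sqr_ge0.
  - exact: mincr0.
  - apply: emeasurable_funD; apply: measurable_funeM; [exact: mincr0|exact: mincr].
  - move=> x _; rewrite -!EFinM -EFinD lee_fin.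
    set a := f x; set c := f _; set b := f _.
    by have := sqr_ge0 (a - b - (b - c)); nra.
rewrite ge0_integralD//; last 4 first.
- by move=> x _; rewrite -EFinM lee_fin mulr_ge0// sqr_ge0.
- by apply: measurable_funeM; exact: mincr0.
- by move=> x _; rewrite -EFinM lee_fin mulr_ge0// sqr_ge0.
- by apply: measurable_funeM; exact: mincr.
rewrite !ge0_integralZl//; last 4 first.
- exact: mincr.
- by move=> x _; rewrite lee_fin sqr_ge0.
- exact: mincr0.
- by move=> x _; rewrite lee_fin sqr_ge0.
have -> : (\int[mu]_x ((f (x + N%:R * t)%R - f (x + N.+1%:R * t)%R) ^+ 2)%:E =
    increment f t)%E.
  rewrite /increment -[RHS](@ge0_integral_translation R (N%:R * t)); last 2 first.
  - exact: mincr0.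
  - by move=> x; rewrite lee_fin sqr_ge0.
  apply: eq_integral => u _.
  by have -> : u + N%:R * t + t = u + N.+1%:R * t by rewrite -natr1; ring.
have i0 : (0 <= increment f t)%E.
  by apply: integral_ge0 => x _; rewrite lee_fin sqr_ge0.
have y0 : 0 <= 2 * 4 ^+ N :> R by rewrite mulr_ge0// exprn_ge0.
rewrite [leRHS](_ : _ = (2 * 4 ^+ N)%:E * increment f t +
    (2 * 4 ^+ N)%:E * increment f t)%E; last by rewrite EFinD ge0_muleDl ?lee_fin.
apply: leeD.
  by rewrite EFinM -muleA lee_pmul2l.
rewrite lee_wpmul2r// lee_fin -[leLHS]mulr1 ler_pM2l//; by rewrite exprn_ege1// ler1n.
Qed.

Let mmass f A : measurable_fun [set: R] f -> measurable A ->
  measurable_fun [set: R] (fun x => ((f x) ^+ 2 * \1_A x)%:E).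
Proof.
move=> mf mA; apply/measurable_EFinP/measurable_funM.
  exact: measurable_funX.
exact: measurable_indic.
Qed.

Lemma sum_indic_disjoint (k : nat) (A : 'I_k -> set R) (x : R) :
  (forall i j, A i x -> A j x -> i = j) -> \sum_(j < k) \1_(A j) x <= 1 :> R.
Proof.
move=> dA; have [[i Ai]|nA] := pselect (exists i, A i x).
  rewrite (bigD1 i)//= indicE mem_set// big1 ?addr0// => j ji.
  rewrite indicE memNset// => Aj; move: ji; rewrite (dA i j Ai Aj).
  by rewrite eqxx.
rewrite big1// => j _; rewrite indicE memNset// => Aj.
by apply: nA; exists j.
Qed.

(** The translates of the interval by [0, m t, ..., 7 m t] are disjoint, since
    [m |t|] exceeds its length, so that the masses of [f] on them add up to at
    most the whole integral. If [f] moves little under the translation by [t], each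
    of these masses is at least half of the mass on the original interval, up to
    the increment, whence the factor [2 / 8 = 1 / 4]. *)
Lemma mass_le_increment f (c l t : R) (m : nat) :
  nnL2 f -> 2 * l < m%:R * `|t| ->
  (mass f `[(c - l)%R, (c + l)%R]%classic <=
   (4^-1)%:E * sqint f + (2 * 4 ^+ (8 * m))%:E * increment f t)%E.
Proof.
move=> [mf f0 fy] lt; set I := `[c - l, c + l]%classic.
have i0 : (0 <= increment f t)%E.
  by apply: integral_ge0 => x _; rewrite lee_fin sqr_ge0.
pose d (j : 'I_8) : R := (j * m)%N%:R * t.
pose A (j : 'I_8) : set R := [set x | I (x - d j)].
have mI : measurable I by exact: measurable_itv.
have mA j : measurable (A j).
  rewrite /A -[X in measurable X]setTI.
  by apply: (measurable_funB _ _) => //.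
have mass_j (j : 'I_8) :
    (mass f I <= 2%:E * mass f (A j) + (2 * 4 ^+ (8 * m))%:E * increment f t)%E.
  apply: (@le_trans _ _ (\int[mu]_x (2%:E * ((f (x + d j)%R) ^+ 2 * \1_I x)%:E +
      2%:E * ((f x - f (x + d j)%R) ^+ 2)%:E))%E).
    apply: ge0_le_integral => //.
    - by move=> x _; rewrite lee_fin mulr_ge0// sqr_ge0.
    - exact: mmass.
    - apply: emeasurable_funD; apply: measurable_funeM; last exact: mincr0.
      by apply: mmass => //; exact: mshift.
    - move=> x _; rewrite -!EFinM -EFinD lee_fin indicE.
      set a := f x; set b := f _; case: (_ \in _); rewrite /= !(mulr1, mulr0).
        by have := sqr_ge0 (a - b - b); nra.
      by rewrite add0r mulr_ge0// sqr_ge0.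
  rewrite ge0_integralD//; last 4 first.
  - by move=> x _; rewrite -EFinM lee_fin !mulr_ge0// sqr_ge0.
  - by apply: measurable_funeM; apply: mmass => //; exact: mshift.
  - by move=> x _; rewrite -EFinM lee_fin mulr_ge0// sqr_ge0.
  - by apply: measurable_funeM; exact: mincr0.
  rewrite !ge0_integralZl//; last 4 first.
  - exact: mincr0.
  - by move=> x _; rewrite lee_fin sqr_ge0.
  - by apply: mmass => //; exact: mshift.
  - by move=> x _; rewrite lee_fin mulr_ge0// sqr_ge0.
  have -> : (\int[mu]_x ((f (x + d j)%R) ^+ 2 * \1_I x)%:E = mass f (A j))%E.
    rewrite /mass -[RHS](@ge0_integral_translation R (d j)); last 2 first.
    - exact: mmass.
    - by move=> x; rewrite lee_fin mulr_ge0// sqr_ge0.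
    apply: eq_integral => x _.
    suff -> : \1_(A j) (x + d j) = \1_I x :> R by [].
    by rewrite !indicE; congr (_%:R); congr nat_of_bool; apply/idP/idP;
      rewrite !inE /A /= addrK.
  apply: leeD => //; rewrite EFinM -muleA lee_pmul2l//.
  apply: (le_trans (incrementMn _ _ mf)); rewrite lee_wpmul2r// lee_fin.
  by rewrite ler_weXn2l ?ler1n// leq_mul2r ltnW ?ltn_ord ?orbT.
have massA : (\sum_(j < 8) mass f (A j) <= sqint f)%E.
  rewrite /mass -ge0_integral_sum//; last 2 first.
  - by move=> j; exact: mmass.
  - by move=> j x _; rewrite lee_fin mulr_ge0// sqr_ge0.
  apply: ge0_le_integral => //.
  - by move=> x _; apply: sume_ge0 => j _; rewrite lee_fin mulr_ge0// sqr_ge0.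
  - by apply: emeasurable_sum => j; exact: mmass.
  - exact/measurable_EFinP/measurable_funX.
  - move=> x _; rewrite sumEFin lee_fin -mulr_sumr ler_piMr ?sqr_ge0//.
    apply: sum_indic_disjoint => i j; rewrite /A /I /= !in_itv /= => hi hj.
    apply/val_inj/eqP; apply/negPn/negP => ij.
    have : `|d i - d j| <= 2 * l by rewrite ler_norml; lra.
    apply/negP; rewrite -ltNge; apply: (lt_le_trans lt).
    rewrite /d -mulrBl normrM ler_wpM2r// !natrM -mulrBl normrM.
    rewrite (ger0_norm (ler0n _ _)) -[leLHS]mul1r ler_wpM2r//.
    case: (ltngtP i j) ij => // h _.
      by rewrite distrC -natrB ?(ltnW h)// ger0_norm// ler1n subn_gt0.
    by rewrite -natrB ?(ltnW h)// ger0_norm// ler1n subn_gt0.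
have sum8 (z : \bar R) : (\sum_(j < 8) z = 8%:E * z)%E.
  by rewrite sumr_const card_ord mule_natl.
rewrite -(@lee_pmul2l _ 8%:E)//.
apply: (@le_trans _ _ (\sum_(j < 8) (2%:E * mass f (A j) +
    (2 * 4 ^+ (8 * m))%:E * increment f t))%E).
  apply: (@le_trans _ _ (\sum_(j < 8) mass f I)%E).
    by rewrite sum8.
  by apply: lee_sum => j _; exact: mass_j.
rewrite big_split sum8.
have h1 : (0 <= (4^-1)%:E * sqint f)%E.
  by apply: mule_ge0; [rewrite lee_fin|exact: sqint_ge0].
have h2 : (0 <= (2 * 4 ^+ (8 * m))%:E * increment f t)%E.
  by apply: mule_ge0 => //; rewrite lee_fin mulr_ge0// exprn_ge0.
rewrite (ge0_muleDr _ h1 h2).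
apply: leeD => //.
rewrite -ge0_sume_distrr; last first.
  by move=> j _; apply: integral_ge0 => x _; rewrite lee_fin mulr_ge0// sqr_ge0.
rewrite muleA -EFinM; have -> : 8 / 4 = 2 :> R by lra.
by rewrite lee_pmul2l.
Qed.

End spread.

Definition bounded_density {R : realType} (M : R)
    (nu : probability (measurableTypeR R) R) : Prop :=
  forall A, measurable A -> (nu A <= M%:E * mu A)%E.

Section contraction.
Context {R : realType} (M : R).
Hypothesis M0 : 0 < M.

(** An interval of length [(2 M)^-1] has [nu]-mass at most 1/2. *)
Lemma pairp_far (nu : probability (measurableTypeR R) R) :
  bounded_density M nu ->
  ((2^-1)%:E <= \int[pairp nu]_p
     (\1_[set p : measurableTypeR R * measurableTypeR R |
           (4 * M)^-1 <= `|p.2 - p.1|] p)%:E)%E.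
Proof.
move=> nuM; set t0 := (4 * M)^-1; set D := [set p | _].
have t00 : 0 < t0 by rewrite invr_gt0 mulr_gt0.
have mD : measurable D.
  have mg : measurable_fun setT
      (fun p : measurableTypeR R * measurableTypeR R => `|p.2 - p.1|).
    by apply: measurableT_comp => //; exact: measurable_funB.
  have := mg measurableT _ (measurable_itv `[t0, +oo[); rewrite setTI.
  by congr (measurable _); apply/seteqP; split => p /=; rewrite in_itv /= andbT.
rewrite ge0_integral_pairp; last 2 first.
- by apply/measurable_EFinP; exact: measurable_indic.
- by move=> p; rewrite lee_fin.
rewrite -[leLHS](integral_cst_probability nu); apply: ge0_le_integral => //.
- by apply: (@measurable_fun_fubini_tonelli_F _ _ (measurableTypeR R) _ _ nu
    (fun p => (\1_D p)%:E)) => //; apply/measurable_EFinP; exact: measurable_indic.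
move=> x _.
pose I : set (measurableTypeR R) := `]x - t0, x + t0[%classic.
have mI : measurable I by exact: measurable_itv.
have -> : (\int[nu]_y (\1_D (x, y))%:E = \int[nu]_y (\1_(~` I) y)%:E)%E.
  apply: eq_integral => y _; rewrite !indicE; congr (_%:R%:E); congr nat_of_bool.
  apply/idP/idP; rewrite !inE /D /I /setC /= in_itv /=.
    by move=> h /andP[h1 h2]; move: h; rewrite leNgt ltr_norml; lra.
  move=> h; rewrite leNgt ltr_norml; apply/negP => /andP[h1 h2].
  by apply: h; apply/andP; split; lra.
rewrite integral_indic//; last exact: measurableC.
rewrite setIT [leRHS](_ : _ = 1 - nu I)%E; last exact: probability_setC.
have := nuM _ mI; rewrite lebesgue_measure_itv/= lte_fin.
rewrite ifT; last lra.
rewrite -EFinB -EFinM => h.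
have hf : nu I \is a fin_num by exact: fin_num_measure.
rewrite -(fineK hf) -EFinB lee_fin.
move: h; rewrite -{1}(fineK hf) lee_fin.
have -> : M * (x + t0 - (x - t0)) = 2^-1 by rewrite /t0; field; rewrite gt_eqF.
lra.
Qed.

(** By [pairp_far] the two samples differ by at least [(4 M)^-1] half of the time.
    Averaging [mass_le_increment] over these differences and using [avg_defect]
    bounds the mass on an interval by a quarter of the squared norm plus a multiple
    of the loss [sqnorm f - sqnorm (avg nu f)]. *)
Lemma mass_le_sqnorm (l : R) : exists2 C : R, 0 <= C &
  forall nu, bounded_density M nu -> forall f, nnL2 f -> forall c,
    (mass f `[(c - l)%R, (c + l)%R]%classic + (C * sqnorm (avg nu f))%:E <=
     ((4^-1 + C) * sqnorm f)%:E)%E.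
Proof.
pose t0 : R := (4 * M)^-1.
have t00 : 0 < t0 by rewrite invr_gt0 mulr_gt0.
pose m := (Num.truncn (2 * l / t0)).+1.
have mt0 : 2 * l < m%:R * t0 by rewrite -ltr_pdivrMr// truncnS_gt.
pose C1 : R := 2 * 4 ^+ (8 * m).
have C10 : 0 <= C1 by rewrite mulr_ge0// exprn_ge0.
exists (4 * C1); first by rewrite mulr_ge0.
move=> nu nuM f f2 c; have [mf f0 fy] := f2.
set I := `[c - l, c + l]%classic.
have mI : measurable I by exact: measurable_itv.
have mass0 : (0 <= mass f I)%E.
  by apply: integral_ge0 => x _; rewrite lee_fin mulr_ge0// sqr_ge0.
have massy : (mass f I <= sqint f)%E.
  apply: ge0_le_integral => //.
  - by move=> x _; rewrite lee_fin mulr_ge0// sqr_ge0.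
  - apply/measurable_EFinP/measurable_funM; first exact: measurable_funX.
    exact: measurable_indic.
  - exact/measurable_EFinP/measurable_funX.
  - by move=> z _; rewrite lee_fin ler_piMr ?sqr_ge0.
have massf : mass f I \is a fin_num by rewrite ge0_fin_numE// (le_lt_trans massy).
have avgn := sqnorm_avg_le (ltW M0) nuM f2.
set x := fine (mass f I); have massE : mass f I = x%:E by rewrite fineK.
rewrite massE -EFinD lee_fin; have [xn|xn] := leP x (4^-1 * sqnorm f).
  by have := ler_wpM2l C10 avgn; lra.
pose y := x - 4^-1 * sqnorm f; have y0 : 0 < y by rewrite subr_gt0.
have mD : measurable_fun setT (defect f).
  have mD : measurable_fun setT
      (fun q : measurableTypeR R * (measurableTypeR R * measurableTypeR R) =>
        ((f (q.2.1 + q.1) - f (q.2.2 + q.1)) ^+ 2)%:E).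
    apply/measurable_EFinP/measurable_funX/measurable_funB;
      apply: (measurableT_comp mf); apply: measurable_funD => //;
      exact: measurableT_comp.
  apply: (@measurable_fun_fubini_tonelli_G _ _ (measurableTypeR R) _ _ mu _ mD).
  by move=> q; rewrite lee_fin sqr_ge0.
have defect0 p : (0 <= defect f p)%E.
  by apply: integral_ge0 => u _; rewrite lee_fin sqr_ge0.
pose D := [set p : measurableTypeR R * measurableTypeR R | t0 <= `|p.2 - p.1|].
have mDD : measurable D.
  have mg : measurable_fun setT
      (fun p : measurableTypeR R * measurableTypeR R => `|p.2 - p.1|).
    by apply: measurableT_comp => //; exact: measurable_funB.
  have := mg measurableT _ (measurable_itv `[t0, +oo[); rewrite setTI.
  by congr (measurable _); apply/seteqP; split => p /=; rewrite in_itv /= andbT.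
have far : ((y * 2^-1)%:E <= C1%:E * \int[pairp nu]_p defect f p)%E.
  rewrite EFinM.
  apply: (@le_trans _ _ (y%:E * \int[pairp nu]_p (\1_D p)%:E)%E).
    by rewrite lee_pmul2l//; exact: pairp_far.
  rewrite -!ge0_integralZl//; last 2 first.
  - by apply/measurable_EFinP; exact: measurable_indic.
  - by rewrite lee_fin ltW.
  apply: ge0_le_integral => //.
  - by move=> p _; rewrite -EFinM lee_fin mulr_ge0// ltW.
  - by apply: measurable_funeM; apply/measurable_EFinP; exact: measurable_indic.
  - exact: measurable_funeM.
  - move=> p _; rewrite indicE; case: (boolP (p \in D)) => [|_]; last first.
      by rewrite mule0 mule_ge0.
    rewrite inE /D /= => pD; rewrite mule1 defectE//.
    have := @mass_le_increment R f c l (p.2 - p.1) m f2.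
    have mp : 2 * l < m%:R * `|p.2 - p.1|.
      by rewrite (lt_le_trans mt0)// ler_wpM2l.
    move=> /(_ mp); rewrite -/C1 -/I sqnormE// massE.
    by rewrite -EFinM /y EFinB leeBlDl.
have := avg_defect (ltW M0) nuM f2.
have af2 := nnL2_avg (ltW M0) nuM f2.
rewrite (sqnormE f2) (sqnormE af2) -!EFinM.
move: far; set I0 := (\int[pairp nu]_p defect f p)%E => far E.
have I0f : I0 \is a fin_num.
  have : (I0 + (2 * sqnorm (avg nu f))%:E)%E \is a fin_num by rewrite E.
  by rewrite fin_numD => /andP[].
have I0E : I0 = (fine I0)%:E by rewrite fineK.
move: far E; rewrite I0E -EFinM -EFinD lee_fin => far [E].
have xE : x = y + 4^-1 * sqnorm f by rewrite /y subrK.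
have I0f' : fine I0 = 2 * sqnorm f - 2 * sqnorm (avg nu f) by rewrite -E addrK.
rewrite I0f' in far.
lra.
Qed.

End contraction.

(** * Contraction of a transfer step *)

Section transfer_step.
Context {R : realType}.
Implicit Type f : R -> R.

(** The isometry of [L^2] attached to the inversion [v -> - b^2 / v]: the factor
    [b / |v|] is the square root of the Jacobian. *)
Definition inv_op (b : R) f (v : R) : R := b / `|v| * f (- b ^+ 2 / v).

Lemma measurable_inv_op b f : measurable_fun [set: R] f ->
  measurable_fun [set: R] (inv_op b f).
Proof.
move=> mf; apply: measurable_funM.
  apply: measurable_funM => //; apply: measurable_funV.
  exact: normr_measurable.
apply: (measurableT_comp mf); apply: measurable_funM => //.
exact: measurable_inv.
Qed.

Let sqr_inv_op b f v :
  inv_op b f v ^+ 2 = f (- b ^+ 2 / v) ^+ 2 * (b ^+ 2 / v ^+ 2).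
Proof. by rewrite /inv_op exprMn expr_div_n real_normK ?num_real// mulrC. Qed.

Lemma sqint_inv_op b f : 0 < b -> measurable_fun [set: R] f ->
  sqint (inv_op b f) = sqint f.
Proof.
move=> b0 mf; rewrite /sqint -[RHS](ge0_integral_inversion (exprn_gt0 2 b0)).
- by apply: eq_integral => v _; rewrite sqr_inv_op.
- by apply/measurable_EFinP; exact: measurable_funX.
- by move=> x; rewrite lee_fin sqr_ge0.
Qed.

Lemma nnL2_inv_op b f : 0 < b -> nnL2 f -> nnL2 (inv_op b f).
Proof.
move=> b0 [mf f0 fy]; split; first exact: measurable_inv_op.
  by move=> x; rewrite mulr_ge0// divr_ge0// ltW.
by rewrite sqint_inv_op.
Qed.

Lemma sqnorm_inv_op b f : 0 < b -> measurable_fun [set: R] f ->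
  sqnorm (inv_op b f) = sqnorm f.
Proof. by move=> b0 mf; rewrite /sqnorm sqint_inv_op. Qed.

(** The inversion maps the outside of [[-l, l]] into [[-l, l]] when [b <= l], and
    it exchanges the masses of [f] and [inv_op b f]. *)
Lemma sqint_inv_op_split b l f : 0 < b <= l -> nnL2 f ->
  (sqint (inv_op b f) <=
   mass (inv_op b f) `[(0 - l)%R, (0 + l)%R]%classic +
   mass f `[(0 - l)%R, (0 + l)%R]%classic)%E.
Proof.
move=> /andP[b0 bl] [mf f0 fy]; set I := `[_, _]%classic.
have mI : measurable I by exact: measurable_itv.
have mh := measurable_inv_op b mf.
have mm (g : R -> R) : measurable_fun [set: R] g ->
    measurable_fun [set: R] (fun x => ((g x) ^+ 2 * \1_I x)%:E).
  move=> mg; apply/measurable_EFinP/measurable_funM; first exact: measurable_funX.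
  exact: measurable_indic.
have mmf := mm _ mf.
have mmf0 x : (0 <= ((f x) ^+ 2 * \1_I x)%:E)%E.
  by rewrite lee_fin mulr_ge0// sqr_ge0.
have -> : mass f I = (\int[mu]_v ((f (- b ^+ 2 / v)%R ^+ 2 *
    \1_I (- b ^+ 2 / v)%R)%:E * (b ^+ 2 / v ^+ 2)%:E))%E.
  exact/esym/(ge0_integral_inversion (exprn_gt0 2 b0) mmf mmf0).
have mmi : measurable_fun [set: R] (fun v => ((f (- b ^+ 2 / v)%R ^+ 2 *
    \1_I (- b ^+ 2 / v)%R)%:E * (b ^+ 2 / v ^+ 2)%:E)%E).
  have mi : measurable_fun [set: R] (fun v : R => - b ^+ 2 / v).
    by apply: measurable_funM => //; exact: measurable_inv.
  apply: emeasurable_funM; first exact: (measurableT_comp mmf mi).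
  apply/measurable_EFinP; apply: measurable_funM => //.
  by apply: measurable_funV; exact: measurable_funX.
have mmi0 v : (0 <= (f (- b ^+ 2 / v)%R ^+ 2 *
    \1_I (- b ^+ 2 / v)%R)%:E * (b ^+ 2 / v ^+ 2)%:E)%E.
  by rewrite mule_ge0// lee_fin divr_ge0 ?sqr_ge0.
rewrite /mass -ge0_integralD//; last 2 first.
- by move=> x _; rewrite lee_fin mulr_ge0// sqr_ge0.
- exact: mm.
apply: ge0_le_integral => //.
- by move=> x _; rewrite lee_fin sqr_ge0.
- by apply/measurable_EFinP; exact: measurable_funX.
- by apply: emeasurable_funD => //; exact: mm.
move=> v _; rewrite -EFinM -EFinD lee_fin.
have [vI|vI] := boolP (v \in I).
  by rewrite indicE vI mulr1 lerDl -lee_fin EFinM; exact: mmi0.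
rewrite [X in _ * X + _]indicE (negbTE vI) mulr0 add0r sqr_inv_op.
suff -> : \1_I (- b ^+ 2 / v) = 1 :> R by rewrite mulr1.
rewrite indicE mem_set//.
have l0 : 0 < l by exact: lt_le_trans bl.
have vl : l < `|v|.
  rewrite ltNge; apply/negP => h; move/negP: vI; apply.
  by rewrite inE /I /= in_itv /= !add0r -ler_norml.
rewrite /I /= in_itv /= !add0r -ler_norml mulNr normrN normrM normfV.
rewrite (ger0_norm (sqr_ge0 b)) ler_pdivrMr ?(lt_trans l0)//.
rewrite expr2; apply: ler_pM; rewrite ?(ltW b0)//.
exact: le_trans bl (ltW vl).
Qed.

Definition step (nu : probability (measurableTypeR R) R) (b : R) f : R -> R :=
  inv_op b (avg nu f).

Context (M : R).
Hypothesis M0 : 0 < M.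

Lemma nnL2_step nu b f : bounded_density M nu -> 0 < b ->
  nnL2 f -> nnL2 (step nu b f).
Proof.
by move=> nuM b0 f2; apply: nnL2_inv_op => //; exact: (nnL2_avg (ltW M0) nuM f2).
Qed.

Lemma sqnorm_step_le nu b f : bounded_density M nu -> 0 < b ->
  nnL2 f -> sqnorm (step nu b f) <= sqnorm f.
Proof.
move=> nuM b0 f2; have [maf _ _] := nnL2_avg (ltW M0) nuM f2.
by rewrite sqnorm_inv_op//; exact: (sqnorm_avg_le (ltW M0) nuM f2).
Qed.

(** The bound of [mass_le_sqnorm] is uniform in the centre of the interval, so it
    passes from [f] to the average of its translates. *)
Lemma mass_avg_le (l : R) : exists2 C : R, 0 <= C &
  forall nu, bounded_density M nu -> forall f, nnL2 f ->
    (mass (avg nu f) `[(0 - l)%R, (0 + l)%R]%classic + (C * sqnorm (avg nu f))%:E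
     <= ((4^-1 + C) * sqnorm f)%:E)%E.
Proof.
have [C C0 HC] := mass_le_sqnorm M0 l; exists C => // nu nuM f f2.
have [mf f0 fy] := f2; set I := `[_, _]%classic.
have mI : measurable I by exact: measurable_itv.
have [maf af0 _] := nnL2_avg (ltW M0) nuM f2.
pose F (q : measurableTypeR R * measurableTypeR R) : \bar R :=
  ((f (q.2 + q.1)) ^+ 2 * \1_I q.1)%:E.
have mF : measurable_fun setT F.
  apply/measurable_EFinP/measurable_funM.
    apply: measurable_funX; apply: (measurableT_comp mf).
    exact: measurable_funD.
  by apply: (measurableT_comp _ measurable_fst); exact: measurable_indic.
have F0 q : (0 <= F q)%E by rewrite lee_fin mulr_ge0// sqr_ge0.
have le1 : (mass (avg nu f) I <= \int[nu]_a \int[mu]_u F (u, a))%E.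
  rewrite -(@fubini_tonelli _ _ (measurableTypeR R) (measurableTypeR R) _ mu nu F mF F0).
  apply: ge0_le_integral => //.
  - by move=> x _; rewrite lee_fin mulr_ge0// sqr_ge0.
  - apply/measurable_EFinP/measurable_funM; first exact: measurable_funX.
    exact: measurable_indic.
  - exact: (@measurable_fun_fubini_tonelli_F _ _ (measurableTypeR R) _ _ nu F mF F0).
  - move=> u _; rewrite /F /= indicE; case: (u \in I); rewrite /= ?mulr1 ?mulr0.
      under eq_integral do rewrite mulr1.
      exact: (sqr_avg_le_avg_sqr (ltW M0) nuM u f2).
    by apply: integral_ge0 => x _; rewrite mulr0.
have le2 a : (\int[mu]_u F (u, a) + (C * sqnorm (avg nu f))%:E <=
    ((4^-1 + C) * sqnorm f)%:E)%E.
  have := HC nu nuM f f2 a.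
  suff -> : (\int[mu]_u F (u, a) = mass f `[(a - l)%R, (a + l)%R]%classic)%E by [].
  rewrite /mass -[RHS](@ge0_integral_translation R a); last 2 first.
  - apply/measurable_EFinP/measurable_funM; first exact: measurable_funX.
    by apply: measurable_indic; exact: measurable_itv.
  - by move=> x; rewrite lee_fin mulr_ge0// sqr_ge0.
  apply: eq_integral => u _; rewrite /F /= addrC.
  suff -> : \1_I u = \1_(`[a - l, a + l]%classic) (u + a) :> R by [].
  rewrite !indicE; congr (_%:R); congr nat_of_bool.
  apply/idP/idP; rewrite !inE /I /= !in_itv /= => /andP[h1 h2];
    by apply/andP; split; lra.
apply: (le_trans (leeD2r _ le1)).
rewrite -[X in (_ + X <= _)%E](integral_cst_probability nu).
rewrite -ge0_integralD//; last 3 first.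
- by move=> a _; apply: integral_ge0 => u _; exact: F0.
- exact: (@measurable_fun_fubini_tonelli_G _ _ (measurableTypeR R) _ _ mu F mF F0).
- by move=> a _; rewrite lee_fin mulr_ge0// sqnorm_ge0.
rewrite -[leRHS](integral_cst_probability nu); apply: ge0_le_integral => //.
- move=> a _; apply: adde_ge0; first by apply: integral_ge0 => u _; exact: F0.
  by rewrite lee_fin mulr_ge0// sqnorm_ge0.
- apply: emeasurable_funD => //.
  exact: (@measurable_fun_fubini_tonelli_G _ _ (measurableTypeR R) _ _ mu F mF F0).
Qed.

(** Let [g = avg nu f] and [h = step nu b f], which have the same norm. If neither
    the average producing [g] nor the one applied to [h] lost any norm, then [g]
    and [h] would each have at most a quarter of their mass on [[-B, B]], although
    by [sqint_inv_op_split] these two masses add up to at least the whole. The factor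
    [kappa] makes this quantitative. *)
Lemma sqnorm_step_contraction (B : R) : exists2 kappa : R, 0 <= kappa < 1 &
  forall nu, bounded_density M nu -> forall b, 0 < b <= B -> forall f, nnL2 f ->
    sqnorm (avg nu (step nu b f)) <= kappa * sqnorm f.
Proof.
have [C1 C10 H1] := mass_avg_le B; have [C2 C20 H2] := mass_le_sqnorm M0 B.
have [C [C0 C1C C2C]] : exists C, [/\ 0 <= C, C1 <= C & C2 <= C].
  by exists (Num.max C1 C2); rewrite !le_max C10 !lexx orbT.
have C34 : 0 < 3 / 4 + C by lra.
exists ((4^-1 + C) / (3 / 4 + C)).
  by rewrite divr_ge0 ?addr_ge0//= ltr_pdivrMr//; lra.
move=> nu nuM b bB f f2; have /andP[b0 _] := bB.
have g2 := nnL2_avg (ltW M0) nuM f2.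
have h2 := nnL2_step nuM b0 f2.
have s2 := nnL2_avg (ltW M0) nuM h2.
have := sqint_inv_op_split bB g2; rewrite -/(step nu b f).
have := H1 nu nuM f f2; have := H2 nu nuM (step nu b f) h2 0.
set I := `[_, _]%classic.
rewrite (sqnormE h2).
have gn := sqnorm_avg_le (ltW M0) nuM f2.
have hn : sqnorm (step nu b f) = sqnorm (avg nu f).
  by have [mg _ _] := g2; rewrite sqnorm_inv_op.
have sn := sqnorm_avg_le (ltW M0) nuM h2.
have n0 := sqnorm_ge0 (avg nu (step nu b f)).
case: (mass (step nu b f) I) (mass (avg nu f) I) => [x| |] [y| |]//.
rewrite -!EFinD !lee_fin => e1 e2 e3.
rewrite mulrAC ler_pdivlMr//.
have c1 : (C - C1) * sqnorm (avg nu f) <= (C - C1) * sqnorm f.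
  by rewrite ler_wpM2l// subr_ge0.
have c2 : (C - C2) * sqnorm (avg nu (step nu b f)) <= (C - C2) * sqnorm (step nu b f).
  by rewrite ler_wpM2l// subr_ge0.
rewrite hn in e1 e3 c2 sn.
move: e1 e2 e3 c1 c2 gn sn; clear.
set n := sqnorm f; set g := sqnorm (avg nu f); set s := sqnorm (avg _ _).
move: C n g s => C n g s.
lra.
Qed.

End transfer_step.

(** * Iterated transfer steps *)

Section iterated_step.
Context {R : realType} (M : R).
Hypothesis M0 : 0 < M.
Implicit Types (f : R -> R) (nu : probability (measurableTypeR R) R).

Definition iterstep nu (bs : seq R) f : R -> R := foldr (step nu) f bs.

(** The gain from one step: only steps with a moderate [b] are known to contract. *)
Definition damping (q B b : R) : R := if b <= B then q else 1.

Lemma damping_ge0 q B b : 0 <= q -> 0 <= damping q B b.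
Proof. by rewrite /damping; case: ifP. Qed.

Lemma nnL2_iterstep nu bs f : bounded_density M nu -> all (> 0) bs ->
  nnL2 f -> nnL2 (iterstep nu bs f).
Proof.
move=> nuM; elim: bs => //= b bs IH /andP[b0 bs0] f2.
by apply: (nnL2_step M0 nuM b0); exact: IH.
Qed.

(** Two averages are needed for a contraction. Following the product of the norms of
    two consecutive iterates lets every step contribute its own factor, wherever
    the steps with large [b] are located. *)
Lemma sqnorm_iterstep (B : R) : exists2 kappa : R, 0 <= kappa < 1 &
  forall nu, bounded_density M nu -> forall bs b f,
    all (> 0) bs -> 0 < b -> nnL2 f ->
    sqnorm (step nu b (iterstep nu bs f)) * sqnorm (iterstep nu bs f) <=
    \prod_(c <- bs) damping kappa B c * sqnorm f ^+ 2.
Proof.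
have [kappa k01 Hk] := sqnorm_step_contraction M0 B; exists kappa => //.
have /andP[k0 k1] := k01.
move=> nu nuM; elim => [|c bs IH] b f /=.
  by move=> _ b0 f2; rewrite big_nil mul1r expr2 ler_wpM2r ?sqnorm_ge0//;
    exact: (sqnorm_step_le M0).
move=> /andP[c0 bs0] b0 f2; rewrite big_cons.
have F2 := nnL2_iterstep nuM bs0 f2.
set F := iterstep nu bs f in F2 *.
have G2 := nnL2_step M0 nuM c0 F2.
set G := step nu c F in G2 *.
have h1 : sqnorm (step nu b G) <= damping kappa B c * sqnorm F.
  have [maG _ _] := nnL2_avg (ltW M0) nuM G2.
  rewrite sqnorm_inv_op// /damping; case: ifPn => cB.
    by apply: Hk => //; rewrite c0.
  rewrite mul1r (le_trans (sqnorm_avg_le (ltW M0) nuM G2))//.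
  exact: (sqnorm_step_le M0).
apply: (le_trans (ler_wpM2r (sqnorm_ge0 _) h1)).
rewrite -!mulrA ler_wpM2l ?damping_ge0// mulrC.
exact: IH.
Qed.

(** A bounded density turns the [L^2] bound into a pointwise one. The left side to
    the power 4 is at most the square of a squared norm, that is a product of two
    squared norms, so [q] is the fourth root of [kappa]. *)
Lemma avg_iterstep_le (B : R) : exists2 q : R, 0 <= q < 1 &
  forall nu, bounded_density M nu -> forall bs f u,
    all (> 0) bs -> nnL2 f ->
    avg nu (iterstep nu bs f) u <=
    Num.sqrt (M * sqnorm f) * \prod_(c <- behead bs) damping q B c.
Proof.
have [kappa /andP[k0 k1] Hk] := sqnorm_iterstep B.
have s1 (x : R) : x < 1 -> Num.sqrt x < 1.
  by move=> x1; rewrite -[ltRHS]sqrtr1 ltr_sqrt.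
pose q := Num.sqrt (Num.sqrt kappa); exists q.
  by rewrite sqrtr_ge0 /q !s1.
have q4 : q ^+ 4 = kappa.
  by rewrite -[4%N]/(2 * 2)%N exprM /q !sqr_sqrtr// sqrtr_ge0.
have q0 : 0 <= q by exact: sqrtr_ge0.
move=> nu nuM bs f u bs0 f2.
have Mf0 : 0 <= M * sqnorm f by rewrite mulr_ge0 ?sqnorm_ge0// ltW.
have it2 := nnL2_iterstep nuM bs0 f2.
have a0 : 0 <= avg nu (iterstep nu bs f) u by case: it2 => _ ? _; exact: avg_ge0.
have asq := sqr_avg_le (ltW M0) nuM u it2.
case: bs bs0 it2 a0 asq => [|b bs] /=.
  move=> _ _ a0 asq; rewrite big_nil mulr1 -(ger0_norm a0) -sqrtr_sqr.
  by rewrite ler_sqrt// (le_trans _ asq)// lexx.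
move=> /andP[b0 bs0] it2 a0 asq.
set a := avg _ _ _ in a0 asq *.
have p0 : 0 <= \prod_(c <- bs) damping q B c.
  by rewrite big_seq_cond; apply: prodr_ge0 => c _; exact: damping_ge0.
rewrite -(@ler_pXn2r _ 4)// ?nnegrE ?mulr_ge0 ?sqrtr_ge0//.
rewrite exprMn -[X in _ <= X ^+ _ * _]/(Num.sqrt (M * sqnorm f)).
have -> : Num.sqrt (M * sqnorm f) ^+ 4 = M ^+ 2 * sqnorm f ^+ 2.
  by rewrite -[4%N]/(2 * 2)%N exprM sqr_sqrtr// exprMn.
have -> : (\prod_(c <- bs) damping q B c) ^+ 4 = \prod_(c <- bs) damping kappa B c.
  rewrite -prodrXl; apply: eq_bigr => c _; rewrite /damping.
  by case: ifP => _; rewrite ?expr1n.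
rewrite -mulrA [X in _ <= _ * X]mulrC -[4%N]/(2 * 2)%N exprM.
apply: (@le_trans _ _ ((M * sqnorm (step nu b (iterstep nu bs f))) ^+ 2)).
  rewrite ler_pXn2r// ?nnegrE ?sqr_ge0//.
  by rewrite mulr_ge0 ?sqnorm_ge0// ltW.
rewrite exprMn ler_wpM2l ?sqr_ge0//.
apply: (le_trans _ (Hk nu nuM bs b f bs0 b0 f2)).
rewrite expr2 ler_wpM2l ?sqnorm_ge0//.
by apply: (sqnorm_step_le M0) => //; exact: nnL2_iterstep.
Qed.

End iterated_step.

Section tail_function.
Context {R : realType}.

(** A square integrable substitute for [1 / |v|]. *)
Definition capinv (v : R) : R := if `|v| <= 1 then 1 else `|v|^-1.

Lemma measurable_capinv : measurable_fun [set: R] capinv.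
Proof.
apply: measurable_fun_if => //.
- by apply: measurable_fun_ler => //; exact: normr_measurable.
- apply: measurable_funTS; apply: measurable_funV; exact: normr_measurable.
Qed.

Lemma capinv_gt0 v : 0 < capinv v.
Proof.
rewrite /capinv; case: ifPn => // v1; rewrite invr_gt0 (lt_trans ltr01)//.
by rewrite ltNge.
Qed.

Lemma sqint_capinv : (sqint capinv <= 4%:E)%E.
Proof.
pose I : set R := `[-1, 1]%classic.
have mI : measurable I by exact: measurable_itv.
(* [capinv v ^+ 2] is 1 on [I] and the Jacobian of [v -> - 1 / v] outside. *)
pose F (x : R) : \bar R := (\1_I x)%:E.
have mF : measurable_fun [set: R] F by apply/measurable_EFinP; exact: measurable_indic.
have F0 x : (0 <= F x)%E by rewrite lee_fin.
have mFi : measurable_fun [set: R] (fun v => (F (- 1 / v)%R * (1 / v ^+ 2)%:E)%E).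
  have mi : measurable_fun [set: R] (fun v : R => - 1 / v).
    by apply: measurable_funM => //; exact: measurable_inv.
  apply: emeasurable_funM; first exact: (measurableT_comp mF mi).
  apply/measurable_EFinP; apply: measurable_funM => //.
  by apply: measurable_funV; exact: measurable_funX.
have Fi0 v : (0 <= F (- 1 / v)%R * (1 / v ^+ 2)%:E)%E.
  by rewrite mule_ge0// lee_fin divr_ge0// sqr_ge0.
apply: (@le_trans _ _ (\int[mu]_v (F v + F (- 1 / v)%R * (1 / v ^+ 2)%:E))%E).
  apply: ge0_le_integral => //.
  - by move=> x _; rewrite lee_fin sqr_ge0.
  - by apply/measurable_EFinP; apply: measurable_funX; exact: measurable_capinv.
  - exact: emeasurable_funD.
  move=> v _; rewrite /capinv; case: ifPn => v1.
    rewrite expr1n {1}/F indicE mem_set ?leeDl//.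
    by rewrite /I /= in_itv /= -ler_norml.
  rewrite -ltNge in v1; have v0 : 0 < `|v| by rewrite (lt_trans ltr01).
  rewrite {2}/F indicE mem_set; last first.
    rewrite /I /= in_itv /= -ler_norml normrM normfV normrN1.
    by rewrite mul1r invf_le1// ltW.
  by rewrite mul1e exprVn real_normK ?num_real// div1r leeDr.
rewrite ge0_integralD// (ge0_integral_inversion ltr01 mF F0).
have muI : mu I = 2%:E.
  rewrite /I lebesgue_measure_itv/= lte_fin ifT; last lra.
  by rewrite -EFinD; congr EFin; lra.
have -> : (\int[mu]_x F x = 2%:E)%E by rewrite integral_indic// setIT; exact: muI.
by rewrite -EFinD lee_fin; lra.
Qed.

Lemma nnL2_capinv_shift (r : R) : nnL2 (fun v => capinv (v - r)).
Proof.
split.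
- by apply: (measurableT_comp measurable_capinv); exact: measurable_funB.
- by move=> x; rewrite ltW// capinv_gt0.
- rewrite /sqint (sqint_translation (- r) measurable_capinv).
  by rewrite (le_lt_trans sqint_capinv)// ltry.
Qed.

Lemma sqnorm_capinv_shift (r : R) : sqnorm (fun v => capinv (v - r)) <= 4.
Proof.
rewrite -lee_fin -sqnormE; last exact: nnL2_capinv_shift.
by rewrite /sqint (sqint_translation (- r) measurable_capinv) sqint_capinv.
Qed.

End tail_function.

(** * Independence of disjoint subfamilies *)

Section decoupling.
Context d1 d2 d (T1 : measurableType d1) (T2 : measurableType d2)
  (Omega : measurableType d) {R : realType} (P : probability Omega R).

Definition indep_maps (Y : Omega -> T1) (Z : Omega -> T2) : Prop :=
  [/\ measurable_fun setT Y, measurable_fun setT Z &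
    forall A B, measurable A -> measurable B ->
      P (Y @^-1` A `&` Z @^-1` B) = (P (Y @^-1` A) * P (Z @^-1` B))%E].

(** Freezing lemma: the joint law is the product of the laws, and the formula is
    Tonelli's theorem for it, pulled back to [Omega]. *)
Lemma indep_maps_decouple (Y : Omega -> T1) (Z : Omega -> T2)
    (F : T1 * T2 -> \bar R) :
  indep_maps Y Z -> measurable_fun setT F -> (forall p, 0 <= F p)%E ->
  (\int[P]_w F (Y w, Z w) = \int[P]_w \int[P]_w' F (Y w, Z w'))%E.
Proof.
move=> [mY mZ YZ] mF F0.
pose Y' : {mfun Omega >-> T1} := HB.pack Y (isMeasurableFun.Build _ _ _ _ _ mY).
pose Z' : {mfun Omega >-> T2} := HB.pack Z (isMeasurableFun.Build _ _ _ _ _ mZ).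
pose m1 := distribution P Y'; pose m2 := distribution P Z'.
have mYZ : measurable_fun setT (fun w => (Y w, Z w)) by exact: measurable_fun_pair.
transitivity (\int[pushforward P (fun w => (Y w, Z w))]_p F p)%E.
  by rewrite ge0_integral_pushforward// preimage_setT.
transitivity (\int[(m1 \x m2)%E]_p F p)%E.
  apply: eq_measure_integral => A mA _; apply/esym.
  by apply: product_measure_unique => // B C mB mC; exact: YZ.
rewrite fubini_tonelli1// /fubini_F.
have mG := measurable_fun_fubini_tonelli_F (m2 := m2) F mF F0.
rewrite ge0_integral_pushforward//; last first.
  by move=> x _; apply: integral_ge0.
rewrite preimage_setT; apply: eq_integral => w _ /=.
rewrite ge0_integral_pushforward// ?preimage_setT//.
by apply: (measurableT_comp mF); exact: measurable_fun_pair.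
Qed.

End decoupling.

Section subfamilies.
Context d (Omega : measurableType d) {R : realType} (P : probability Omega R)
  (J : finType) (X : J -> {RV P >-> R}).
Hypothesis indX : mutually_independent X.

Definition boxes (K : {set J}) : set (set Omega) :=
  [set A | exists B : J -> set R,
    [/\ forall i, measurable (B i), forall i, i \notin K -> B i = setT &
        A = \bigcap_(i in setT) (X i @^-1` B i)]].

(** [Omega] with the sigma-algebra generated by the variables [X i], [i \in K]:
    measurability of a function on this type says that it depends on these
    variables only. *)
Definition subsigma (K : {set J}) := g_sigma_algebraType (boxes K).

Let fullI : {fset J} := [fset i | i in J]%fset.

Let PboxE (B : J -> set R) : (forall i, measurable (B i)) ->
  P (\bigcap_(i in setT) (X i @^-1` B i)) =
  (\prod_(i <- fullI) P (X i @^-1` B i))%E.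
Proof.
move=> mB; rewrite -indX//; congr (P _); apply/seteqP; split => w /= h i.
  by move=> _; exact: h.
by move=> _; apply: h => /=; rewrite in_fset.
Qed.

Let mX i (A : set R) : measurable A -> measurable (X i @^-1` A).
Proof.
by move=> mA; rewrite -[Y in measurable Y]setTI; exact: measurable_funPT.
Qed.

Lemma boxes_measurable K : boxes K `<=` measurable.
Proof.
move=> _ [B [mB _ ->]]; apply: fin_bigcap_measurable => //.
by move=> i _; exact: mX.
Qed.

Lemma subsigma_measurable K : <<s boxes K >> `<=` (measurable : set (set Omega)).
Proof. by apply: smallest_sub; [exact: sigma_algebra_measurable|exact: boxes_measurable]. Qed.

Lemma setI_closed_boxes K : setI_closed (boxes K).
Proof.
move=> _ _ [B [mB BT ->]] [C [mC CT ->]].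
exists (fun i => B i `&` C i); split.
- by move=> i; exact: measurableI.
- by move=> i iK; rewrite BT// CT// setTI.
- apply/seteqP; split => w /=.
    by move=> [hB hC] i _; split; [exact: hB|exact: hC].
  by move=> h; split => i _; have [] := h i I.
Qed.

Lemma boxesT K : boxes K setT.
Proof.
exists (fun=> setT); split => //.
by apply/seteqP; split => w //= _ i _.
Qed.

Lemma boxes_independent (K L : {set J}) (A A' : set Omega) :
  (forall i, i \in K -> i \notin L) -> boxes K A -> boxes L A' -> P (A `&` A') = (P A * P A')%E.
Proof.
move=> KL [B [mB BT ->]] [C [mC CT ->]].
transitivity (P (\bigcap_(i in setT) (X i @^-1` (B i `&` C i)))).
  congr (P _); apply/seteqP; split => w /=.
    by move=> [hB hC] i _; split; [exact: hB|exact: hC].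
  by move=> h; split => i _; have [] := h i I.
rewrite !PboxE//; last by move=> i; exact: measurableI.
rewrite -big_split /=; apply: eq_bigr => i _.
have [iK|iK] := boolP (i \in K).
  rewrite (CT i) ?KL// setIT preimage_setT.
  by rewrite [X in _ = (_ * X)%E]probability_setT mule1.
by rewrite (BT i)// setTI preimage_setT [X in _ = (X * _)%E]probability_setT mul1e.
Qed.

(** The boxes are stable under intersection, so independence extends from boxes to
    the generated sigma-algebras by uniqueness of measures, one side at a time. *)
Lemma subsigma_independent (K L : {set J}) (A A' : set Omega) :
  (forall i, i \in K -> i \notin L) ->
  <<s boxes K >> A -> <<s boxes L >> A' -> P (A `&` A') = (P A * P A')%E.
Proof.
move=> KL.
have bT (H : {set J}) : \bigcup_(k : nat) (setT : set Omega) = setT.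
  by apply/seteqP; split => // w _; exists 0%N.
have half (K' L' : {set J}) (C : set Omega) : measurable C ->
    (forall D, boxes L' D -> P (D `&` C) = (P D * P C)%E) ->
    forall D, <<s boxes L' >> D -> P (D `&` C) = (P D * P C)%E.
  move=> mC HC D sD.
  have PC0 : 0 <= fine (P C) by exact: fine_ge0.
  have PCE : (fine (P C))%:E = P C by rewrite fineK// fin_num_measure.
  have /= := @g_sigma_algebra_measure_unique _ R Omega (boxes L')
    (@boxes_measurable L') (fun=> setT) (fun=> boxesT L') (bT L')
    (mrestr P mC) (mscale (NngNum PC0) P) (@setI_closed_boxes L').
  rewrite /mrestr /mscale /= => H.
  rewrite H//.
  - by rewrite PCE muleC.
  - by move=> E bE; rewrite HC// PCE muleC.
  - move=> _; rewrite setTI.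
    by rewrite (le_lt_trans (probability_le1 _ mC))// ltry.
move=> sA sA'.
apply: (half K K A') => //; first exact: subsigma_measurable sA'.
move=> D bD; rewrite setIC muleC; apply: (half L L D) => //.
  exact: boxes_measurable bD.
by move=> E bE; rewrite setIC muleC; exact: boxes_independent bD bE.
Qed.

Lemma measurable_coord (K : {set J}) i : i \in K ->
  measurable_fun [set: subsigma K] (X i : subsigma K -> R).
Proof.
move=> iK _ A mA; rewrite setTI; apply: sub_sigma_algebra.
exists (fun j => if j == i then A else setT); split.
- by move=> j; case: ifP.
- by move=> j jK; case: eqP => // ji; rewrite -ji (negbTE jK) in iK.
- apply/seteqP; split => w /=.
    by move=> Aw j _ /=; case: eqP => // ->.
  by move=> /(_ i I); rewrite /= eqxx.
Qed.

Lemma subsigma_measurable_fun d' (T : measurableType d') (K : {set J})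
    (Y : Omega -> T) :
  measurable_fun [set: subsigma K] (Y : subsigma K -> T) -> measurable_fun setT Y.
Proof.
move=> mY _ A mA; rewrite setTI; apply: (@subsigma_measurable K).
by have := mY measurableT A mA; rewrite setTI.
Qed.

Lemma subsigma_indep_maps d1 d2 (T1 : measurableType d1) (T2 : measurableType d2)
    (K L : {set J}) (Y : Omega -> T1) (Z : Omega -> T2) :
  (forall i, i \in K -> i \notin L) ->
  measurable_fun [set: subsigma K] (Y : subsigma K -> T1) ->
  measurable_fun [set: subsigma L] (Z : subsigma L -> T2) ->
  indep_maps P Y Z.
Proof.
move=> KL mY mZ; split; [exact: subsigma_measurable_fun mY|
  exact: subsigma_measurable_fun mZ|].
move=> A B mA mB; apply: (subsigma_independent KL).
  by have := mY measurableT A mA; rewrite setTI.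
by have := mZ measurableT B mB; rewrite setTI.
Qed.

End subfamilies.

(** * Negative moments of a bounded density *)

Section negative_moments.
Context {R : realType}.
Variable t : R.
Hypothesis t1 : t < 1.

Let mpow : measurable_fun [set: R] (fun x : R => `|x| `^ (t - 2)).
Proof. by apply: (measurableT_comp (measurable_powR _)); exact: normr_measurable. Qed.

Lemma cvg_powR_infty : x `^ (t - 1) @[x --> +oo%R] --> (0 : R).
Proof.
apply/cvgr0Pnorm_lt => e e0.
near=> x.
have xN : (e^-1) `^ ((1 - t)^-1) < x by near: x; exact: nbhs_pinfty_gt.
have x0 : 0 < x by apply: le_lt_trans xN; exact: powR_ge0.
have h : e^-1 < x `^ (1 - t).
  have <- : ((e^-1) `^ ((1 - t)^-1)) `^ (1 - t) = e^-1.
    rewrite -powRrM mulVf ?powRr1 ?invr_ge0 ?(ltW e0)//.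
    by rewrite subr_eq0 gt_eqF.
  by apply: gt0_ltr_powR => //; rewrite ?subr_gt0// nnegrE ?powR_ge0// ltW.
rewrite ger0_norm ?powR_ge0// -opprB powRN.
rewrite -[e]invrK ltf_pV2// posrE ?invr_gt0//.
exact: powR_gt0.
Unshelve. all: by end_near. Qed.

Lemma integral_powR_tail :
  (\int[mu]_(x in `[1%R, +oo[) (`|x| `^ (t - 2))%:E = ((1 - t)^-1)%:E)%E.
Proof.
have tn0 : t - 1 != 0 by rewrite subr_eq0 lt_eqF.
have dF (x : R) : 0 < x ->
    is_derive x 1 (fun y : R => (t - 1)^-1 * y `^ (t - 1)) (`|x| `^ (t - 2)).
  move=> x0; have dV := is_derive1_powR (t - 1) x0.
  have dZ := @is_deriveZ _ _ _ _ ((t - 1)^-1) _ _ _ dV.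
  apply: (is_derive_eq dZ); rewrite /GRing.scale /= mulKf// gtr0_norm//.
  by congr (_ `^ _); ring.
have cF (x : R) : 0 < x -> {for x, continuous (fun y : R => (t - 1)^-1 * y `^ (t - 1))}.
  move=> x0; apply/differentiable_continuous/derivable1_diffP.
  by have [] := dF x x0.
rewrite (@ge0_continuous_FTC2y R _ (fun y => (t - 1)^-1 * y `^ (t - 1)) 1 0)//.
- rewrite powR1 mulr1 -EFinB; congr EFin.
  by rewrite sub0r -opprB invrN opprK.
- apply: continuous_in_subspaceT => x.
  rewrite inE /= in_itv /= andbT => x1.
  have x0 : 0 < x by exact: lt_le_trans x1.
  apply: (@continuous_comp _ _ _ (@Num.norm R R) (fun y : R => y `^ (t - 2))).
    exact: norm_continuous.
  apply/differentiable_continuous/derivable1_diffP.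
  by apply: derivable_powR; rewrite in_itv /= andbT normr_gt0 gt_eqF.
- rewrite -(mulr0 ((t - 1)^-1)); apply: cvgM; first exact: cvg_cst.
  exact: cvg_powR_infty.
- by move=> x x1; have [] := dF x (lt_trans ltr01 x1).
- by apply/cvg_at_right_filter/cF.
- move=> x; rewrite in_itv /= andbT => x1; rewrite derive1E.
  by have [_ ->] := dF x (lt_trans ltr01 x1).
Qed.

Lemma integral_powR_tailN :
  (\int[mu]_(x in `]-oo, (- 1)%R]) (`|x| `^ (t - 2))%:E = ((1 - t)^-1)%:E)%E.
Proof.
rewrite -integral_powR_tail.
rewrite (_ : `]-oo, (- 1)]%classic =
    (-%R : _ -> measurableTypeR R) @^-1` `[1, +oo[); last first.
  by rewrite opp_preimage_itvbndy.
transitivity (\int[mu]_(x in (-%R : _ -> measurableTypeR R) @^-1` `[1%R, +oo[)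
    ((fun x : R => (`|x| `^ (t - 2))%:E) \o -%R) x)%E.
  by apply: eq_integral => x _ /=; rewrite normrN.
rewrite -ge0_integral_pushforward//=; last first.
  by apply: measurable_funTS; apply/measurable_EFinP; exact: mpow.
by apply: eq_measure_integral => //= A mA AS; exact: lebesgue_measureN.
Qed.

(** The substitution [v -> - 1 / v] turns the singularity at the origin into the
    tails of [|v| ^ (t - 2)]. *)
Lemma integral_powR_origin :
  (\int[mu]_x (`|x| `^ (- t) * \1_(`[(-1)%R, 1%R]%classic) x)%:E <=
   (2 / (1 - t))%:E)%E.
Proof.
pose I : set R := `[-1, 1]%classic.
have mI : measurable I by exact: measurable_itv.
pose F (x : R) : \bar R := (`|x| `^ (- t) * \1_I x)%:E.
have mF : measurable_fun [set: R] F.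
  apply/measurable_EFinP; apply: measurable_funM; last exact: measurable_indic.
  by apply: (measurableT_comp (measurable_powR _)); exact: normr_measurable.
have F0 x : (0 <= F x)%E by rewrite lee_fin mulr_ge0// powR_ge0.
rewrite -(ge0_integral_inversion ltr01 mF F0).
pose D : set R := (`[1, +oo[ `|` `]-oo, -1])%classic.
have mD : measurable D by apply: measurableU; exact: measurable_itv.
have -> : (\int[mu]_v (F (- 1 / v)%R * (1 / v ^+ 2)%:E) =
    \int[mu]_(v in D) (`|v| `^ (t - 2))%:E)%E.
  rewrite [RHS]integral_mkcond; apply: eq_integral => v _.
  rewrite patchE /F normrM normfV normrN1.
  have [->|v0] := eqVneq v 0.
    rewrite normr0 expr0n /= invr0 mulr0 mule0 memNset//.
    by rewrite /D /= !in_itv /=; lra.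
  have v0' : 0 < `|v| by rewrite normr_gt0.
  have -> : (v \in D) = (- 1 / v \in I).
    apply/idP/idP; rewrite !inE /D /I /= !in_itv /= andbT -ler_norml normrM normfV
      normrN1 mul1r invf_le1//.
      by move=> [h|h]; [rewrite ger0_norm|rewrite ltr0_norm]; lra.
    by rewrite ler_normr lerNr => /orP[]; [left|right].
  rewrite indicE; case: (_ \in I); last by rewrite mulr0 mul0e.
  have -> : (1 / `|v|) `^ (- t) = `|v| `^ t.
    by rewrite div1r -powR_inv1// -powRrM mulrNN mul1r.
  rewrite mulr1 -EFinM; congr EFin; rewrite -(real_normK (num_real v)).
  rewrite -powR_mulrn ?(ltW v0')// -powRN mul1r -powRD//.
  by rewrite (gt_eqF v0') implybT.
rewrite ge0_integral_setU//; last 2 first.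
- by apply: measurable_funTS; apply/measurable_EFinP; exact: mpow.
- by apply/disj_setPS => x [] /=; rewrite !in_itv /= andbT; lra.
by rewrite integral_powR_tail integral_powR_tailN -EFinD lee_fin; lra.
Qed.

(** [|v| capinv v] is [min (|v|, 1)], so only the singularity at [c] matters, and
    it is integrable for Lebesgue measure. *)
Lemma negative_moment_le (M : R) (nu : probability (measurableTypeR R) R) (c : R) :
  0 < M -> bounded_density M nu ->
  (\int[nu]_a ((`|(a - c)%R| * capinv (a - c)) `^ (- t))%:E <=
   (1 + M * (2 / (1 - t)))%:E)%E.
Proof.
move=> M0 nuM; pose I : set R := `[-1, 1]%classic.
have mI : measurable I by exact: measurable_itv.
pose F (x : R) : \bar R := (`|x| `^ (- t) * \1_I x)%:E.
have mF : measurable_fun [set: R] F.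
  apply/measurable_EFinP; apply: measurable_funM; last exact: measurable_indic.
  by apply: (measurableT_comp (measurable_powR _)); exact: normr_measurable.
have F0 x : (0 <= F x)%E by rewrite lee_fin mulr_ge0// powR_ge0.
have msub : measurable_fun [set: R] (fun x : R => x - c) by exact: measurable_funB.
have mFc : measurable_fun [set: R] (fun x : R => F (x - c)).
  exact: (measurableT_comp mF msub).
apply: (@le_trans _ _ (\int[nu]_a (1%:E + F (a - c)%R))%E).
  apply: ge0_le_integral => //.
  - by move=> x _; rewrite lee_fin powR_ge0.
  - apply/measurable_EFinP; apply: (measurableT_comp (measurable_powR _)).
    apply: measurable_funM; first exact: (measurableT_comp (@normr_measurable _ _)).
    exact: (measurableT_comp measurable_capinv).
  - exact: emeasurable_funD.
  move=> x _; rewrite /F -EFinD lee_fin /capinv.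
  case: ifPn => h.
    rewrite mulr1 indicE mem_set ?mulr1 ?lerDr//.
    by rewrite /I /= in_itv /= -ler_norml.
  rewrite mulfV ?powR1 ?lerDl ?mulr_ge0 ?powR_ge0//.
  by rewrite gt_eqF// (lt_trans ltr01)// ltNge.
rewrite ge0_integralD// integral_cst_probability EFinD leeD2l// EFinM.
apply: (le_trans (ge0_integral_bounded_density (ltW M0) nuM mFc (fun x => F0 _))).
rewrite lee_pmul2l//.
rewrite (@ge0_integral_translation R (- c) F mF F0).
exact: integral_powR_origin.
Qed.

End negative_moments.

(** * Pivots of a random chain *)

(** The diagonal of the LU factorization of the tridiagonal matrix with diagonal [al]
    and off-diagonal [be]. *)
Fixpoint pivot {F : fieldType} (al be : nat -> F) (n : nat) : F :=
  if n is k.+1 then al n - be k ^+ 2 / pivot al be k else al 0%N.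

Definition transfer {R : realType} (al be : nat -> R) (n : nat) : R :=
  \prod_(j < n) (be j / `|pivot al be j|).

Lemma transferS {R : realType} (al be : nat -> R) n :
  transfer al be n.+1 = transfer al be n * (be n / `|pivot al be n|).
Proof. by rewrite /transfer big_ord_recr. Qed.

Lemma eq_pivot {F : fieldType} (al al' be be' : nat -> F) n :
  (forall i, (i <= n)%N -> al i = al' i) ->
  (forall i, (i < n)%N -> be i = be' i) -> pivot al be n = pivot al' be' n.
Proof.
elim: n => [|n IH] ha hb /=; first exact: ha.
rewrite ha// hb// IH// => i lin; [apply: ha|apply: hb]; exact: leqW.
Qed.

Lemma eq_transfer {R : realType} (al al' be be' : nat -> R) n :
  (forall i, (i < n)%N -> al i = al' i) ->
  (forall i, (i < n)%N -> be i = be' i) -> transfer al be n = transfer al' be' n.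
Proof.
move=> ha hb; apply: eq_bigr => j _; rewrite hb//.
rewrite (@eq_pivot _ al al' be be' j)// => i ij; [apply: ha|apply: hb].
  exact: leq_ltn_trans ij (ltn_ord j).
exact: ltn_trans ij (ltn_ord j).
Qed.

Section pivot_measurable.
Context d (T : measurableType d) {R : realType}.
Variables (al be : nat -> T -> R) (n : nat).
Hypothesis mal : forall i, (i <= n)%N -> measurable_fun setT (al i).
Hypothesis mbe : forall i, (i < n)%N -> measurable_fun setT (be i).

Lemma measurable_pivot : measurable_fun setT (fun w => pivot (al^~ w) (be^~ w) n).
Proof.
move: mal mbe; elim: n => [|k IH] ma mb /=; first exact: ma.
apply: measurable_funB; first exact: ma.
apply: measurable_funM; first by apply: measurable_funX; exact: mb.
apply: measurable_funV; apply: IH => i ik; [apply: ma|apply: mb]; exact: leqW.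
Qed.

End pivot_measurable.

Lemma measurable_transfer d (T : measurableType d) {R : realType}
    (al be : nat -> T -> R) n :
  (forall i, (i < n)%N -> measurable_fun setT (al i)) ->
  (forall i, (i < n)%N -> measurable_fun setT (be i)) ->
  measurable_fun setT (fun w => transfer (al^~ w) (be^~ w) n).
Proof.
move=> ma mb; apply: measurable_prod => j _.
apply: measurable_funM; first exact: mb.
apply: measurable_funV; apply: (measurableT_comp (@normr_measurable _ _)).
apply: measurable_pivot => i ij; [apply: ma|apply: mb].
  exact: leq_ltn_trans ij (ltn_ord j).
exact: ltn_trans ij (ltn_ord j).
Qed.

Lemma transfer_ge0 {R : realType} (al be : nat -> R) n :
  (forall i, (i < n)%N -> 0 < be i) -> 0 <= transfer al be n.
Proof.
by move=> hb; apply: prodr_ge0 => j _; rewrite divr_ge0// ltW// hb.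
Qed.

(** A chain restarted at an inner site: the sites to its left act on it only through
    the number [l] subtracted from its first diagonal entry. *)
Definition shift0 {R : realType} (l : R) (a : nat -> R) (j : nat) : R :=
  if j is 0%N then a 0%N - l else a j.

Section chain.
Context d (Omega : measurableType d) {R : realType} (P : probability Omega R)
  (J : finType) (X : J -> {RV P >-> R}).
Hypothesis indX : mutually_independent X.

Lemma measurable_shift0_coord (ia : nat -> J) (K : {set J}) (l : R) i :
  ia i \in K -> measurable_fun [set: subsigma X K]
    ((fun w => shift0 l (fun j => X (ia j) w) i) : subsigma X K -> R).
Proof.
move=> iK; have mc := @measurable_coord _ _ _ _ _ X K _ iK.
by case: i iK mc => [|i] iK mc //=; apply: measurable_funB.
Qed.

Lemma law_transfer (nu : probability (measurableTypeR R) R) (Y : {RV P >-> R})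
    (F : R -> \bar R) :
  (forall A, measurable A -> P (Y @^-1` A) = nu A) ->
  measurable_fun [set: R] F -> (forall x, 0 <= F x)%E ->
  (\int[P]_w F (Y w) = \int[nu]_x F x)%E.
Proof.
move=> Ynu mF F0.
pose Y' : Omega -> measurableTypeR R := Y.
have mY : measurable_fun setT Y' by exact: (measurable_funPT Y).
transitivity (\int[pushforward P Y']_x F x)%E.
  by rewrite ge0_integral_pushforward// preimage_setT.
by apply: eq_measure_integral => A mA _; exact: Ynu.
Qed.

Context (M : R) (nu : probability (measurableTypeR R) R).
Hypotheses (M0 : 0 < M) (nuM : bounded_density M nu).

(** Integrating out the last diagonal entry, on which only the last pivot depends,
    replaces the test function [f] by [step nu b f] and shortens the chain by one. *)
Lemma chain_expectation (ia : nat -> J) (be : nat -> R) (l : R) (n : nat)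
    (f : R -> R) :
  (forall i j, (i <= n)%N -> (j <= n)%N -> ia i = ia j -> i = j) ->
  (forall i A, (i <= n)%N -> measurable A -> P (X (ia i) @^-1` A) = nu A) ->
  (forall i, (i < n)%N -> 0 < be i) -> nnL2 f ->
  (\int[P]_w (transfer (shift0 l (fun j => X (ia j) w)) be n *
     f (pivot (shift0 l (fun j => X (ia j) w)) be n))%:E =
   (avg nu (iterstep nu (mkseq be n) f) (- l))%:E)%E.
Proof.
elim: n f => [|n IH] f inj law be0 f2.
  have [mf f0 _] := f2.
  under eq_integral do rewrite /transfer big_ord0 mul1r /=.
  rewrite (@law_transfer nu (X (ia 0%N)) (fun x => (f (x - l))%:E)).
  - exact: (avgE (ltW M0) nuM).
  - by move=> A mA; exact: law.
  - apply/measurable_EFinP; apply: (measurableT_comp mf).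
    exact: measurable_funB.
  - by move=> x; rewrite lee_fin.
have [mf f0 _] := f2.
have be0' i : (i < n)%N -> 0 < be i by move=> ni; apply: be0; exact: ltnW.
have bn : 0 < be n by exact: be0.
have s2 : nnL2 (step nu (be n) f) by exact: (nnL2_step M0 nuM bn f2).
rewrite mkseqS -cats1 /iterstep foldr_cat /= -/(iterstep nu (mkseq be n) _).
rewrite -(IH (step nu (be n) f)) //; last 2 first.
- by move=> i j ni nj; apply: inj; exact: leqW.
- by move=> i A ni; apply: law; exact: leqW.
pose K : {set J} := [set j | [exists i : 'I_n.+1, j == ia i]]%SET.
have inK i : (i <= n)%N -> ia i \in K.
  move=> ni; rewrite inE; apply/existsP.
  by exists (Ordinal (ni : (i < n.+1)%N)).
pose al w := shift0 l (fun j => X (ia j) w).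
pose Y w := (transfer (al w) be n, pivot (al w) be n).
pose Z w := X (ia n.+1) w.
have YZ : indep_maps P Y Z.
  apply: (@subsigma_indep_maps _ _ _ _ _ _ indX _ _ _ _ K [set ia n.+1]%SET).
  - move=> j; rewrite !inE => /existsP[i /eqP ->].
    apply/eqP => /inj; have := ltn_ord i => ni.
    by rewrite ltnW// leqnn => /(_ isT isT) E; rewrite E ltnn in ni.
  - apply: measurable_fun_pair.
      apply: (@measurable_transfer _ (subsigma X K) R (fun i w => al w i) (fun i _ => be i)).
        by move=> i ni; apply: measurable_shift0_coord; apply: inK; exact: ltnW.
      by [].
    apply: (@measurable_pivot _ (subsigma X K) R (fun i w => al w i) (fun i _ => be i)).
      by move=> i ni; apply: measurable_shift0_coord; exact: inK.
    by [].
  - by apply: measurable_coord; rewrite inE.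
pose F (p : (R * R) * R) : \bar R :=
  (`|p.1.1| * (be n / `|p.1.2|) * f (p.2 - be n ^+ 2 / p.1.2))%:E.
have mF : measurable_fun setT F.
  have m11 : measurable_fun setT (fun p : (R * R) * R => p.1.1).
    by apply: measurableT_comp.
  have m12 : measurable_fun setT (fun p : (R * R) * R => p.1.2).
    by apply: measurableT_comp.
  apply/measurable_EFinP; apply: measurable_funM.
    apply: measurable_funM; first exact: measurableT_comp.
    by apply: measurable_funM => //; apply: measurable_funV; exact: measurableT_comp.
  apply: (measurableT_comp mf); apply: measurable_funB => //.
  by apply: measurable_funM => //; exact: measurable_funV.
have F0 p : (0 <= F p)%E.
  by rewrite lee_fin mulr_ge0// mulr_ge0// divr_ge0// ltW.
transitivity (\int[P]_w F (Y w, Z w))%E.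
  apply: eq_integral => w _; rewrite /F /Y /Z /= transferS.
  by rewrite (ger0_norm (transfer_ge0 (al w) be0')).
rewrite (indep_maps_decouple YZ mF F0); apply: eq_integral => w _.
have mFw : measurable_fun [set: R] (fun x => F (Y w, x)).
  by apply: (measurableT_comp mF); exact: measurable_fun_pair.
rewrite (@law_transfer nu (X (ia n.+1)) (fun x => F (Y w, x)))//; last first.
  by move=> A mA; exact: law.
rewrite /F /Y /=; set z := transfer _ _ _; set v := pivot _ _ _.
under eq_integral do rewrite EFinM.
rewrite ge0_integralZl//; last 3 first.
- apply/measurable_EFinP; apply: (measurableT_comp mf); exact: measurable_funB.
- by move=> x _; rewrite lee_fin.
- by rewrite lee_fin mulr_ge0// divr_ge0// ltW.
rewrite (avgE (ltW M0) nuM (- (be n ^+ 2 / v)) f2) -EFinM.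
rewrite (ger0_norm (transfer_ge0 (al w) be0')).
by rewrite /step /inv_op mulNr mulrA.
Qed.

End chain.

(** * Fractional moments of real chains *)

(** The integral is a supremum over the simple functions below the integrand, hence
    monotone on arbitrary nonnegative functions. *)
Lemma ge0_le_integralT d (T : measurableType d) (R : realType)
    (m : {measure set T -> \bar R}) (f g : T -> \bar R) :
  (forall x, 0 <= f x)%E -> (forall x, f x <= g x)%E ->
  (\int[m]_x f x <= \int[m]_x g x)%E.
Proof.
move=> f0 fg; have g0 x : (0 <= g x)%E by exact: le_trans (fg x).
rewrite !ge0_integralTE//; apply: ereal_sup_le => _ [h /= hf] <-.
by exists h => // x; exact: le_trans (fg x).
Qed.

Lemma subsigma_mono d (Omega : measurableType d) {R : realType}
    (P : probability Omega R) (J : finType) (X : J -> {RV P >-> R})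
    (K L : {set J}) d' (T : measurableType d') (f : Omega -> T) :
  (forall j, j \in K -> j \in L) ->
  measurable_fun [set: subsigma X K] (f : subsigma X K -> T) ->
  measurable_fun [set: subsigma X L] (f : subsigma X L -> T).
Proof.
move=> KL mf _ A mA; have := mf measurableT A mA.
have sub : <<s boxes X K >> `<=` <<s boxes X L >>; last exact: sub.
apply: smallest_sub; first exact: smallest_sigma_algebra.
move=> _ [B [mB BT ->]]; apply: sub_sigma_algebra; exists B; split => // i iL.
by apply: BT; apply: contra iL; exact: KL.
Qed.

Section resolvent_moment.
Context d (Omega : measurableType d) {R : realType} (P : probability Omega R)
  (J : finType) (X : J -> {RV P >-> R}).
Hypothesis indX : mutually_independent X.

Lemma measurable_damping (q B : R) : measurable_fun [set: R] (damping q B).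
Proof. by apply: measurable_fun_if => //; exact: measurable_fun_ler. Qed.

(** Each factor has mean at most [(1 + q) / 2], as it equals [q] with probability at
    least 1/2, and the factors are independent. *)
Lemma expectation_damping (q B : R) (ib : nat -> J) (n : nat) : 0 <= q <= 1 ->
  (forall i j, (i < n)%N -> (j < n)%N -> ib i = ib j -> i = j) ->
  (forall i, (i < n)%N -> ((2^-1)%:E <= P (X (ib i) @^-1` `]-oo, B]%classic))%E) ->
  (\int[P]_w (\prod_(j < n) damping q B (X (ib j) w))%:E <=
   (((1 + q) / 2) ^+ n)%:E)%E.
Proof.
move=> /andP[q0 q1]; elim: n => [|n IH] inj PB.
  under eq_integral do rewrite big_ord0.
  by rewrite integral_cst_probability expr0.
pose K : {set J} := [set j | [exists i : 'I_n, j == ib i]]%SET.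
pose Y w := \prod_(j < n) damping q B (X (ib j) w).
pose Z w := damping q B (X (ib n) w).
have mY : measurable_fun [set: subsigma X K] (Y : subsigma X K -> R).
  apply: measurable_prod => j _; apply: (measurableT_comp (measurable_damping q B)).
  by apply: measurable_coord; rewrite inE; apply/existsP; exists j.
have mZ : measurable_fun [set: subsigma X [set ib n]%SET]
    (Z : subsigma X [set ib n]%SET -> R).
  apply: (measurableT_comp (measurable_damping q B)).
  by apply: measurable_coord; rewrite inE.
have YZ : indep_maps P Y Z.
  apply: (@subsigma_indep_maps _ _ _ _ _ _ indX _ _ _ _ K [set ib n]%SET) => //.
  move=> j; rewrite !inE => /existsP[i /eqP ->].
  apply/eqP => /inj; rewrite (ltnW (ltn_ord i : (i.+1 < n.+1)%N)) leqnn.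
  by move=> /(_ isT isT) E; have := ltn_ord i; rewrite E ltnn.
have Y0 w : 0 <= Y w by apply: prodr_ge0 => j _; exact: damping_ge0.
have Z0 w : 0 <= Z w by exact: damping_ge0.
pose F (p : R * R) : \bar R := (`|p.1| * `|p.2|)%:E.
have mF : measurable_fun setT F.
  apply/measurable_EFinP; apply: measurable_funM;
    by apply: (measurableT_comp (@normr_measurable _ _)).
have -> : (\int[P]_w (\prod_(j < n.+1) damping q B (X (ib j) w))%:E =
    \int[P]_w F (Y w, Z w))%E.
  apply: eq_integral => w _; rewrite big_ord_recr /= /F /=.
  by rewrite !ger0_norm.
rewrite (indep_maps_decouple YZ mF); last by move=> p; rewrite lee_fin mulr_ge0.
have mY' : measurable_fun setT Y by case: YZ.
have mZ' : measurable_fun setT Z by case: YZ.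
have EZ : (\int[P]_w (Z w)%:E <= ((1 + q) / 2)%:E)%E.
  pose D := X (ib n) @^-1` `]-oo, B]%classic.
  have mD : measurable D.
    by rewrite -[X in measurable X]setTI; exact: measurable_funPT.
  have : (\int[P]_w (Z w)%:E + (1 - q)%:E * P D = 1)%E.
    have -> : P D = (\int[P]_w (\1_D w)%:E)%E by rewrite integral_indic// setIT.
    have mI : measurable_fun setT (fun w => (\1_D w : R)%:E).
      by apply/measurable_EFinP; exact: measurable_indic.
    have q10 : (0 <= (1 - q)%:E)%E by rewrite lee_fin subr_ge0.
    rewrite -(ge0_integralZl P measurableT mI)//.
    rewrite -ge0_integralD//; last 4 first.
    - by move=> w _; rewrite lee_fin.
    - exact/measurable_EFinP.
    - by move=> w _; rewrite -EFinM lee_fin mulr_ge0// subr_ge0.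
    - by apply: measurable_funeM; apply/measurable_EFinP; exact: measurable_indic.
    rewrite -[RHS](integral_cst_probability P); apply: eq_integral => w _.
    rewrite -EFinM -EFinD; congr EFin; rewrite /Z /damping indicE.
    have -> : (w \in D) = (X (ib n) w <= B).
      by apply/idP/idP; rewrite inE /D /= in_itv.
    by case: ifP => _; rewrite /= ?mulr1 ?mulr0; ring.
  have := PB n (ltnSn n); rewrite -/D.
  have PDf : P D \is a fin_num by exact: fin_num_measure.
  rewrite -(fineK PDf) lee_fin => pD.
  have : (0 <= \int[P]_w (Z w)%:E)%E by apply: integral_ge0 => w _; rewrite lee_fin.
  case: (\int[P]_w (Z w)%:E)%E => [z| |]//= _; rewrite -EFinM -EFinD lee_fin.
  move=> [E]; have := ler_wpM2l (_ : 0 <= 1 - q) pD; rewrite subr_ge0 => /(_ q1).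
  lra.
apply: (@le_trans _ _ (\int[P]_w (((1 + q) / 2)%:E * (Y w)%:E))%E).
  apply: ge0_le_integral => //.
  - by move=> w _; apply: integral_ge0 => w' _; rewrite lee_fin mulr_ge0.
  - rewrite [X in measurable_fun _ X](_ : _ =
      fun w => (\int[P]_w (Z w)%:E * (Y w)%:E)%E).
      by apply: measurable_funeM; exact/measurable_EFinP.
    apply/funext => w; under eq_integral do rewrite /F /= !ger0_norm// mulrC EFinM.
    rewrite ge0_integralZr//.
    + exact/measurable_EFinP.
    + by move=> x _; rewrite lee_fin.
    + by rewrite lee_fin.
  - by apply: measurable_funeM; exact/measurable_EFinP.
  move=> w _; under eq_integral do rewrite /F /= !ger0_norm// mulrC EFinM.
  rewrite ge0_integralZr//.
  + by rewrite lee_wpmul2r// lee_fin.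
  + exact/measurable_EFinP.
  + by move=> x _; rewrite lee_fin.
  + by rewrite lee_fin.
have mYE : measurable_fun setT (fun w => (Y w)%:E) by exact/measurable_EFinP.
rewrite (ge0_integralZl P measurableT mYE); last 2 first.
- by move=> w _; rewrite lee_fin.
- by rewrite lee_fin divr_ge0// addr_ge0.
rewrite exprS [X in (_ <= X)%E]EFinM lee_pmul2l//.
  by apply: IH => [i j ni nj|i ni]; [apply: inj|apply: PB]; exact: ltnW.
by rewrite lte_fin divr_gt0// ltr_pwDl.
Qed.

Lemma behead_mkseq (T : Type) (g : nat -> T) n :
  behead (mkseq g n) = mkseq (fun i => g i.+1) n.-1.
Proof.
by case: n => // n; rewrite /mkseq /= -[1%N]addn0 iotaDl -map_comp.
Qed.

Lemma prod_mkseq (T : Type) (g : nat -> T) (F : T -> R) n :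
  \prod_(c <- mkseq g n) F c = \prod_(j < n) F (g j).
Proof.
by rewrite /mkseq big_map -{1}(subn0 n) -/(index_iota 0 n) big_mkord.
Qed.

Context (M B : R) (nu : probability (measurableTypeR R) R).
Hypotheses (M0 : 0 < M) (nuM : bounded_density M nu).
Variables (ia ib : nat -> J) (n : nat) (L : {set J}) (l r : Omega -> R).
Hypothesis ia_inj : forall i j, (i <= n)%N -> (j <= n)%N -> ia i = ia j -> i = j.
Hypothesis ib_inj : forall i j, (i < n)%N -> (j < n)%N -> ib i = ib j -> i = j.
Hypothesis law : forall i A, (i <= n)%N -> measurable A ->
  P (X (ia i) @^-1` A) = nu A.
Hypothesis ib0 : forall i, (i < n)%N -> forall w, 0 < X (ib i) w.
Hypothesis ibB : forall i, (i < n)%N ->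
  ((2^-1)%:E <= P (X (ib i) @^-1` `]-oo, B]%classic))%E.
Hypothesis iaL : forall i, (i <= n)%N -> ia i \notin L.
Hypothesis ibL : forall i, (i < n)%N -> ib i \in L.
Hypothesis ml : measurable_fun [set: subsigma X L] (l : subsigma X L -> R).
Hypothesis mr : measurable_fun [set: subsigma X L] (r : subsigma X L -> R).

Let diag w := shift0 (l w) (fun j => X (ia j) w).
Let offd w (j : nat) : R := X (ib j) w.
Let V w := pivot (diag w) (offd w) n - r w.
Let Z w := transfer (diag w) (offd w) n.

(** Everything measurable for [L], in particular the off-diagonal entries, [l] and
    [r], can be frozen while the diagonal entries are integrated out. *)
Lemma expectation_transfer (q : R) : 0 <= q <= 1 ->
  (forall bs (f : R -> R) u, all (> 0) bs -> nnL2 f ->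
    avg nu (iterstep nu bs f) u <=
    Num.sqrt (M * sqnorm f) * \prod_(c <- behead bs) damping q B c) ->
  (\int[P]_w (Z w * capinv (V w))%:E <=
   (Num.sqrt (M * 4) * ((1 + q) / 2) ^+ n.-1)%:E)%E.
Proof.
move=> q01 Hq; have /andP[q0 q1] := q01.
pose Ka : {set J} := [set j | [exists i : 'I_n.+1, j == ia i]]%SET.
have inK i : (i <= n)%N -> ia i \in Ka.
  move=> ni; rewrite inE; apply/existsP.
  by exists (Ordinal (ni : (i < n.+1)%N)).
pose T := (subsigma X L * subsigma X Ka)%type.
pose al (i : nat) (p : T) : R := shift0 (l p.1) (fun j => X (ia j) p.2) i.
pose be (i : nat) (p : T) : R := X (ib i) p.1.
have mal i : (i <= n)%N -> measurable_fun setT (al i).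
  move=> ni; have mc : measurable_fun setT (fun p : T => X (ia i) p.2).
    apply: (measurableT_comp _ measurable_snd).
    by apply: measurable_coord; exact: inK.
  case: i ni mc => [|i] ni mc //.
  by apply: measurable_funB => //; exact: (measurableT_comp ml).
have mbe i : (i < n)%N -> measurable_fun setT (be i).
  move=> ni; apply: (measurableT_comp _ measurable_fst).
  by apply: measurable_coord; exact: ibL.
pose F (p : T) : \bar R := (`|transfer (al^~ p) (be^~ p) n| *
  capinv (pivot (al^~ p) (be^~ p) n - r p.1))%:E.
have mF : measurable_fun setT F.
  apply/measurable_EFinP; apply: measurable_funM.
    apply: (measurableT_comp (@normr_measurable _ _)).
    by apply: measurable_transfer => i ni; [apply: mal; exact: ltnW|exact: mbe].
  apply: (measurableT_comp measurable_capinv); apply: measurable_funB.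
    exact: measurable_pivot.
  exact: (measurableT_comp mr).
have F0 p : (0 <= F p)%E by rewrite lee_fin mulr_ge0// ltW// capinv_gt0.
have ind : indep_maps P (id : Omega -> subsigma X L) (id : Omega -> subsigma X Ka).
  apply: (@subsigma_indep_maps _ _ _ _ _ _ indX _ _ _ _ L Ka) => //.
  move=> j jL; rewrite inE; apply/existsP => -[i /eqP ji].
  by move: jL; rewrite ji; apply/negP/iaL; rewrite -ltnS.
have -> : (\int[P]_w (Z w * capinv (V w))%:E = \int[P]_w F (w, w))%E.
  apply: eq_integral => w _; rewrite /F /=.
  by rewrite (ger0_norm (transfer_ge0 _ (fun i ni => ib0 ni w))).
have := indep_maps_decouple ind mF F0; rewrite /= => ->.
have mG : measurable_fun setT (fun w => (Num.sqrt (M * 4) *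
    \prod_(j < n.-1) damping q B (X (ib j.+1) w))%:E).
  apply/measurable_EFinP; apply: measurable_funM => //.
  by apply: measurable_prod => j _; apply: (measurableT_comp (measurable_damping q B)).
have ipos (w : Omega) : (0 <= \int[P]_w' F (w, w'))%E by apply: integral_ge0 => x _.
have inner (w : Omega) : (\int[P]_w' F (w, w') <= (Num.sqrt (M * 4) *
    \prod_(j < n.-1) damping q B (X (ib j.+1) w))%:E)%E.
  pose f x := capinv (x - r w).
  have f2 : nnL2 f by exact: nnL2_capinv_shift.
  have b0 : forall i, (i < n)%N -> 0 < offd w i by move=> i ni; exact: ib0.
  have -> : (\int[P]_w' F (w, w') = (avg nu (iterstep nu (mkseq (offd w) n) f) (- l w))%:E)%E.
    rewrite -(@chain_expectation _ _ _ _ _ _ indX M nu M0 nuM ia (offd w) (l w) n f)//.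
    apply: eq_integral => w' _; rewrite /F /=.
    by rewrite (ger0_norm (transfer_ge0 _ b0)).
  rewrite lee_fin; apply: (le_trans (Hq _ _ _ _ f2)).
    rewrite /mkseq all_map; apply/allP => i; rewrite mem_iota add0n => /andP[_ ni].
    exact: b0.
  rewrite behead_mkseq prod_mkseq ler_wpM2r//.
    by apply: prodr_ge0 => j _; exact: damping_ge0.
  rewrite ler_wsqrtr// ler_wpM2l ?(ltW M0)//; exact: sqnorm_capinv_shift.
apply: (le_trans (@ge0_le_integralT _ Omega R P _ _ ipos inner)).
have mprod : measurable_fun setT
    (fun w => (\prod_(j < n.-1) damping q B (X (ib j.+1) w))%:E).
  apply/measurable_EFinP.
  by apply: measurable_prod => j _; apply: (measurableT_comp (measurable_damping q B)).
under eq_integral do rewrite EFinM.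
rewrite (ge0_integralZl P measurableT mprod); last 2 first.
- by move=> w _; rewrite lee_fin; apply: prodr_ge0 => j _; exact: damping_ge0.
- by rewrite lee_fin sqrtr_ge0.
rewrite [leRHS]EFinM lee_wpmul2l ?lee_fin ?sqrtr_ge0//.
apply: (@expectation_damping q B (fun j => ib j.+1)) => //.
- by move=> i j hi hj /ib_inj; rewrite -!ltn_predRL => /(_ hi hj) [].
- by move=> i hi; apply: ibB; rewrite -ltn_predRL.
Qed.

(** [V] is the last diagonal entry minus a function of the other variables, so its
    conditional law has the same bounded density up to a translation. *)
Lemma expectation_negative_moment (t : R) : t < 1 ->
  (\int[P]_w ((`|V w| * capinv (V w)) `^ (- t))%:E <=
   (1 + M * (2 / (1 - t)))%:E)%E.
Proof.
move=> t1.
pose K : {set J} := [set j | (j \in L) || [exists i : 'I_n, j == ia i]]%SET.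
have LK j : j \in L -> j \in K by rewrite inE => ->.
have aK i : (i < n)%N -> ia i \in K.
  move=> ni; rewrite inE; apply/orP; right; apply/existsP.
  by exists (Ordinal ni).
pose c w := if n is k.+1 then offd w k ^+ 2 / pivot (diag w) (offd w) k + r w
  else l w + r w.
have VE w : V w = X (ia n) w - c w.
  by rewrite /V /c; case: (n) => [|k] /=; rewrite opprD addrA.
have ml' := subsigma_mono LK ml; have mr' := subsigma_mono LK mr.
have mc : measurable_fun [set: subsigma X K] (c : subsigma X K -> R).
  rewrite /c; case E : n => [|k]; first exact: measurable_funD.
  apply: measurable_funD => //; apply: measurable_funM.
    by apply: measurable_funX; apply: measurable_coord; apply/LK/ibL; rewrite E.
  apply: measurable_funV.
  apply: (@measurable_pivot _ (subsigma X K) R (fun i w => diag w i) (fun i w => offd w i)).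
    move=> i ik; have iK : ia i \in K by apply: aK; rewrite E.
    have mci := @measurable_coord _ _ _ _ _ X K _ iK.
    by case: i ik iK mci => [|i] ik iK mci //; exact: measurable_funB.
  by move=> i ik; apply: measurable_coord; apply/LK/ibL; rewrite E ltnW.
pose F (p : R * R) : \bar R := ((`|p.2 - p.1| * capinv (p.2 - p.1)) `^ (- t))%:E.
have mF : measurable_fun setT F.
  have msub : measurable_fun setT (fun p : R * R => p.2 - p.1).
    exact: measurable_funB.
  apply/measurable_EFinP; apply: (measurableT_comp (measurable_powR _)).
  apply: measurable_funM; first exact: (measurableT_comp (@normr_measurable _ _)).
  exact: (measurableT_comp measurable_capinv).
have F0 p : (0 <= F p)%E by rewrite lee_fin powR_ge0.
have ind : indep_maps P c (X (ia n)).
  apply: (@subsigma_indep_maps _ _ _ _ _ _ indX _ _ _ _ K [set ia n]%SET) => //.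
    move=> j; rewrite !inE => /orP[jL|/existsP[i /eqP ->]]; apply/eqP.
      by move=> ji; move: jL; rewrite ji; apply/negP; exact: iaL.
    move=> /ia_inj; rewrite leqnn ltnW// => /(_ isT isT) E.
    by have := ltn_ord i; rewrite E ltnn.
  by apply: measurable_coord; rewrite inE.
have -> : (\int[P]_w ((`|V w| * capinv (V w)) `^ (- t))%:E =
    \int[P]_w F (c w, X (ia n) w))%E.
  by apply: eq_integral => w _; rewrite /F /= VE.
rewrite (indep_maps_decouple ind mF F0).
rewrite -[leRHS](integral_cst_probability P); apply: ge0_le_integralT.
  by move=> w; apply: integral_ge0.
move=> w.
rewrite (@law_transfer _ _ _ P nu (X (ia n)) (fun x => F (c w, x)))//.
- exact: negative_moment_le.
- by move=> A mA; exact: law.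
- by apply: (measurableT_comp mF); exact: measurable_fun_pair.
Qed.

End resolvent_moment.

(** Split [Z / |V|] as [(Z h) / (|V| h)] with [h = capinv V], and apply Young's
    inequality with exponents [1 / s] and [1 / (1 - s)] after scaling [Z h] by its
    typical size [theta ^+ n]. The assumption [s < 2^-1] is what makes the remaining
    negative power [t = s / (1 - s)] of [|V| h] smaller than 1, hence integrable. *)
Theorem resolvent_moment_decay {R : realType} (M B : R) : 0 < M ->
  exists2 theta : R, 0 < theta < 1 &
  forall s : R, 0 < s -> s < 2^-1 -> exists2 C : R, 0 < C &
  forall d (Omega : measurableType d) (P : probability Omega R)
    (J : finType) (X : J -> {RV P >-> R})
    (nu : probability (measurableTypeR R) R)
    (ia ib : nat -> J) (n : nat) (L : {set J}) (l r : Omega -> R),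
  mutually_independent X -> bounded_density M nu ->
  (forall i j, (i <= n)%N -> (j <= n)%N -> ia i = ia j -> i = j) ->
  (forall i j, (i < n)%N -> (j < n)%N -> ib i = ib j -> i = j) ->
  (forall i A, (i <= n)%N -> measurable A -> P (X (ia i) @^-1` A) = nu A) ->
  (forall i, (i < n)%N -> forall w, 0 < X (ib i) w) ->
  (forall i, (i < n)%N -> ((2^-1)%:E <= P (X (ib i) @^-1` `]-oo, B]%classic))%E) ->
  (forall i, (i <= n)%N -> ia i \notin L) ->
  (forall i, (i < n)%N -> ib i \in L) ->
  measurable_fun [set: subsigma X L] (l : subsigma X L -> R) ->
  measurable_fun [set: subsigma X L] (r : subsigma X L -> R) ->
  (\int[P]_w ((transfer (shift0 (l w) (fun j => X (ia j) w)) (fun j => X (ib j) w) n /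
     `|pivot (shift0 (l w) (fun j => X (ia j) w)) (fun j => X (ib j) w) n - r w|)
       `^ s)%:E <= (C * theta `^ (s * n%:R))%:E)%E.
Proof.
move=> M0; have [q q01 Hq] := avg_iterstep_le M0 B.
have /andP[q0 q1] := q01.
pose theta := (1 + q) / 2; have th0 : 0 < theta by rewrite divr_gt0// ltr_pwDl.
have th1 : theta < 1 by rewrite /theta; lra.
exists theta; first by rewrite th0.
move=> s s0 s2; pose t := s / (1 - s).
have s1 : 0 < 1 - s by lra.
have t1 : t < 1 by rewrite /t ltr_pdivrMr//; lra.
pose C1 := Num.sqrt (M * 4); pose C2 := 1 + M * (2 / (1 - t)).
have C20 : 0 < C2.
  by rewrite /C2 ltr_pwDl// mulr_ge0 ?(ltW M0)// divr_ge0// subr_ge0 ltW.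
have C10 : 0 <= C1 / theta by rewrite divr_ge0 ?sqrtr_ge0// ltW.
exists (C1 / theta + C2); first by rewrite ltr_wpDl.
move=> d Omega P J X nu ia ib n L l r indX nuM iai ibi law ib0 ibB iaL ibL ml mr.
pose diag w := shift0 (l w) (fun j => X (ia j) w).
pose offd w (j : nat) : R := X (ib j) w.
pose Z w := transfer (diag w) (offd w) n.
pose V w := pivot (diag w) (offd w) n - r w.
have EZ : (\int[P]_w (Z w * capinv (V w))%:E <= (C1 * theta ^+ n.-1)%:E)%E.
  apply: (expectation_transfer indX M0 nuM iai ibi law ib0 ibB iaL ibL ml mr _ (Hq nu nuM)).
  by rewrite q0 ltW.
have EV : (\int[P]_w ((`|V w| * capinv (V w)) `^ (- t))%:E <= C2%:E)%E.
  exact: (expectation_negative_moment indX M0 nuM iai law iaL ibL ml mr t1).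
have Z0 w : 0 <= Z w by apply: transfer_ge0 => i ni; exact: ib0.
have md i : measurable_fun setT (fun w => diag w i).
  by case: i => [|i] //; apply: measurable_funB => //; exact: subsigma_measurable_fun ml.
have mZ : measurable_fun setT Z.
  exact: (@measurable_transfer _ Omega R (fun i w => diag w i) (fun i w => offd w i)).
have mV : measurable_fun setT V.
  apply: measurable_funB; last exact: subsigma_measurable_fun mr.
  exact: (@measurable_pivot _ Omega R (fun i w => diag w i) (fun i w => offd w i)).
have mG : measurable_fun setT (fun w => (Z w * capinv (V w))%:E).
  apply/measurable_EFinP; apply: measurable_funM => //.
  exact: (measurableT_comp measurable_capinv).
have mH : measurable_fun setT (fun w => ((`|V w| * capinv (V w)) `^ (- t))%:E).
  apply/measurable_EFinP; apply: (measurableT_comp (measurable_powR _)).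
  apply: measurable_funM; first exact: (measurableT_comp (@normr_measurable _ _)).
  exact: (measurableT_comp measurable_capinv).
have G0 w : 0 <= Z w * capinv (V w) by rewrite mulr_ge0// ltW// capinv_gt0.
have thn : 0 < theta ^+ n by exact: exprn_gt0.
have -> : theta `^ (s * n%:R) = (theta ^+ n) `^ s.
  by rewrite -powR_mulrn ?(ltW th0)// -powRrM mulrC.
have young (x y : R) : 0 <= x -> 0 <= y -> x `^ s * y `^ (1 - s) <= x + y.
  move=> x0 y0; pose m := Num.max x y.
  have m0 : 0 <= m by rewrite le_max x0.
  have -> : x + y = Num.max x y + Num.min x y by rewrite addr_max_min.
  apply: (@le_trans _ _ (m `^ s * m `^ (1 - s))).
    apply: ler_pM; rewrite ?powR_ge0//; apply: ge0_ler_powR; rewrite ?nnegrE//.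
    - exact: ltW.
    - by rewrite le_max lexx.
    - exact: ltW.
    - by rewrite le_max lexx orbT.
  rewrite -powRD; last by rewrite addrC subrK oner_eq0.
  by rewrite addrC subrK powRr1// lerDl le_min x0.
have pw w : (Z w / `|V w|) `^ s <= (theta ^+ n) `^ s *
    ((theta ^+ n)^-1 * (Z w * capinv (V w)) + (`|V w| * capinv (V w)) `^ (- t)).
  have h0 := capinv_gt0 (V w).
  have [->|V0] := eqVneq (V w) 0.
    rewrite normr0 invr0 mulr0 powR0 ?gt_eqF// mulr_ge0 ?powR_ge0//.
    by rewrite addr_ge0 ?powR_ge0// mulr_ge0 ?invr_ge0 ?(ltW thn)// mulr_ge0// ltW// capinv_gt0.
  have v0 : 0 < `|V w| by rewrite normr_gt0.
  have vh : 0 < `|V w| * capinv (V w) by exact: mulr_gt0.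
  apply: (le_trans _ (ler_wpM2l (powR_ge0 _ _) (young _ _ _ _))); last 2 first.
  - by rewrite mulr_ge0 ?invr_ge0// ltW.
  - exact: powR_ge0.
  rewrite mulrA -powRM ?invr_ge0 ?mulr_ge0 ?(ltW thn)// ?invr_ge0 ?(ltW thn)//; last exact: ltW.
  rewrite mulVKf ?gt_eqF// -powRrM.
  have -> : - t * (1 - s) = - s by rewrite /t mulNr divfK// gt_eqF.
  rewrite powRN -powR_inv1 ?powR_ge0// -powRAC powR_inv1 ?(ltW vh)//.
  rewrite -powRM ?invr_ge0 ?(ltW vh)//.
  suff -> : Z w / `|V w| = Z w * capinv (V w) / (`|V w| * capinv (V w)) by [].
  by rewrite invfM mulrACA mulfV ?mulr1// gt_eqF.
apply: (@le_trans _ _ (\int[P]_w (((theta ^+ n) `^ s)%:E *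
  (((theta ^+ n)^-1)%:E * (Z w * capinv (V w))%:E +
   ((`|V w| * capinv (V w)) `^ (- t))%:E)))%E).
  apply: ge0_le_integralT => w; first by rewrite lee_fin powR_ge0.
  by rewrite lee_fin; exact: pw.
have mG' : measurable_fun setT (fun w => ((theta ^+ n)^-1)%:E * (Z w * capinv (V w))%:E)%E.
  exact: measurable_funeM.
rewrite (ge0_integralZl P measurableT (emeasurable_funD mG' mH)); last 2 first.
- by move=> w _; rewrite lee_fin addr_ge0 ?powR_ge0// mulr_ge0// invr_ge0 ltW.
- by rewrite lee_fin powR_ge0.
rewrite (ge0_integralD P measurableT _ mG' _ mH); last 2 first.
- by move=> w _; rewrite lee_fin mulr_ge0// invr_ge0 ltW.
- by move=> w _; rewrite lee_fin powR_ge0.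
rewrite (ge0_integralZl P measurableT mG); last 2 first.
- by move=> w _; rewrite lee_fin.
- by rewrite lee_fin invr_ge0 ltW.
rewrite [leRHS]EFinM muleC lee_wpmul2r ?lee_fin ?powR_ge0//.
rewrite EFinD leeD//.
apply: (@le_trans _ _ (((theta ^+ n)^-1)%:E * (C1 * theta ^+ n.-1)%:E)%E).
  by rewrite lee_wpmul2l// lee_fin invr_ge0 ltW.
rewrite -EFinM lee_fin; case: (n) thn => [|k] thn /=.
  rewrite expr0 invr1 mul1r mulr1 ler_pdivlMr// ler_piMr ?sqrtr_ge0// ltW//.
by rewrite exprS invfM mulrACA mulVf ?mulr1 1?mulrC// gt_eqF// exprn_gt0.
Qed.

(** * Inverse of a tridiagonal matrix *)

Section tridiagonal.
Context {F : fieldType} (n : nat) (al be : nat -> F).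

Definition tridiag : 'M[F]_n :=
  \matrix_(i, j)
    if i == j then al i
    else if (j == i.+1 :> nat)%N then be i
    else if (i == j.+1 :> nat)%N then be j
    else 0.

(** Pivots of the elimination that starts from the last site: reading the matrix
    backwards makes them instances of [pivot]. *)
Definition rpivot (j : nat) : F :=
  pivot (fun i => al (n.-1 - i)%N) (fun i => be (n.-2 - i)%N) (n.-1 - j).

Lemma rpivot_last : rpivot n.-1 = al n.-1.
Proof. by rewrite /rpivot subnn /= subn0. Qed.

Lemma rpivotE j : (j.+1 < n)%N -> rpivot j = al j - be j ^+ 2 / rpivot j.+1.
Proof.
move=> jn; rewrite /rpivot.
have -> : (n.-1 - j = (n.-1 - j.+1).+1)%N by lia.
by rewrite /=; congr (al _ - be _ ^+ 2 / _); lia.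
Qed.

(** The Schur complement of site [j], once both sides have been eliminated. *)
Definition cpivot (j : nat) : F := pivot al be j + rpivot j - al j.

(** Column [y] of the inverse. Away from [y] its entries solve a three-term recurrence
    that has a first (last) equation on the left (right) of [y], which fixes the
    ratio of consecutive entries; the equation at [y] fixes the value [1 / cpivot y]. *)
Definition green_col (y j : nat) : F :=
  if (j <= y)%N then \prod_(j <= k < y) (- be k / pivot al be k) / cpivot y
  else \prod_(y <= k < j) (- be k / rpivot k.+1) / cpivot y.

Lemma green_col_diag y : green_col y y = (cpivot y)^-1.
Proof. by rewrite /green_col leqnn big_geq// mul1r. Qed.

Lemma green_col_left y j : (j < y)%N ->
  green_col y j = - be j / pivot al be j * green_col y j.+1.
Proof. by move=> jy; rewrite /green_col (ltnW jy) jy big_ltn// mulrA. Qed.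

Lemma green_col_right y j : (y <= j)%N ->
  green_col y j.+1 = - be j / rpivot j.+1 * green_col y j.
Proof.
move=> yj; rewrite /green_col leqNgt ltnS yj /= big_nat_recr//=.
case: ifPn => [jy|_]; last by rewrite mulrAC mulrC.
have -> : j = y by apply/eqP; rewrite eqn_leq jy.
by rewrite !big_geq// mul1r mulrC mul1r mulrC.
Qed.

Lemma tridiag_row (g : nat -> F) (i : 'I_n) :
  \sum_(j < n) tridiag i j * g j =
  (if (i : nat) is k.+1 then be k * g k else 0) + al i * g i +
  (if (i.+1 < n)%N then be i * g i.+1 else 0).
Proof.
have E (j : 'I_n) : tridiag i j * g j =
    (if (i == j.+1 :> nat)%N then be j * g j else 0) +
    (if (j == i :> nat)%N then al j * g j else 0) +
    (if (j == i.+1 :> nat)%N then be i * g j else 0).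
  rewrite mxE -(inj_eq val_inj) /=.
  move: (i : nat) (j : nat) => {}i {}j; have [->|ij] := eqVneq i j.
    by rewrite (ltn_eqF (ltnSn j)) add0r addr0.
  rewrite addr0; have [->|ji] := eqVneq j i.+1.
    by rewrite (ltn_eqF (ltnW (ltnSn i.+1) : (i < i.+2)%N)) add0r.
  by rewrite addr0; case: ifP; rewrite ?mul0r.
under eq_bigr do rewrite E.
rewrite !big_split /=; congr (_ + _ + _).
- case E0 : (i : nat) => [|k]; first by rewrite big1.
  under eq_bigr do rewrite eqSS eq_sym.
  rewrite -big_mkcond (big_ord1_eq _ (fun j => be j * g j)) ifT//.
  by rewrite ltnW// -E0.
- by rewrite -big_mkcond (big_ord1_eq _ (fun j => al j * g j)) ltn_ord.
- by rewrite -big_mkcond (big_ord1_eq _ (fun j => be i * g j)).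
Qed.

Hypothesis piv0 : forall j, (j < n)%N -> pivot al be j != 0.
Hypothesis rpiv0 : forall j, (j < n)%N -> rpivot j != 0.
Hypothesis cpiv0 : forall j, (j < n)%N -> cpivot j != 0.

Lemma tridiag_mul_green :
  tridiag *m (\matrix_(x, y) green_col y x) = 1%:M.
Proof.
apply/matrixP => i y; rewrite !mxE.
under eq_bigr do rewrite [X in _ * X]mxE.
rewrite (tridiag_row (green_col y)) -(inj_eq val_inj) /=.
have prev k : i = k.+1 :> nat -> (i <= y)%N ->
    be k * green_col y k = - (be k ^+ 2 / pivot al be k) * green_col y i.
  by move=> ik iy; rewrite green_col_left -?ik//; ring.
have next : (i.+1 < n)%N -> (y <= i)%N ->
    be i * green_col y i.+1 = - (be i ^+ 2 / rpivot i.+1) * green_col y i.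
  by move=> _ yi; rewrite green_col_right//; ring.
have leftE : (i <= y)%N ->
    (if (i : nat) is k.+1 then be k * green_col y k else 0) =
    (pivot al be i - al i) * green_col y i.
  move=> iy; case E : (i : nat) => [|k]; first by rewrite subrr mul0r.
  by rewrite -E (prev k E iy) E /=; ring.
have rightE : (y <= i)%N ->
    (if (i.+1 < n)%N then be i * green_col y i.+1 else 0) =
    (rpivot i - al i) * green_col y i.
  move=> yi; case: ifPn => ni; first by rewrite (next ni yi) (rpivotE ni); ring.
  have -> : i = n.-1 :> nat by have := ltn_ord i; lia.
  by rewrite rpivot_last subrr mul0r.
have [iy|yi|iy] := ltngtP i y.
- have ni : (i.+1 < n)%N by exact: leq_ltn_trans iy (ltn_ord y).
  rewrite (leftE (ltnW iy)) ni (green_col_left iy).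
  by rewrite [RHS](_ : _ = 0)//; field; exact: piv0.
- rewrite (rightE (ltnW yi)).
  case E : (i : nat) => [|k]; first by rewrite E in yi.
  have yk : (y <= k)%N by rewrite -ltnS -E.
  rewrite (green_col_right yk) [RHS](_ : _ = 0)//; field.
  by apply: rpiv0; rewrite -E.
- have [iy1 iy2] : (i <= y)%N /\ (y <= i)%N by rewrite iy.
  rewrite (leftE iy1) (rightE iy2) -!mulrDl [RHS](_ : _ = 1)//.
  rewrite -[RHS](mulfV (cpiv0 (ltn_ord y))) iy green_col_diag.
  by congr (_ * _); rewrite /cpivot; ring.
Qed.

Lemma invmx_tridiag (x y : 'I_n) : invmx tridiag x y = green_col y x.
Proof.
have AG := tridiag_mul_green; have [uA _] := mulmx1_unit AG.
have := congr1 (mulmx (invmx tridiag)) AG.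
rewrite mulmxA mulVmx// mul1mx mulmx1 => <-.
by rewrite mxE.
Qed.

End tridiagonal.

(** * Complex pivots against real ones *)

Section complex_pivots.
Context {R : realType}.
Implicit Types (tau : R) (p : R[i]).
Local Notation Im := complex.Im.
Local Notation Re := complex.Re.

(** The spectral parameter is [i tau]: its real part is absorbed into [al]. *)
Definition zdiag tau (al : nat -> R) (i : nat) : R[i] := (al i)%:C - (0 +i* tau).
Definition zoff (be : nat -> R) (i : nat) : R[i] := (be i)%:C.

Lemma normc_shift_im tau p : tau * Im p <= 0 -> normc p <= normc (p - (0 +i* tau)).
Proof.
case: p => x y /= h; rewrite ler_sqrt ?addr_ge0 ?sqr_ge0// subr0 lerD2l.
by have := sqr_ge0 tau; nra.
Qed.

Lemma normr_Re_le p : `|Re p| <= normc p.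
Proof.
case: p => x y /=; rewrite -sqrtr_sqr ler_sqrt ?addr_ge0 ?sqr_ge0//.
by rewrite lerDl sqr_ge0.
Qed.

Lemma normc_nneg p : 0 <= normc p.
Proof. by case: p => x y /=; exact: sqrtr_ge0. Qed.

Lemma normc_real (x : R) : normc x%:C = `|x|.
Proof. by rewrite /= expr0n /= addr0 sqrtr_sqr. Qed.

Lemma im_sqr_div tau (b : R) p : tau * Im p <= 0 -> 0 <= tau * Im (b%:C ^+ 2 / p).
Proof.
case: p => x y /= h; set n2 := (x ^+ 2 + y ^+ 2)^-1.
have n20 : 0 <= n2 by rewrite invr_ge0 addr_ge0// sqr_ge0.
rewrite [leRHS](_ : _ = b ^+ 2 * n2 * - (tau * y)); last by ring.
by rewrite mulr_ge0 ?oppr_ge0// mulr_ge0// sqr_ge0.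
Qed.

(** By induction all pivots keep an imaginary part of the sign of [- tau], since
    [b^2 / p] has the sign opposite to that of [p]. *)
Lemma pivot_im tau al be n :
  tau * Im (pivot (zdiag tau al) (zoff be) n) <= - tau ^+ 2.
Proof.
elim: n => [|n IH] /=; first by rewrite sub0r mulrN expr2.
have t0 : tau * Im (pivot (zdiag tau al) (zoff be) n) <= 0.
  by apply: (le_trans IH); rewrite oppr_le0 sqr_ge0.
have := im_sqr_div (be n) t0; rewrite -/(zoff be n).
case: (zoff be n ^+ 2 / _) => x y /= h.
by rewrite sub0r mulrDr !mulrN expr2 lerBlDr lerDl.
Qed.

Lemma rpivot_im tau al be n j :
  tau * Im (rpivot n (zdiag tau al) (zoff be) j) <= - tau ^+ 2.
Proof. exact: (pivot_im tau (fun i => al (n.-1 - i)%N) (fun i => be (n.-2 - i)%N)). Qed.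

Lemma cpivot_im tau al be n j :
  tau * Im (cpivot n (zdiag tau al) (zoff be) j) <= - tau ^+ 2.
Proof.
rewrite /cpivot; have := pivot_im tau al be j; have := rpivot_im tau al be n j.
case: (rpivot _ _ _ _) => x y /= hy; case: (pivot _ _ _) => x' y' /= hy'.
rewrite [leLHS](_ : _ = tau * y' + tau * y + tau ^+ 2); last by ring.
lra.
Qed.

Lemma neq0_of_im tau p : tau != 0 -> tau * Im p <= - tau ^+ 2 -> p != 0.
Proof.
move=> t0 h; apply/eqP => p0; move: h; rewrite p0 /= mulr0 lerNr oppr0.
by rewrite leNgt exprn_even_gt0//= t0.
Qed.

Lemma zdiag0 al i : zdiag 0 al i = (al i)%:C.
Proof. by rewrite /zdiag subr0. Qed.

Lemma pivot_real (al be : nat -> R) n :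
  pivot (zdiag 0 al) (zoff be) n = (pivot al be n)%:C.
Proof.
elim: n => [|n IH] /=; first exact: zdiag0.
by rewrite IH zdiag0 /zoff rmorphB /= fmorph_div /= rmorphXn.
Qed.

Lemma rpivot_real (al be : nat -> R) n j :
  rpivot n (zdiag 0 al) (zoff be) j = (rpivot n al be j)%:C.
Proof. exact: (pivot_real (fun i => al (n.-1 - i)%N) (fun i => be (n.-2 - i)%N)). Qed.

Lemma cpivot_real (al be : nat -> R) n j :
  cpivot n (zdiag 0 al) (zoff be) j = (cpivot n al be j)%:C.
Proof. by rewrite /cpivot pivot_real rpivot_real zdiag0 rmorphB /= rmorphD. Qed.

(** Off the real axis this comes from the strict sign of the imaginary parts, on it
    from the assumption. *)
Lemma complex_pivots_neq0 tau al be n :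
  (forall j, (j < n)%N -> [/\ pivot al be j != 0, rpivot n al be j != 0 &
    cpivot n al be j != 0]) ->
  forall j, (j < n)%N -> [/\ pivot (zdiag tau al) (zoff be) j != 0,
    rpivot n (zdiag tau al) (zoff be) j != 0 &
    cpivot n (zdiag tau al) (zoff be) j != 0].
Proof.
move=> h j jn; have [->|t0] := eqVneq tau 0.
  have [h1 h2 h3] := h j jn.
  rewrite pivot_real rpivot_real cpivot_real.
  by split; rewrite -(rmorph0 (real_complex R)) (inj_eq (@complexI R)).
by split; apply: (neq0_of_im t0);
  [exact: pivot_im|exact: rpivot_im|exact: cpivot_im].
Qed.

Lemma normc_prod (I : Type) (s : seq I) (Pr : pred I) (f : I -> R[i]) :
  normc (\prod_(i <- s | Pr i) f i) = \prod_(i <- s | Pr i) normc (f i).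
Proof.
have n1 : normc (1 : R[i]) = 1 by exact: normc1.
exact: (big_morph (@normc R) (@normcM R) n1).
Qed.

Section comparison.
Variables (tau : R) (al be : nat -> R) (n : nat).
Let V k := rpivot n (zdiag tau al) (zoff be) k.
Let u k := pivot al be k.
Let c k : R[i] := zdiag tau al k - V k.

Let im_u_sub_c k : tau * Im ((u k)%:C - c k) <= 0.
Proof.
have := rpivot_im tau al be n k; rewrite /c -/(V k); case: (V k) => x y /= h.
rewrite [leLHS](_ : _ = tau * y + tau ^+ 2); last by ring.
by rewrite -lerBrDr sub0r.
Qed.

Let cE k : (k.+1 < n)%N -> c k = zoff be k ^+ 2 / V k.+1.
Proof. by move=> kn; rewrite /c /V rpivotE// opprB addrC subrK. Qed.

Hypothesis Vn0 : forall k, (k < n)%N -> V k != 0.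

(** Induction on [x] through the identity
    [u_x (u_(x+1) - i tau - c_(x+1)) = (u_x - c_x) w_(x+1)], where [w = rpivot] and
    [c_x] is the contribution of the sites to the right of [x]. Removing [i tau]
    from [u_x - i tau - c_x] does not increase the modulus, because both imaginary
    parts have the same sign. *)
Lemma prod_rpivot_ge x : (x < n)%N -> (forall k, (k < x)%N -> u k != 0) ->
  \prod_(k < x) `|u k| * normc ((u x)%:C - (0 +i* tau) - c x) <=
  \prod_(k < x.+1) normc (V k).
Proof.
elim: x => [|x IH] xn u0.
  rewrite big_ord0 mul1r big_ord1 /=.
  by rewrite /c opprB addrCA /zdiag subrr addr0.
have xn' : (x < n)%N by exact: ltnW.
have {}IH := IH xn' (fun k kx => u0 k (ltnW kx)).
rewrite big_ord_recr /= [leRHS]big_ord_recr /=.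
apply: (le_trans _ (ler_wpM2r _ IH)); last exact: normc_nneg.
rewrite -!mulrA ler_wpM2l//; first by apply: prodr_ge0.
rewrite -normc_real -!normcM.
have -> : (u x)%:C * ((u x.+1)%:C - (0 +i* tau) - c x.+1) =
    ((u x)%:C - c x) * V x.+1.
  rewrite (cE xn) mulrBl divfK ?Vn0//.
  have ux0 : (u x)%:C != 0.
    by rewrite -(rmorph0 (real_complex R)) (inj_eq (@complexI R)) u0.
  rewrite /c /zdiag; have -> : (u x.+1)%:C = (al x.+1)%:C - zoff be x ^+ 2 / (u x)%:C.
    by rewrite /u /= rmorphB /= fmorph_div /= rmorphXn.
  by field.
rewrite !normcM ler_wpM2r ?normc_nneg//.
have -> : (u x)%:C - (0 +i* tau) - c x = (u x)%:C - c x - (0 +i* tau).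
  by rewrite addrAC.
exact: normc_shift_im.
Qed.

(** The real part of [c_x] depends only on the entries to the right of [x], so the
    lower bound involves the modulus of a real pivot minus an independent number,
    as on the real axis. *)
Lemma prod_rpivot_ge_real x : (x < n)%N -> (forall k, (k < x)%N -> u k != 0) ->
  \prod_(k < x) `|u k| * `|u x - Re (c x)| <= \prod_(k < x.+1) normc (V k).
Proof.
move=> xn u0; apply: le_trans (prod_rpivot_ge xn u0).
rewrite ler_wpM2l//; first by apply: prodr_ge0.
have -> : (u x)%:C - (0 +i* tau) - c x = (u x)%:C - c x - (0 +i* tau).
  by rewrite addrAC.
apply: le_trans (normc_shift_im (im_u_sub_c x)).
apply: le_trans (normr_Re_le _).
by case: (c x) => a b.
Qed.

End comparison.
End complex_pivots.

(** * Null sets *)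

Section complex_pivot_measurable.
Context d (T : measurableType d) {R : realType} (tau : R).
Local Notation Im := complex.Im.
Local Notation Re := complex.Re.

Lemma re_sqr_div (b : R) (p : R[i]) :
  Re (zoff (fun=> b) 0 ^+ 2 / p) = b ^+ 2 * (Re p / (Re p ^+ 2 + Im p ^+ 2)).
Proof. by case: p => x y /=; ring. Qed.

Lemma im_sqr_divE (b : R) (p : R[i]) :
  Im (zoff (fun=> b) 0 ^+ 2 / p) = - (b ^+ 2 * (Im p / (Re p ^+ 2 + Im p ^+ 2))).
Proof. by case: p => x y /=; ring. Qed.

Lemma ReB (p q : R[i]) : Re (p - q) = Re p - Re q.
Proof. by case: p; case: q. Qed.

Lemma ImB (p q : R[i]) : Im (p - q) = Im p - Im q.
Proof. by case: p; case: q. Qed.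

Lemma measurable_complex_pivot (al be : nat -> T -> R) n :
  (forall i, (i <= n)%N -> measurable_fun setT (al i)) ->
  (forall i, (i < n)%N -> measurable_fun setT (be i)) ->
  measurable_fun setT (fun w => Re (pivot (zdiag tau (al^~ w)) (zoff (be^~ w)) n)) /\
  measurable_fun setT (fun w => Im (pivot (zdiag tau (al^~ w)) (zoff (be^~ w)) n)).
Proof.
elim: n => [|n IH] ma mb.
  split.
    have -> : (fun w => Re (pivot (zdiag tau (al^~ w)) (zoff (be^~ w)) 0)) = al 0%N.
      by apply/funext => w; rewrite /= subr0.
    exact: ma.
  have -> : (fun w => Im (pivot (zdiag tau (al^~ w)) (zoff (be^~ w)) 0)) = cst (- tau).
    by apply/funext => w; rewrite /= sub0r.
  exact: measurable_cst.
have [mRe mIm] := IH (fun i ni => ma i (leqW ni)) (fun i ni => mb i (leqW ni)).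
have mS : measurable_fun setT (fun w =>
    Re (pivot (zdiag tau (al^~ w)) (zoff (be^~ w)) n) ^+ 2 +
    Im (pivot (zdiag tau (al^~ w)) (zoff (be^~ w)) n) ^+ 2).
  by apply: measurable_funD; exact: measurable_funX.
have mbn : measurable_fun setT (fun w => be n w ^+ 2).
  by apply: measurable_funX; exact: mb.
split.
  have -> : (fun w => Re (pivot (zdiag tau (al^~ w)) (zoff (be^~ w)) n.+1)) =
      (fun w => al n.+1 w - be n w ^+ 2 *
        (Re (pivot (zdiag tau (al^~ w)) (zoff (be^~ w)) n) /
        (Re (pivot (zdiag tau (al^~ w)) (zoff (be^~ w)) n) ^+ 2 +
         Im (pivot (zdiag tau (al^~ w)) (zoff (be^~ w)) n) ^+ 2))).
    apply/funext => w; rewrite [pivot _ _ n.+1]/= ReB -re_sqr_div.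
    by rewrite ReB /= subr0.
  apply: measurable_funB; first exact: ma.
  by apply: measurable_funM => //; apply: measurable_funM => //; exact: measurable_funV.
have -> : (fun w => Im (pivot (zdiag tau (al^~ w)) (zoff (be^~ w)) n.+1)) =
    (fun w => - tau + be n w ^+ 2 *
      (Im (pivot (zdiag tau (al^~ w)) (zoff (be^~ w)) n) /
      (Re (pivot (zdiag tau (al^~ w)) (zoff (be^~ w)) n) ^+ 2 +
       Im (pivot (zdiag tau (al^~ w)) (zoff (be^~ w)) n) ^+ 2))).
  apply/funext => w; rewrite [pivot _ _ n.+1]/= ImB.
  rewrite -[zoff (be^~ w) n]/(zoff (fun=> be n w) 0) im_sqr_divE.
  by rewrite opprK ImB /= sub0r.
apply: measurable_funD => //.
by apply: measurable_funM => //; apply: measurable_funM => //; exact: measurable_funV.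
Qed.

End complex_pivot_measurable.

Section ae_tools.
Context d (Omega : measurableType d) {R : realType} (P : probability Omega R).

(** The exceptional set is paid for by adding [+oo] times its indicator to [g]. *)
Lemma ge0_ae_le_integralT (f g : Omega -> \bar R) :
  measurable_fun setT g ->
  (forall w, 0 <= f w)%E -> (forall w, 0 <= g w)%E ->
  {ae P, forall w, f w <= g w}%E ->
  (\int[P]_w f w <= \int[P]_w g w)%E.
Proof.
move=> mg f0 g0 [N [mN PN0 fgN]].
pose h w : \bar R := (g w + (+oo * (\1_N w)%:E))%E.
have mi : measurable_fun setT (fun w => (+oo * (\1_N w)%:E)%E : \bar R).
  by apply: measurable_funeM; apply/measurable_EFinP; exact: measurable_indic.
have mh : measurable_fun setT h by exact: emeasurable_funD.
have i0 w : (0 <= +oo * (\1_N w)%:E :> \bar R)%E by rewrite mule_ge0// lee_fin.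
apply: (@le_trans _ _ (\int[P]_w h w)%E).
  apply: ge0_le_integralT => // w; rewrite /h indicE.
  have [wN|wN] := boolP (w \in N).
    by rewrite mule1 addey ?leey// gt_eqF// (lt_le_trans _ (g0 w))// ltNy0.
  rewrite mule0 adde0; apply: contrapT => fg; move/negP: wN; apply.
  by apply: mem_set; exact: fgN.
rewrite ge0_integralD// ge0_integralZl//.
- have -> : (\int[P]_w (\1_N w)%:E = 0)%E by rewrite integral_indic// setIT; exact: PN0.
  by rewrite mule0 adde0.
by apply/measurable_EFinP; exact: measurable_indic.
Qed.

Context (J : finType) (X : J -> {RV P >-> R}) (indX : mutually_independent X).
Context (M : R) (nu : probability (measurableTypeR R) R).
Hypotheses (M0 : 0 < M) (nuM : bounded_density M nu).

(** Conditionally on [c], this is the absence of atoms of a law with a density. *)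
Lemma ae_coord_neq (j : J) (K : {set J}) (c : Omega -> R) : j \notin K ->
  (forall A, measurable A -> P (X j @^-1` A) = nu A) ->
  measurable_fun [set: subsigma X K] (c : subsigma X K -> R) ->
  {ae P, forall w, X j w - c w != 0}.
Proof.
move=> jK law mc.
have mc' := subsigma_measurable_fun mc.
pose D := [set w | X j w = c w].
pose D2 := [set p : R * R | p.2 - p.1 = 0].
have mD2 : measurable D2.
  have msub : measurable_fun setT (fun p : R * R => p.2 - p.1) by exact: measurable_funB.
  by have := msub measurableT _ (measurable_set1 0); rewrite setTI.
have mD : measurable D.
  have mXc : measurable_fun setT (fun w => X j w - c w) by exact: measurable_funB.
  have := mXc measurableT _ (measurable_set1 0); rewrite setTI.
  congr measurable; apply/seteqP; split => w /=.
    by move/eqP; rewrite subr_eq0 => /eqP.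
  by move=> ->; rewrite subrr.
exists D; split => //; last first.
  by move=> w /= /negP; rewrite negbK subr_eq0 => /eqP.
pose F (p : R * R) : \bar R := (\1_D2 p)%:E.
have mF : measurable_fun setT F by apply/measurable_EFinP; exact: measurable_indic.
have F0 p : (0 <= F p)%E by rewrite lee_fin.
have ind : indep_maps P c (X j).
  apply: (@subsigma_indep_maps _ _ _ _ _ _ indX _ _ _ _ K [set j]%SET) => //.
    by move=> k kK; rewrite !inE; apply: contraNneq jK => <-.
  by apply: measurable_coord; rewrite inE.
have -> : P D = (\int[P]_w F (c w, X j w))%E.
  rewrite -[D in LHS]setIT -integral_indic//; apply: eq_integral => w _.
  rewrite /F !indicE; congr (_%:R%:E); congr nat_of_bool.
  apply/idP/idP; rewrite !inE /D /D2 /=.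
    by move=> ->; rewrite subrr.
  by move/eqP; rewrite subr_eq0 => /eqP.
rewrite (indep_maps_decouple ind mF F0); apply: integral0_eq => w _.
rewrite (@law_transfer _ _ _ P nu (X j) (fun x => F (c w, x)))//; last first.
  by apply: (measurableT_comp mF); exact: measurable_fun_pair.
have mc1 : measurable [set c w] by exact: measurable_set1.
have -> : (\int[nu]_x F (c w, x) = nu [set c w])%E.
  rewrite -[X in nu X]setIT -integral_indic//; apply: eq_integral => x _.
  rewrite /F !indicE; congr (_%:R%:E); congr nat_of_bool.
  apply/idP/idP; rewrite !inE /D2 /=.
    by move/eqP; rewrite subr_eq0 => /eqP.
  by move=> ->; rewrite subrr.
apply/eqP; rewrite eq_le measure_ge0 andbT.
apply: (le_trans (nuM mc1)).
by rewrite lebesgue_measure_set1 mule0.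
Qed.

End ae_tools.

(** * The pivots of a random Jacobi matrix *)

Section random_jacobi.
Context d (Omega : measurableType d) {R : realType} (P : probability Omega R)
  (N : nat) (al be : nat -> {RV P >-> R}).
Local Notation Re := complex.Re.

Implicit Types (K : {set 'I_N.+1 + 'I_N.+1.-1}).

Local Notation X := (@jacobi_family d Omega R P N.+1 al be).

Definition diag_index (i : nat) : 'I_N.+1 + 'I_N.+1.-1 := inl (inord i).
Definition off_index (i : nat) : 'I_N.+1 + 'I_N.+1.-1 :=
  if insub i is Some j then inr j else inl ord0.

Lemma jacobi_diag i : (i <= N)%N -> X (diag_index i) = al i.
Proof. by move=> iN; rewrite /= inordK. Qed.

Lemma off_indexE i (iN : (i < N)%N) : off_index i = inr (Ordinal iN).
Proof. by rewrite /off_index insubT. Qed.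

Lemma jacobi_off i : (i < N)%N -> X (off_index i) = be i.
Proof. by move=> iN; rewrite off_indexE. Qed.

Lemma diag_index_inj i j : (i <= N)%N -> (j <= N)%N ->
  diag_index i = diag_index j -> i = j.
Proof. by move=> iN jN [/(congr1 val)]; rewrite /= !inordK. Qed.

Lemma off_index_inj i j : (i < N)%N -> (j < N)%N ->
  off_index i = off_index j -> i = j.
Proof. by move=> iN jN; rewrite !off_indexE => -[]. Qed.

Lemma off_diag_index i j : (i < N)%N -> off_index i != diag_index j.
Proof. by move=> iN; rewrite off_indexE. Qed.

Lemma measurable_diag_coord K i : (i <= N)%N -> diag_index i \in K ->
  measurable_fun [set: subsigma X K] (al i : subsigma X K -> R).
Proof. by move=> iN iK; rewrite -(jacobi_diag iN); exact: measurable_coord. Qed.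

Lemma measurable_off_coord K i : (i < N)%N -> off_index i \in K ->
  measurable_fun [set: subsigma X K] (be i : subsigma X K -> R).
Proof. by move=> iN iK; rewrite -(jacobi_off iN); exact: measurable_coord. Qed.

Let A (w : Omega) (i : nat) : R := al i w.
Let B (w : Omega) (i : nat) : R := be i w.

(** What the sites to the left of [x] subtract from the diagonal entry at [x]. *)
Definition lshift (x : nat) (w : Omega) : R :=
  if x is k.+1 then B w k ^+ 2 / pivot (A w) (B w) k else 0.

(** The real part of what the sites to the right of [x] subtract from the diagonal
    entry at [x]. *)
Definition rshift (tau : R) (x : nat) (w : Omega) : R :=
  Re (zdiag tau (A w) x - rpivot N.+1 (zdiag tau (A w)) (zoff (B w)) x).

Lemma pivot_lshift x w : pivot (A w) (B w) x = al x w - lshift x w.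
Proof. by case: x => [|x] //=; rewrite subr0. Qed.

Lemma rpivot_rshift x w : rpivot N.+1 (A w) (B w) x = al x w - rshift 0 x w.
Proof. by rewrite /rshift rpivot_real zdiag0 -rmorphB /= subKr. Qed.

Lemma measurable_lshift K x : (x <= N)%N ->
  (forall i, (i < x)%N -> diag_index i \in K) ->
  (forall i, (i < x)%N -> off_index i \in K) ->
  measurable_fun [set: subsigma X K] (lshift x : subsigma X K -> R).
Proof.
case: x => [|k] kN aK bK; first exact: measurable_cst.
apply: measurable_funM.
  by apply: measurable_funX; apply: measurable_off_coord => //; exact: bK.
apply: measurable_funV.
apply: (@measurable_pivot _ (subsigma X K) R (fun i w => al i w) (fun i w => be i w)).
  move=> i ik; apply: measurable_diag_coord; last exact: aK.
  exact: leq_trans ik (ltnW kN).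
move=> i ik; apply: measurable_off_coord; last by apply: bK; exact: ltnW.
exact: ltn_trans ik kN.
Qed.

Lemma measurable_rshift K tau x : (x <= N)%N ->
  (forall i, (x < i)%N -> (i <= N)%N -> diag_index i \in K) ->
  (forall i, (x <= i)%N -> (i < N)%N -> off_index i \in K) ->
  measurable_fun [set: subsigma X K] (rshift tau x : subsigma X K -> R).
Proof.
move=> xN aK bK; have [xltN|Nx] := ltnP x N; last first.
  have -> : x = N by apply/eqP; rewrite eqn_leq xN.
  have -> : rshift tau N = cst 0.
    apply/funext => w; rewrite /rshift -[X in rpivot _ _ _ X]/(N.+1.-1).
    by rewrite rpivot_last subrr.
  exact: measurable_cst.
have [mRe mIm] := @measurable_complex_pivot _ (subsigma X K) R tau
  (fun i w => al (N - i)%N w) (fun i w => be (N.-1 - i)%N w) (N - x.+1)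
  ltac:(by move=> i ix; apply: measurable_diag_coord; [lia|apply: aK; lia])
  ltac:(by move=> i ix; apply: measurable_off_coord; [lia|apply: bK; lia]).
pose p w := rpivot N.+1 (zdiag tau (A w)) (zoff (B w)) x.+1.
have -> : rshift tau x = fun w => be x w ^+ 2 *
    (Re (p w) / (Re (p w) ^+ 2 + complex.Im (p w) ^+ 2)).
  apply/funext => w; rewrite -re_sqr_div /rshift rpivotE//.
  by rewrite opprB addrC subrK.
apply: measurable_funM.
  by apply: measurable_funX; apply: measurable_off_coord => //; exact: bK.
apply: measurable_funM; first exact: mRe.
by apply: measurable_funV; apply: measurable_funD; apply: measurable_funX;
  [exact: mRe|exact: mIm].
Qed.

(** The common upper bound of the entries of the Green function that are considered:
    it is exact on the real axis, and an estimate for the first column off it. *)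
Definition left_product (tau : R) (x m : nat) (w : Omega) : R :=
  \prod_(k < m) (B w (x + k) / `|pivot (A w) (B w) (x + k)|) /
  `|pivot (A w) (B w) (x + m) - rshift tau (x + m) w|.

Lemma pivot_restart x j w :
  pivot (shift0 (lshift x w) (fun i => al (x + i)%N w)) (fun i => be (x + i)%N w) j =
  pivot (A w) (B w) (x + j).
Proof.
elim: j => [|j IH] /=; first by rewrite addn0 pivot_lshift.
by rewrite IH addnS.
Qed.

Lemma left_productE tau x m w : left_product tau x m w =
  transfer (shift0 (lshift x w) (fun i => al (x + i)%N w)) (fun i => be (x + i)%N w) m /
  `|pivot (shift0 (lshift x w) (fun i => al (x + i)%N w)) (fun i => be (x + i)%N w) m
    - rshift tau (x + m) w|.
Proof.
rewrite pivot_restart; congr (_ / _); apply: eq_bigr => k _.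
by rewrite pivot_restart.
Qed.

Context (M : R) (nu : probability (measurableTypeR R) R).
Hypotheses (M0 : 0 < M) (nuM : bounded_density M nu).
Hypothesis indX : mutually_independent X.
Hypothesis law : forall i Y, (i <= N)%N -> measurable Y -> P (al i @^-1` Y) = nu Y.

(** Each of these numbers is the diagonal entry [al j] minus a function of the other
    entries of the matrix. *)
Lemma ae_pivots_neq0 tau : {ae P, forall w, forall j : 'I_N.+1,
  [/\ pivot (A w) (B w) j != 0, rpivot N.+1 (A w) (B w) j != 0,
      cpivot N.+1 (A w) (B w) j != 0 &
      pivot (A w) (B w) j - rshift tau j w != 0]}.
Proof.
apply: filter_forall => j.
have jN : (j <= N)%N by rewrite -ltnS.
pose K : {set 'I_N.+1 + 'I_N.+1.-1} := (~: [set diag_index j])%SET.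
have aK i : (i <= N)%N -> i != j -> diag_index i \in K.
  by move=> iN; rewrite !inE; apply: contra_neq => /diag_index_inj ->.
have bK i : (i < N)%N -> off_index i \in K by move=> iN; rewrite !inE off_diag_index.
have ml : measurable_fun [set: subsigma X K] (lshift j : subsigma X K -> R).
  apply: measurable_lshift => // i ij.
    by apply: aK; [exact: leq_trans (ltnW ij) jN|rewrite ltn_eqF].
  by apply: bK; exact: leq_trans ij jN.
have mr t : measurable_fun [set: subsigma X K] (rshift t j : subsigma X K -> R).
  apply: measurable_rshift => // i ij iN; last exact: bK.
  by apply: aK => //; rewrite gtn_eqF.
have gen c : measurable_fun [set: subsigma X K] (c : subsigma X K -> R) ->
    {ae P, forall w, al j w - c w != 0}.
  move=> mc; rewrite -(jacobi_diag jN).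
  apply: (@ae_coord_neq _ _ _ _ _ _ indX M nu nuM (diag_index j) K c) => //.
  - by rewrite !inE eqxx.
  - by move=> Y mY; rewrite jacobi_diag//; exact: law.
apply: filterS2 (filterI (gen _ ml) (gen _ (mr 0)))
  (filterI (gen _ (measurable_funD ml (mr 0))) (gen _ (measurable_funD ml (mr tau)))).
move=> w [h1 h2] [h3 h4].
rewrite /cpivot pivot_lshift rpivot_rshift /A; split => //.
- by rewrite [X in X != 0](_ : _ = al j w - (lshift j w + rshift 0 j w))//; ring.
- by rewrite -addrA -opprD.
Qed.

End random_jacobi.

(** * Fractional moments of the Green function *)

Section green_bounds.
Context {R : realType} (N : nat) (al be : nat -> R).
Hypothesis be0 : forall i, (i < N)%N -> 0 < be i.
Hypothesis piv0 : forall j, (j < N.+1)%N -> [/\ pivot al be j != 0,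
  rpivot N.+1 al be j != 0 & cpivot N.+1 al be j != 0].
Local Notation Re := complex.Re.

Lemma tridiag_sym (F : fieldType) n (al' be' : nat -> F) :
  (tridiag n al' be')^T = tridiag n al' be'.
Proof.
apply/matrixP => i j; rewrite !mxE eq_sym.
case: eqVneq => [->//|ij]; case: eqP => [e1|//]; case: eqP => [e2|//].
by lia.
Qed.

Lemma invmx_tridiag_sym (F : fieldType) n (al' be' : nat -> F) (x y : 'I_n) :
  invmx (tridiag n al' be') x y = invmx (tridiag n al' be') y x.
Proof. by rewrite -[in LHS]tridiag_sym -trmx_inv mxE. Qed.

Let G tau := invmx (tridiag N.+1 (zdiag tau al) (zoff be)).

Let greenE tau (x y : 'I_N.+1) : G tau x y = green_col N.+1 (zdiag tau al) (zoff be) y x.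
Proof.
by apply: invmx_tridiag => j jn; have [] := complex_pivots_neq0 tau piv0 jn.
Qed.

Lemma normc_off_div (b : R) (p : R[i]) : 0 <= b -> normc (- b%:C / p) = b / normc p.
Proof. by move=> b0; rewrite normcM normcN normcV normc_real ger0_norm. Qed.

Lemma normc_green_real (x y : 'I_N.+1) : (x <= y)%N ->
  normc (G 0 x y) =
  \prod_(k < y - x) (be (x + k) / `|pivot al be (x + k)|) / `|cpivot N.+1 al be y|.
Proof.
move=> xy; rewrite greenE /green_col xy normcM normcV cpivot_real normc_real.
congr (_ / _); rewrite normc_prod -{1}[x : nat]add0n big_addn big_mkord.
apply: eq_bigr => k _; rewrite addnC pivot_real normc_off_div ?normc_real//.
apply/ltW/be0; have := ltn_ord k; have := ltn_ord y; lia.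
Qed.

(** In column 0 the denominator is a product of right pivots, which
    [prod_rpivot_ge_real] bounds below. *)
Lemma normc_green_corner tau (x y : 'I_N.+1) : y = 0%N :> nat ->
  pivot al be x - Re (zdiag tau al x - rpivot N.+1 (zdiag tau al) (zoff be) x) != 0 ->
  normc (G tau x y) <=
  \prod_(k < x) (be k / `|pivot al be k|) /
  `|pivot al be x - Re (zdiag tau al x - rpivot N.+1 (zdiag tau al) (zoff be) x)|.
Proof.
move=> y0 u0; pose V := rpivot N.+1 (zdiag tau al) (zoff be).
have V0 k : (k < N.+1)%N -> V k != 0.
  by move=> kn; have [] := complex_pivots_neq0 tau piv0 kn.
have p0 k : (k < x)%N -> pivot al be k != 0.
  by move=> kx; have [] := piv0 (ltn_trans kx (ltn_ord x)).
have -> : normc (G tau x y) = \prod_(k < x) be k / \prod_(k < x.+1) normc (V k).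
  rewrite greenE y0 -[RHS](_ : \prod_(k < x) (be k / normc (V k.+1)) / normc (V 0%N) = _).
    rewrite /green_col leqn0; have cE : cpivot N.+1 (zdiag tau al) (zoff be) 0 = V 0%N.
      by rewrite /cpivot addrAC subrr add0r.
    case: eqP => [->|_].
      by rewrite big_geq// big_ord0 !mul1r cE normcV.
    rewrite normcM normcV cE normc_prod big_mkord; congr (_ / _).
    apply: eq_bigr => k _; rewrite normc_off_div//; apply/ltW/be0.
    have := ltn_ord k; have := ltn_ord x; lia.
  by rewrite prodf_div big_ord_recl /= invfM mulrA mulrAC.
rewrite prodf_div -mulrA -invfM ler_wpM2l//.
  apply: prodr_ge0 => k _; apply/ltW/be0.
  have := ltn_ord k; have := ltn_ord x; lia.
rewrite lef_pV2 ?posrE; last 2 first.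
- by apply: prodr_gt0 => k _; rewrite lt_neqAle normc_nneg andbT eq_sym;
    apply/eqP => /eq0_normc /eqP; apply/negP/V0; exact: leq_trans (ltn_ord k) (ltn_ord x).
- rewrite mulr_gt0 ?normr_gt0//; apply: prodr_gt0 => k _.
  by rewrite normr_gt0 p0.
exact: prod_rpivot_ge_real.
Qed.

End green_bounds.

(** Almost surely the Green function is bounded by a [left_product], which is the
    quantity of [resolvent_moment_decay] for the chain between the two sites, all
    other diagonal entries being part of the frozen variables. *)
Theorem jacobi_green_moment_decay {R : realType} (M B : R) : 0 < M ->
  exists2 theta : R, 0 < theta < 1 &
  forall s : R, 0 < s -> s < 2^-1 -> exists2 C : R, 0 < C &
  forall d (Omega : measurableType d) (P : probability Omega R) (N : nat)
    (al be : nat -> {RV P >-> R}) (nu : probability (measurableTypeR R) R),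
  bounded_density M nu ->
  mutually_independent (@jacobi_family d Omega R P N.+1 al be) ->
  (forall i A, (i <= N)%N -> measurable A -> P (al i @^-1` A) = nu A) ->
  (forall i, (i < N)%N -> forall w, 0 < be i w) ->
  (forall i, (i < N)%N -> ((2^-1)%:E <= P (be i @^-1` `]-oo, B]%classic))%E) ->
  forall (tau : R) (x y : 'I_N.+1), tau = 0 \/ y = 0%N :> nat ->
  (\int[P]_w (normc (invmx (tridiag N.+1 (zdiag tau (al^~ w)) (zoff (be^~ w))) x y)
     `^ s)%:E <= (C * theta `^ (s * `|x%:R - y%:R|))%:E)%E.
Proof.
move=> M0; have [theta th01 decay] := resolvent_moment_decay B M0.
exists theta => // s s0 s2; have [C C0 decay_s] := decay s s0 s2.
exists C => // d Omega P N al be nu nuM indX law be0 beB tau.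
have Qle (t : R) (x m : nat) : (x + m <= N)%N ->
    (\int[P]_w (left_product N al be t x m w `^ s)%:E <=
     (C * theta `^ (s * m%:R))%:E)%E.
  move=> xmN.
  pose ia j := diag_index N (x + j); pose ib j := off_index N (x + j).
  pose L : {set 'I_N.+1 + 'I_N.+1.-1} := [set k | [forall j : 'I_m.+1, k != ia j]]%SET.
  have aL i : (i <= m)%N -> ia i \notin L.
    move=> im; rewrite inE negb_forall; apply/existsP.
    by exists (Ordinal (im : (i < m.+1)%N)); rewrite negbK.
  have bL i : (i < N)%N -> off_index N i \in L.
    by move=> iN; rewrite inE; apply/forallP => j; exact: off_diag_index.
  have dL i : (i <= N)%N -> ~~ (x <= i <= x + m)%N -> diag_index N i \in L.
    move=> iN out; rewrite inE; apply/forallP => j; apply: contraNneq out.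
    by move=> /diag_index_inj -> //; have := ltn_ord j; lia.
  have iaE i w : (i <= m)%N ->
      (@jacobi_family d Omega R P N.+1 al be (ia i)) w = al (x + i)%N w.
    by move=> im; rewrite jacobi_diag//; lia.
  have ibE i w : (i < m)%N ->
      (@jacobi_family d Omega R P N.+1 al be (ib i)) w = be (x + i)%N w.
    by move=> im; rewrite jacobi_off//; lia.
  have ml : measurable_fun [set: subsigma (@jacobi_family d Omega R P N.+1 al be) L]
      (lshift al be x : subsigma (@jacobi_family d Omega R P N.+1 al be) L -> R).
    by apply: measurable_lshift => [|i ix|i ix]; [lia|apply: dL; lia|apply: bL; lia].
  have mr : measurable_fun [set: subsigma (@jacobi_family d Omega R P N.+1 al be) L]
      (rshift N al be t (x + m) :
        subsigma (@jacobi_family d Omega R P N.+1 al be) L -> R).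
    by apply: measurable_rshift => // [i ix iN|i ix iN]; [apply: dL; lia|apply: bL; lia].
  have := decay_s d Omega P _ _ nu ia ib m L _ _ indX nuM _ _ _ _ _ aL _ ml mr.
  have -> : (fun w => (left_product N al be t x m w `^ s)%:E) = (fun w => ((
      transfer (shift0 (lshift al be x w)
          (fun j => @jacobi_family d Omega R P N.+1 al be (ia j) w))
        (fun j => @jacobi_family d Omega R P N.+1 al be (ib j) w) m /
      `|pivot (shift0 (lshift al be x w)
          (fun j => @jacobi_family d Omega R P N.+1 al be (ia j) w))
        (fun j => @jacobi_family d Omega R P N.+1 al be (ib j) w) m
        - rshift N al be t (x + m) w|) `^ s)%:E).
    apply/funext => w; rewrite left_productE.
    have E i : (i <= m)%N -> shift0 (lshift al be x w) (fun i => al (x + i)%N w) i =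
        shift0 (lshift al be x w) (fun j => @jacobi_family d Omega R P N.+1 al be (ia j) w) i.
      by case: i => [|i] im; rewrite [RHS]/= iaE.
    rewrite (@eq_pivot R _ _ _
      (fun j => @jacobi_family d Omega R P N.+1 al be (ib j) w) m E); last first.
      by move=> i im; rewrite ibE.
    rewrite (@eq_transfer R _ _ _
      (fun j => @jacobi_family d Omega R P N.+1 al be (ib j) w) m
      (fun i im => E i (ltnW im))).
      by [].
    by move=> i im; rewrite ibE.
  apply.
  - by move=> i j im jm /diag_index_inj; lia.
  - by move=> i j im jm /off_index_inj; lia.
  - by move=> i A im mA; rewrite jacobi_diag; [apply: law => //; lia|lia].
  - by move=> i im w; rewrite ibE//; apply: be0; lia.
  - by move=> i im; rewrite jacobi_off; [apply: beB; lia|lia].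
  - by move=> i im; apply: bL; lia.
have ae0 t := ae_pivots_neq0 nuM indX law t.
have bound (f : Omega -> R) (t : R) (x m : nat) : (x + m <= N)%N ->
    (forall w, 0 <= f w) -> {ae P, forall w, f w <= left_product N al be t x m w} ->
    (\int[P]_w (f w `^ s)%:E <= (C * theta `^ (s * m%:R))%:E)%E.
  move=> xmN f0 fQ; apply: le_trans (Qle t x m xmN).
  apply: ge0_ae_le_integralT => //.
  - have mp j : measurable_fun setT (fun w => pivot (al^~ w) (be^~ w) j).
      exact: (@measurable_pivot _ Omega R (fun i w => al i w) (fun i w => be i w)).
    have mr : measurable_fun setT (rshift N al be t (x + m)).
      apply: (@subsigma_measurable_fun _ _ _ _ _ (@jacobi_family d Omega R P N.+1 al be)
        _ _ [set: _]%SET).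
      by apply: measurable_rshift => // *; rewrite finset.in_setT.
    apply/measurable_EFinP; apply: (measurableT_comp (measurable_powR _)).
    apply: measurable_funM.
      apply: measurable_prod => k _; apply: measurable_funM => //.
      by apply: measurable_funV; exact: (measurableT_comp (@normr_measurable _ _)).
    apply: measurable_funV; apply: (measurableT_comp (@normr_measurable _ _)).
    exact: measurable_funB.
  - by move=> w; rewrite lee_fin powR_ge0.
  - by move=> w; rewrite lee_fin powR_ge0.
  apply: filterS fQ => w fQ; rewrite lee_fin ge0_ler_powR ?nnegrE//; first exact: ltW.
  exact: le_trans fQ.
have G0 t x y w : 0 <= normc (invmx (tridiag N.+1 (zdiag t (al^~ w)) (zoff (be^~ w))) x y).
  exact: normc_nneg.
have be0' w i : (i < N)%N -> 0 < be i w by move=> iN; exact: be0.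
have real (x y : 'I_N.+1) : (x <= y)%N ->
    (\int[P]_w (normc (invmx (tridiag N.+1 (zdiag 0 (al^~ w)) (zoff (be^~ w))) x y)
     `^ s)%:E <= (C * theta `^ (s * (y - x)%:R))%:E)%E.
  move=> xy; have yN : (x + (y - x) <= N)%N by rewrite subnKC// -ltnS.
  apply: (bound _ 0 x (y - x)%N) => //.
  apply: filterS (ae0 0) => w piv.
  rewrite (normc_green_real (be0' w))//; last first.
    by move=> j jN; have [? ? ? _] := piv (Ordinal jN).
  rewrite /left_product subnKC// le_eqVlt; apply/orP; left.
  rewrite [X in _ / `|X| == _](_ : _ = pivot (al^~ w) (be^~ w) y - rshift N al be 0 y w)//.
  by rewrite /cpivot rpivot_rshift -addrA addrAC subrr sub0r.
move=> x y; case=> [->|y0].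
  have [xy|yx] := leqP x y.
    apply: (le_trans (real x y xy)).
    by rewrite distrC -natrB// ger0_norm.
  under eq_integral do rewrite invmx_tridiag_sym.
  apply: (le_trans (real y x (ltnW yx))).
  by rewrite -natrB ?(ltnW yx)// ger0_norm.
rewrite y0 subr0 ger0_norm//.
apply: (bound _ tau 0%N x) => //; first by rewrite add0n -ltnS.
apply: filterS (ae0 tau) => w piv.
apply: (normc_green_corner (be0' w)) => //.
  by move=> j jN; have [? ? ? _] := piv (Ordinal jN).
by have [] := piv x.
Qed.

(** * Laws, tightness and independence *)

Section families.
Context d (Omega : measurableType d) {R : realType} (P : probability Omega R).

(** Events of [Y] are events of the renamed family [X \o e]; injectivity of [e] makes
    the products over [F] and over its image agree. *)
Lemma mutually_independent_preimage (I : choiceType) (I' : finType)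
    (X : I -> {RV P >-> R}) (Y : I' -> {RV P >-> R}) (e : I' -> I)
    (h : I' -> set R -> set R) : injective e ->
  (forall i A, measurable A -> measurable (h i A)) ->
  (forall i A, Y i @^-1` A = X (e i) @^-1` (h i A)) ->
  mutually_independent X -> mutually_independent Y.
Proof.
move=> einj mh YX indX F A mA.
pose A' j := if [pick i | e i == j] is Some i then h i (A i) else setT.
have A'E i : A' (e i) = h i (A i).
  rewrite /A'; case: pickP => [k /eqP/einj ->//|/(_ i)].
  by rewrite eqxx.
have mA' j : measurable (A' j).
  by rewrite /A'; case: pickP => [k _|_]//; exact: mh.
have := indX [fset e i | i in F]%fset A' mA'.
rewrite big_imfset /=; last by move=> i j _ _ /einj.
under eq_bigr do rewrite A'E -YX.
move=> <-; congr (P _); apply/seteqP; split => w /= H.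
  by move=> _ /imfsetP[i /= iF ->]; rewrite /= A'E; have := H i iF; rewrite YX.
by move=> i iF; rewrite YX; have := H (e i); rewrite A'E; apply; exact: in_imfset.
Qed.

Let measurable_subc (X : {RV P >-> R}) (c : R) :
  measurable_fun setT (fun w => X w - c).
Proof. exact: measurable_funB. Qed.

Definition rv_subc (X : {RV P >-> R}) (c : R) : {RV P >-> R} :=
  HB.pack (fun w => X w - c) (isMeasurableFun.Build _ _ _ _ _ (measurable_subc X c)).

Let measurable_law (X : {RV P >-> R}) :
  measurable_fun setT (X : Omega -> measurableTypeR R).
Proof. exact: (measurable_funPT X). Qed.

(** The law as a measure on [measurableTypeR R], the type that carries Lebesgue
    measure. *)
Definition rv_law (X : {RV P >-> R}) : probability (measurableTypeR R) R :=
  distribution P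
    (HB.pack (X : Omega -> measurableTypeR R)
      (isMeasurableFun.Build _ _ _ _ _ (measurable_law X)) :
      {mfun Omega >-> measurableTypeR R}).

Lemma rv_lawE (X : {RV P >-> R}) A : rv_law X A = P (X @^-1` A).
Proof. by []. Qed.

Lemma measurable_translate (c : R) (A : set R) : measurable A ->
  measurable [set x | A (x - c)].
Proof.
have mf : measurable_fun setT (fun x : R => x - c) by exact: measurable_funB.
by move=> mA; have := mf measurableT _ mA; rewrite setTI.
Qed.

Lemma mu_translate (c : R) (A : set R) : measurable A ->
  mu [set x | A (x - c)] = mu A.
Proof.
move=> mA; rewrite -[X in mu X]setIT -integral_indic//; last exact: measurable_translate.
rewrite -[X in _ = mu X]setIT -integral_indic//.
have mF : measurable_fun [set: R] (fun x => (\1_A x : R)%:E).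
  by apply/measurable_EFinP; exact: measurable_indic.
rewrite -(@ge0_integral_translation R (- c) _ mF)//.
Qed.

Lemma ae_le_of_Lnorm_le (rho : R -> R) (M : R) :
  ('N[mu]_(+oo)[EFin \o rho] <= M%:E)%E -> {ae mu, forall x, rho x <= M}.
Proof.
rewrite unlock => h.
have mu0 : (0 < mu [set: R])%E.
  by rewrite -set_itvNyy lebesgue_measure_itv /= ltry.
move: h; rewrite ifT// => /ess_sup_inf.ess_supP; apply: filterS => x /=.
by rewrite lee_fin; apply: le_trans; exact: ler_norm.
Qed.

Lemma bounded_density_rv_law (X : {RV P >-> R}) (rho : R -> R) (M c : R) :
  is_pdf rho -> ('N[mu]_(+oo)[EFin \o rho] <= M%:E)%E -> has_pdf X rho -> 0 <= M ->
  bounded_density M (rv_law (rv_subc X c)).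
Proof.
move=> [mrho rho0 _] rhoM pdfX M0 A mA; rewrite rv_lawE.
have mAc := measurable_translate c mA.
have -> : P (rv_subc X c @^-1` A) = distribution P X [set x | A (x - c)] by [].
rewrite pdfX// -(mu_translate c mA).
rewrite -integral_cst//.
apply: ae_ge0_le_integral => //.
- by move=> x _; rewrite lee_fin.
- by apply/measurable_EFinP; exact: measurable_funTS.
have [Z [mZ Z0 ZP]] := ae_le_of_Lnorm_le rhoM.
exists Z; split => // x /= nx; apply: ZP => /= xM; apply: nx => _.
by rewrite lee_fin.
Qed.

(** Markov's inequality: beyond [K >= 1] one has [X <= X ^ T], so the probability
    of [X > K] is at most [m / K]. *)
Lemma tight_of_moment (X : {RV P >-> R}) (T m : R) : (forall w, 0 < X w) -> 1 <= T ->
  ('E_P[fun w => (X w `^ T)%R] <= m%:E)%E ->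
  ((2^-1)%:E <= P (X @^-1` `]-oo, (Num.max 1 (2 * m))%R]%classic))%E.
Proof.
move=> X0 T1; rewrite unlock => Xm; set K := Num.max 1 _.
have K1 : 1 <= K by rewrite le_max lexx.
have K0 : 0 < K by exact: lt_le_trans K1.
have mX : measurable_fun setT X by exact: measurable_funPT.
pose D := X @^-1` `]-oo, K]%classic.
have mD : measurable D by rewrite -[D]setTI; exact: mX.
have H : (K%:E * P (~` D) <= m%:E)%E.
  apply: le_trans Xm.
  rewrite -[~` D]setIT -integral_indic//; last exact: measurableC.
  rewrite -ge0_integralZl//; last 2 first.
  - by apply/measurable_EFinP; apply: measurable_indic; exact: measurableC.
  - by rewrite lee_fin ltW.
  apply: ge0_le_integralT => w.
    by rewrite mule_ge0// lee_fin// ltW.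
  rewrite indicE; have [wD|_] := boolP (w \in _); last by rewrite mule0 lee_fin powR_ge0.
  rewrite mule1 lee_fin.
  have KX : K < X w.
    by move: wD; rewrite inE /D /= in_itv /= => /negP; rewrite -ltNge.
  apply: (le_trans (ltW KX)); rewrite -[X in X <= _]powRr1 ?(ltW (X0 w))//.
  by rewrite ler_powR// (le_trans K1)// ltW.
have PD := probability_setC P mD.
have : (P (~` D) <= (2^-1)%:E)%E.
  have fin : P (~` D) \is a fin_num by exact: fin_num_measure (measurableC mD).
  move: H; rewrite -(fineK fin) -EFinM !lee_fin => H.
  have mK : 2 * m <= K by rewrite le_max lexx orbT.
  rewrite -(ler_pM2l K0); apply: (le_trans H); lra.
rewrite PD leeBlDr//; last exact: fin_num_measure.
rewrite (_ : 1%E = (2^-1)%:E + (2^-1)%:E)%E; last by rewrite -EFinD; congr EFin; lra.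
by rewrite leeD2lE.
Qed.

End families.

(** * Energy shift and reversal *)

Section reversal.
Context {F : fieldType} (n : nat).
Implicit Types A B : 'M[F]_n.

Definition rev_mx A : 'M[F]_n := mxsub (@rev_ord n) (@rev_ord n) A.

Lemma rev_mxK : involutive rev_mx.
Proof. by move=> A; apply/matrixP => i j; rewrite !mxE !rev_ordK. Qed.

Lemma rev_mxM A B : rev_mx (A *m B) = rev_mx A *m rev_mx B.
Proof.
apply/matrixP => i j; rewrite !mxE (reindex_inj rev_ord_inj) /=.
by apply: eq_bigr => k _; rewrite !mxE.
Qed.

Lemma rev_mx1 : rev_mx 1%:M = 1%:M.
Proof. by apply/matrixP => i j; rewrite !mxE (inj_eq rev_ord_inj). Qed.

(** Reversing the order of the indices is a ring automorphism; it preserves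
    invertibility both ways, which settles the singular matrices too, for which
    [invmx] is the identity. *)
Lemma invmx_rev A : invmx (rev_mx A) = rev_mx (invmx A).
Proof.
have unit_rev B : B \in unitmx -> rev_mx B \in unitmx.
  by move=> /mulmxV BB; apply: (proj1 (mulmx1_unit (B := rev_mx (invmx B)) _));
    rewrite -rev_mxM BB rev_mx1.
have [uA|nuA] := boolP (A \in unitmx).
  have uA' := unit_rev A uA.
  by rewrite -[LHS]mulmx1 -rev_mx1 -(mulmxV uA) rev_mxM mulKmx.
have nuA' : rev_mx A \notin unitmx.
  by apply: contra nuA => /unit_rev; rewrite rev_mxK.
by rewrite /invmx (negPf nuA) (negPf nuA').
Qed.

Lemma tridiag_rev (al be : nat -> F) :
  tridiag n (fun i => al (n.-1 - i)%N) (fun i => be (n.-2 - i)%N) =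
  rev_mx (tridiag n al be).
Proof.
apply/matrixP => i j; rewrite !mxE (inj_eq rev_ord_inj) /=.
have := ltn_ord i; have := ltn_ord j; case: eqVneq => [->|ij] jn iN.
  by congr al; lia.
have {}ij : (i : nat) <> j by move/val_inj/eqP; exact/negP.
have -> : (n - i.+1 == (n - j.+1).+1)%N = (j == i.+1 :> nat) by apply/eqP/eqP; lia.
have -> : (n - j.+1 == (n - i.+1).+1)%N = (i == j.+1 :> nat) by apply/eqP/eqP; lia.
case: (j =P i.+1 :> nat) => [e|_].
  by rewrite ifF; [congr be; lia|apply/eqP; lia].
by case: (i =P j.+1 :> nat) => [e|//]; congr be; lia.
Qed.

End reversal.

Section resolvent_tridiag.
Context {R : realType}.

Lemma resolvent_tridiag n (a b : nat -> R) (lambda tau : R) :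
  resolvent (jacobi_mx n a b) (lambda +i* tau) =
  invmx (tridiag n (zdiag tau (fun i => a i - lambda)) (zoff b)).
Proof.
congr invmx; apply/matrixP => i j; rewrite !mxE.
have [->|ij] := eqVneq i j.
  rewrite mulr1n /zdiag rmorphB /= -addrA -opprD; congr (_ - _).
  by rewrite /real_complex_def; apply/eqP; rewrite eq_complex /= addr0 add0r !eqxx.
by rewrite mulr0n subr0; case: ifP => // _; case: ifP => // _; rewrite rmorph0.
Qed.

End resolvent_tridiag.

Lemma powR_expR {R : realType} (th s m : R) : 0 < th ->
  th `^ (s * m) = expR (- (- (s * ln th)) * m).
Proof. by move=> th0; rewrite /powR gt_eqF// opprK mulrAC. Qed.

(** * Localization *)

Lemma rev_lt N i : (i < N)%N -> (N.-1 - i < N)%N.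
Proof. by lia. Qed.

(** Both families are coordinatewise images of the original one, up to a permutation
    of the coordinates. *)
Lemma jacobi_independent_transform d (Omega : measurableType d) (R : realType)
    (P : probability Omega R) (N : nat) (a b : nat -> {RV P >-> R}) (c : R) :
  mutually_independent (@jacobi_family d Omega R P N.+1 a b) ->
  mutually_independent (@jacobi_family d Omega R P N.+1
    (fun i => rv_subc (a i) c) b) /\
  mutually_independent (@jacobi_family d Omega R P N.+1
    (fun i => rv_subc (a (N - i)%N) c) (fun i => b (N.-1 - i)%N)).
Proof.
move=> indX; pose h (k : 'I_N.+1 + 'I_N.+1.-1) (A : set R) : set R :=
  if k is inl _ then [set x | A (x - c)] else A.
have mh k A : measurable A -> measurable (h k A).
  by case: k => k //=; exact: measurable_translate.
split.
  apply: (mutually_independent_preimage (e := id) (h := h)) indX => //.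
  by case.
pose e (k : 'I_N.+1 + 'I_N.+1.-1) : 'I_N.+1 + 'I_N.+1.-1 :=
  match k with inl i => inl (rev_ord i) | inr j => inr (rev_ord j) end.
apply: (mutually_independent_preimage (e := e) (h := h)) indX => //.
  by apply: (can_inj (g := e)); case=> i /=; rewrite rev_ordK.
case=> k A //=.
have -> : (N.-1 - k = N - k.+1)%N by lia.
by [].
Qed.

Theorem theorem3p2 (d : measure_display) (Omega : measurableType d)
    (R : realType) (P : probability Omega R)
    (a : nat -> {RV P >-> R}) (b : nat -> nat -> {RV P >-> R})
    (rho : R -> R) (MA MB T s Lambda : R) :
  is_pdf rho ->
  ('N[lebesgue_measure]_(+oo)[EFin \o rho] <= MA%:E)%E ->
  fluctuation_regular rho ->
  (forall i, has_pdf (a i) rho) ->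
  mutually_independent a ->
  (forall n i, (i.+1 < n)%N -> forall w, 0 < b n i w) ->
  (forall n, mutually_independent (@jacobi_family d Omega R P n a (b n))) ->
  1 < T ->
  (forall n i, (i.+1 < n)%N -> ('E_P[fun w => (b n i w `^ T)%R] <= MB%:E)%E) ->
  0 < s -> s < 2^-1 -> 0 < Lambda ->
  exists M gamma Ms : R,
    [/\ 0 < M, 0 < gamma, 0 < Ms,
        forall (n : nat) (lambda : R) (x y : 'I_n),
          - Lambda <= lambda <= Lambda ->
          ('E_P[fun w => (normc (green a (b n) lambda%:C x y w) `^ s)%R]
             <= (M * expR (- gamma * `|x%:R - y%:R|))%R%:E)%E
      & forall (n : nat) (lambda tau : R) (x y : 'I_n),
          - Lambda <= lambda <= Lambda ->
          (y : nat) = 0%N \/ (y : nat) = n.-1 ->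
          ('E_P[fun w => (normc (green a (b n) (lambda +i* tau) y x w) `^ (s / 2))%R]
             <= (Ms * expR (- (gamma / 2) * `|y%:R - x%:R|))%R%:E)%E].
Proof.
move=> pdf_rho rhoM _ pdf_a _ b0 indX T1 bT s0 s2 _.
pose M := Num.max 1 MA; pose B := Num.max 1 (2 * MB).
have M0 : 0 < M by rewrite lt_max ltr01.
have [theta /andP[th0 th1] decay] := jacobi_green_moment_decay B M0.
have sh0 : 0 < s / 2 by lra.
have sh2 : s / 2 < 2^-1 by lra.
have [C C0 decayC] := decay s s0 s2.
have [C' C'0 decayC'] := decay (s / 2) sh0 sh2.
have ln0 : ln theta < 0 by rewrite ln_lt0// th0.
pose nu lambda := rv_law (rv_subc (a 0%N) lambda).
have nuM lambda : bounded_density M (nu lambda).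
  apply: (bounded_density_rv_law _ pdf_rho _ (pdf_a 0%N) (ltW M0)).
  by apply: (le_trans rhoM); rewrite lee_fin le_max lexx orbT.
have law lambda i A : measurable A ->
    P (rv_subc (a i) lambda @^-1` A) = nu lambda A.
  move=> mA; have mA' := measurable_translate lambda mA.
  exact: (etrans (pdf_a i _ mA') (esym (pdf_a 0%N _ mA'))).
have b0' N i : (i < N)%N -> forall w, 0 < b N.+1 i w by move=> iN; exact: b0.
have bB N i : (i < N)%N -> ((2^-1)%:E <= P (b N.+1 i @^-1` `]-oo, B]%classic))%E.
  by move=> iN; apply: (tight_of_moment (b0' N i iN) (ltW T1)); exact: bT.
(* The rate [theta] is the same for the exponents [s] and [s / 2], hence one [gamma]. *)
exists C, (- (s * ln theta)), C'; split => //.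
- by rewrite oppr_gt0 pmulr_rlt0.
- case=> [|N] lambda x y _; first by case: x.
  have [ind _] := jacobi_independent_transform lambda (indX N.+1).
  rewrite -powR_expR// unlock.
  under eq_integral do rewrite /green -[_%:C]/(lambda +i* 0) resolvent_tridiag.
  apply: (decayC _ _ _ _ _ _ _ (nuM lambda) ind) => //; last by left.
  - by move=> i A _ mA; exact: law.
  - exact: b0'.
  - exact: bB.
case=> [|N] lambda tau x y _ yE; first by case: x.
have [ind ind_rev] := jacobi_independent_transform lambda (indX N.+1).
have -> : - (- (s * ln theta) / 2) = - (- (s / 2 * ln theta)) by field.
rewrite -powR_expR// distrC unlock.
case: yE => yE.
  under eq_integral do rewrite /green resolvent_tridiag invmx_tridiag_sym.
  apply: (decayC' _ _ _ _ _ _ _ (nuM lambda) ind) => //; last by right.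
  - by move=> i A _ mA; exact: law.
  - exact: b0'.
  - exact: bB.
have := decayC' _ _ P N _ _ (nu lambda) (nuM lambda) ind_rev _ _ _ tau
  (rev_ord x) (rev_ord y).
have -> : `|(rev_ord x)%:R - (rev_ord y)%:R| = `|x%:R - y%:R| :> R.
  rewrite /= !subSS !natrB -1?ltnS//; rewrite -normrN; congr `|_|; ring.
move=> H; apply: le_trans (H _ _ _ _).
- apply: ge0_le_integralT => w; first by rewrite lee_fin powR_ge0.
  rewrite lee_fin le_eqVlt; apply/orP; left; apply/eqP.
  congr (normc _ `^ _).
  rewrite /green resolvent_tridiag invmx_tridiag_sym.
  rewrite [X in _ = invmx X _ _](tridiag_rev N.+1
    (zdiag tau (fun i => a i w - lambda)) (zoff (fun i => b N.+1 i w))).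
  by rewrite invmx_rev mxE !rev_ordK.
- by move=> i A _ mA; exact: law.
- by move=> i iN; apply: b0'; exact: rev_lt.
- by move=> i iN; apply: bB; exact: rev_lt.
- by right; rewrite /= yE subnn.
Qed.
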